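(* Let $u_t=K(t,x,u,u_1,u_2,u_3)$ be a third order scalar evolution equation, with $K$ smooth and $\partial K/\partial u_3$ nowhere zero. Put $K_i=\partial K/\partial u_i$, $\hat K_2=\frac{2}{3K_3}\big(K_2-X(K_3)\big)$ and $$\kappa=\hat K_2 \, dx+ \Big( -2K_0 +K_1\hat K_2 -\tfrac{1}{2}\big(X(K_3)\hat K_2 ^2 +K_3 \hat K_2^3\big) +X\big(K_3X(\hat K_2)\big)\Big) dt .$$ Then the equation admits a first order symplectic operator (for which it is Hamiltonian) of the form $\mathcal E=2R\,D_x+D_x(R)$, with $R=R(t,x,u,u_1,\dots)$ not identically zero, if and only if $\kappa$ is a trivial conservation law, i.e. $\kappa=d_H f$ for some smooth function $f$ on $\mathcal R^\infty$. Likewise the equation admits a first order variational operator of this form if and only if $\kappa$ is a trivial conservation law. Furthermore, when $\kappa=d_H(\log R)$ (with $R$ a positive function on $\mathcal R^\infty$), the equation $u_t=K$ admits $\mathcal E=2R\,D_x+D_x(R)$ as a first order symplectic operator and as a variational operator.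
   Context: Write $u_0=u$, $u_1=u_x$, $u_i=\partial_x^i u$; smooth functions depend on finitely many coordinates. $\mathcal R^\infty$ is the infinitely prolonged equation manifold of $u_t=K$ with coordinates $(t,x,u,u_1,u_2,\dots)$; $X=\partial_x+\sum_i u_{i+1}\partial_{u_i}$ (total $x$ derivative), $T=\partial_t+\sum_i X^i(K)\partial_{u_i}$, and for a function $f$, $d_Hf=X(f)\,dx+T(f)\,dt$. Variational operator: $J^\infty(\mathbb R^2,\mathbb R)$ has coordinates $(t,x,u_{a,i})_{a,i\ge0}$, $u_{a,i}$ corresponding to $\partial_t^a\partial_x^iu$ ($u_{0,i}=u_i$, $u_{1,0}=u_t$), total derivatives $D_t,D_x$, Euler operator $\mathbf E(L)=\sum_{a,i}(-1)^{a+i}D_x^iD_t^a(\partial L/\partial u_{a,i})$. $\mathcal E=\sum_i r_i(t,x,u,u_1,\dots)D_x^i$ is a variational operator for $u_t=K$ if $\mathcal E(u_t-K)=\mathbf E(L)$ for some $L\in C^\infty(J^\infty(\mathbb R^2,\mathbb R))$. Symplectic operators: let $E=\mathbb R\times J^\infty(\mathbb R,\mathbb R)$ with coordinates $(t,x,u,u_1,u_2,\dots)$, $D_x=\partial_x+\sum_i u_{i+1}\partial_{u_i}$, $\theta^i_E=du_i-u_{i+1}dx$. $\Omega^{r,s}_{t_{sb}}(E)$ ($r=0,1$) is the space of forms that are finite sums of a function on $E$ times $dx$ ($r$ times) wedged with $s$ of the $\theta^i_E$. $D_x$ acts on these forms as a derivation with $D_x(dx)=0$, $D_x(\theta^i_E)=\theta^{i+1}_E$;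 $d^E_V$ is the anti-derivation with $d^E_Vf=\sum_i(\partial f/\partial u_i)\theta^i_E$, $d_V^E(dx)=0$, $d^E_V\theta^i_E=0$. For $\Sigma\in\Omega^{1,s}_{t_{sb}}(E)$, $s\ge1$, $I_E(\Sigma)=\frac1s\theta^0_E\wedge\sum_i(-D_x)^i(\partial_{u_i}\lrcorner\,\Sigma)$, and $\delta^E_V=I_E\circ d^E_V$. A differential operator $\mathcal S=\sum s_iD_x^i$ is symplectic if it is skew-adjoint ($\mathcal S^*=-\mathcal S$ where $\mathcal S^*(f)=\sum(-D_x)^i(s_if)$), and $\Sigma=dx\wedge\theta^0_E\wedge\sum_i s_i\theta^i_E$ satisfies $\Sigma\ne0$ and $\delta^E_V\Sigma=0$. The equation is Hamiltonian for $\mathcal S$ if, with $T=\partial_t+\sum_i D_x^i(K)\partial_{u_i}$ on $E$, $I_E\circ\pi^{1,2}\circ\mathcal L_T\Sigma=0$, where $\mathcal L_T$ is the Lie derivative and $\pi^{1,2}$ keeps only the $dx\wedge\theta^i_E\wedge\theta^j_E$ terms in the coframe $dt,dx,\theta^i_E$. The equation ''admits'' a symplectic operator if it is Hamiltonian for it. Operators with coefficients in $(t,x,u,u_1,\dots)$ are regarded on either space. *)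

(* Defs.v *)
From HB Require Import structures.
From mathcomp Require Import all_boot all_order all_algebra.
From mathcomp Require Import all_classical all_reals all_analysis.

Set Implicit Arguments.
Unset Strict Implicit.
Unset Printing Implicit Defensive.

Import Order.TTheory GRing.Theory Num.Theory.
Import numFieldNormedType.Exports.

Local Open Scope classical_set_scope.
Local Open Scope ring_scope.

Inductive jcoord (I : Type) : Type := ct | cx | cu of I.
Arguments ct {I}.
Arguments cx {I}.
Arguments cu {I} i.

Definition jcoord_code (I : Type) (c : jcoord I) : option (option I) :=
  match c with ct => None | cx => Some None | cu i => Some (Some i) end.

Definition jcoord_decode (I : Type) (o : option (option I)) : jcoord I :=
  match o with None => ct | Some None => cx | Some (Some i) => cu i end.

Lemma jcoord_codeK (I : Type) : cancel (@jcoord_code I) (@jcoord_decode I).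
Proof. by case. Qed.

HB.instance Definition _ (I : eqType) :=
  Equality.copy (jcoord I) (can_type (@jcoord_codeK I)).

(* Functions on a space of points [C -> R] with coordinates indexed by [C].   *)
Section SmoothFunctions.
Context {R : realType} {C : eqType}.

Definition pd (c : C) (f : (C -> R) -> R) : (C -> R) -> R :=
  fun p => derive1 (fun s : R => f (@dfwith C (fun=> R) p c s)) (p c).

Definition pderivable (c : C) (f : (C -> R) -> R) : Prop :=
  forall p : C -> R,
    derivable (fun s : R => f (@dfwith C (fun=> R) p c s)) (p c) 1.

Definition depends_on (S : seq C) (f : (C -> R) -> R) : Prop :=
  forall p q : C -> R, {in S, p =1 q} -> f p = f q.

(* A C^oo function of finitely many coordinates: all iterated partial         *)
(* derivatives exist and are continuous. For a function depending on finitely *)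
(* many coordinates, continuity for pointwise convergence is continuity in    *)
(* these coordinates.                                                         *)
Definition smooth (f : (C -> R) -> R) : Prop :=
  (exists S : seq C, depends_on S f) /\
  (forall l : seq C,
     continuous (foldr pd f l : {ptws C -> R} -> R) /\
     (forall c : C, pderivable c (foldr pd f l))).

(* The operator \sum_i S_i D^i, given by its list of coefficients S.          *)
Definition apply_op (D : ((C -> R) -> R) -> (C -> R) -> R)
    (S : seq ((C -> R) -> R)) (f : (C -> R) -> R) : (C -> R) -> R :=
  fun p => \sum_(i < size S) nth (cst 0) S i p * iter i D f p.

(* Its formal adjoint, f |-> \sum_i (- D)^i (S_i f).                          *)
Definition apply_adj (D : ((C -> R) -> R) -> (C -> R) -> R)
    (S : seq ((C -> R) -> R)) (f : (C -> R) -> R) : (C -> R) -> R :=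
  fun p => \sum_(i < size S)
    (-1) ^+ i * iter i D (fun q => nth (cst 0) S i q * f q) p.

Definition smooth_coefs (S : seq ((C -> R) -> R)) : Prop :=
  forall i : nat, smooth (nth (cst 0) S i).

End SmoothFunctions.

(* [ecoord] indexes the coordinates (t, x, u_0, u_1, ...), which are shared   *)
(* by the prolonged equation R^oo and by E = R x J^oo(R, R); the operators X  *)
(* on R^oo and D_x on E have the same expression, and so do the two T.        *)
(* [jcoord2] indexes (t, x, u_(a,i)), the coordinates of J^oo(R^2, R).        *)
(* The infinite sums over setT below have finitely many nonzero terms when    *)
(* applied to smooth functions and to forms in Omega^(r,s).                   *)
Notation ecoord := (jcoord nat).
Notation jcoord2 := (jcoord (nat * nat)%type).
Notation efun R := ((ecoord -> R%type) -> R%type).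
Notation jfun R := ((jcoord2 -> R%type) -> R%type).

Section EquationManifold.
Context {R : realType}.

Definition Dx (f : efun R) : efun R := fun p =>
  pd cx f p + \sum_(i \in [set: nat]) p (cu i.+1) * pd (cu i) f p.

Definition Tvf (K f : efun R) : efun R := fun p =>
  pd ct f p + \sum_(i \in [set: nat]) iter i Dx K p * pd (cu i) f p.

(* The pair (a, b) stands for the horizontal form a dx + b dt.                *)
Definition dH (K f : efun R) : efun R * efun R := (Dx f, Tvf K f).

Definition K2hat (K : efun R) : efun R := fun p =>
  2 / (3 * pd (cu 3%N) K p) * (pd (cu 2%N) K p - Dx (pd (cu 3%N) K) p).

Definition kappa (K : efun R) : efun R * efun R :=
  (K2hat K,
   fun p =>
     - 2 * pd (cu 0%N) K p + pd (cu 1%N) K p * K2hat K p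
     - 2^-1 * (Dx (pd (cu 3%N) K) p * K2hat K p ^+ 2
               + pd (cu 3%N) K p * K2hat K p ^+ 3)
     + Dx (fun q => pd (cu 3%N) K q * Dx (K2hat K) q) p).

Definition trivial_claw (K : efun R) (k : efun R * efun R) : Prop :=
  exists f : efun R, smooth f /\ k = dH K f.

End EquationManifold.

Section Forms.
Context {R : realType}.

(* A form w on E is given by its components w [:: g1; ..; gk] =               *)
(* w(e_g1, .., e_gk) in the frame e_ct = d/dt, e_cx = D_x, e_(cu i) = d/du_i, *)
(* which is dual to the coframe dt, dx, theta^i = du_i - u_(i+1) dx.          *)
Definition form : Type := seq ecoord -> efun R.

Definition zero_form : form := fun _ _ => 0.
Definition add_form (w1 w2 : form) : form := fun s p => w1 s p + w2 s p.
Definition opp_form (w : form) : form := fun s p => - w s p.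

(* 1-forms are given by their coefficients in the coframe.                    *)
Definition coframe (g : ecoord) : ecoord -> efun R := fun h _ => (h == g)%:R.
Definition dt := coframe ct.
Definition dx := coframe cx.
Definition theta (i : nat) := coframe (cu i).

Definition form_of1 (a : ecoord -> efun R) : form := fun s =>
  if s is [:: g] then a g else cst 0.

(* Exterior product of a 1-form by a form, with the determinant convention    *)
(* (a1 /\ .. /\ ak)(v1, .., vk) = det (ai(vj)).                               *)
Definition wedge (a : ecoord -> efun R) (w : form) : form := fun s p =>
  \sum_(j < size s)
    (-1) ^+ j * a (nth ct s j) p * w (take j s ++ drop j.+1 s) p.

(* Interior product by a vector of the frame.                                 *)
Definition iprod (g : ecoord) (w : form) : form := fun s => w (g :: s).

(* The derivation of forms extending D_x with D_x dt = 0, D_x dx = 0,         *)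
(* D_x theta^i = theta^(i+1), written on components.                          *)
Definition DxF (w : form) : form := fun s p =>
  Dx (w s) p +
  \sum_(j < size s)
    (if nth ct s j is cu i.+1 then w (set_nth ct s j (cu i)) p else 0).

(* On f * eta with eta a product of coframe elements this is                  *)
(* \sum_i (df/du_i) theta^i /\ eta, since dV kills the coframe.               *)
Definition dV (w : form) : form := fun s p =>
  \sum_(i \in [set: nat]) wedge (theta i) (fun s' => pd (cu i) (w s')) s p.

(* Exterior derivative: df = f_t dt + D_x f dx + \sum_i f_(u_i) theta^i,      *)
(* d dt = d dx = 0 and d theta^i = dx /\ theta^(i+1).                         *)
Definition dE (w : form) : form :=
  add_form (wedge dt (fun s => pd ct (w s)))
    (add_form (wedge dx (DxF w)) (dV w)).

Definition IE (s : nat) (w : form) : form := fun l p =>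
  s%:R^-1 *
  wedge (theta 0)
    (fun l' q => \sum_(i \in [set: nat])
       iter i (fun h => opp_form (DxF h)) (iprod (cu i) w) l' q) l p.

(* deltaV on Omega^(1,s).                                                     *)
Definition deltaV (s : nat) (w : form) : form := IE s.+1 (dV w).

Definition iprodT (K : efun R) (w : form) : form := fun s p =>
  iprod ct w s p +
  \sum_(i \in [set: nat]) iter i Dx K p * iprod (cu i) w s p.

(* Lie derivative along T, by Cartan's formula.                               *)
Definition LieT (K : efun R) (w : form) : form :=
  add_form (iprodT K (dE w)) (dE (iprodT K w)).

Definition pi12 (w : form) : form := fun s =>
  if [&& size s == 3%N, count_mem cx s == 1%N & count_mem ct s == 0%N]
  then w s else cst 0.

Definition Sigma_of (S : seq (efun R)) : form :=
  wedge dx (wedge (theta 0)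
    (form_of1 (fun g p =>
       \sum_(i < size S) nth (cst 0) S i p * theta i g p))).

Definition skew_adjoint (S : seq (efun R)) : Prop :=
  forall f : efun R, smooth f ->
    forall p, apply_adj Dx S f p = - apply_op Dx S f p.

Definition is_symplectic (S : seq (efun R)) : Prop :=
  [/\ smooth_coefs S, skew_adjoint S,
      Sigma_of S <> zero_form & deltaV 2 (Sigma_of S) = zero_form].

Definition is_hamiltonian_for (K : efun R) (S : seq (efun R)) : Prop :=
  IE 2 (pi12 (LieT K (Sigma_of S))) = zero_form.

Definition admits_symplectic (K : efun R) (S : seq (efun R)) : Prop :=
  is_symplectic S /\ is_hamiltonian_for K S.

End Forms.

Section Variational.
Context {R : realType}.

Definition jDx (f : jfun R) : jfun R := fun p =>
  pd cx f p +
  \sum_(ai \in [set: nat * nat]) p (cu (ai.1, ai.2.+1)) * pd (cu ai) f p.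

Definition jDt (f : jfun R) : jfun R := fun p =>
  pd ct f p +
  \sum_(ai \in [set: nat * nat]) p (cu (ai.1.+1, ai.2)) * pd (cu ai) f p.

Definition euler (L : jfun R) : jfun R := fun p =>
  \sum_(ai \in [set: nat * nat])
    (-1) ^+ (ai.1 + ai.2)%N * iter ai.2 jDx (iter ai.1 jDt (pd (cu ai) L)) p.

(* Functions of (t, x, u, u_1, ...) viewed on J^oo(R^2, R), with              *)
(* u_i = u_(0,i).                                                             *)
Definition to_jet (f : efun R) : jfun R := fun p =>
  f (fun c => match c with ct => p ct | cx => p cx | cu i => p (cu (0%N, i)) end).

Definition admits_variational (K : efun R) (S : seq (efun R)) : Prop :=
  smooth_coefs S /\
  exists L : jfun R, smooth L /\
    apply_op jDx (map to_jet S) (fun p => p (cu (1%N, 0%N)) - to_jet K p)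
    = euler L.

End Variational.

(* The operator 2 r D_x + D_x(r), as its list of coefficients.                *)
Definition first_order_op {R : realType} (r : efun R) : seq (efun R) :=
  [:: Dx r; (fun p => 2 * r p)].

(* Main.v *)
Require Import Defs.
From HB Require Import structures.
From mathcomp Require Import all_boot all_order all_algebra.
From mathcomp Require Import all_classical all_reals all_analysis.
From mathcomp Require Import ring lra zify.

Set Implicit Arguments.
Unset Strict Implicit.
Unset Printing Implicit Defensive.

Import Order.TTheory GRing.Theory Num.Theory.
Import numFieldNormedType.Exports.

Local Open Scope classical_set_scope.
Local Open Scope ring_scope.

(** Write [D] for the total [x]-derivative, [h] and [k] for the components of
    [kappa], and [E = 2 R D + D(R)].

    The whole statement turns on one linear system for [R], namely
    [D R = R h] and [T R = R k] (lemma [log_eqsP]), which says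
    [kappa = d_H (log R)] where [R] does not vanish. It is reached twice.

    Symplectic side. The form attached to [E] is [Sigma = 2 R dx theta^0 theta^1].
    Modulo [D]-exact forms its Lie derivative along [T] has the normal form
    [2 dx theta^0 (a theta^1 + b theta^3)], and [b = 0] is the first equation of
    the system while [a = 0] is then the second; the source form [I_E] sees the
    class modulo [D]-exact forms faithfully, so the equation is Hamiltonian for
    [E] if and only if [a = b = 0] (lemma [hamiltonianE]).

    Variational side. Put [G = u_t - K]. The linearization of an Euler-Lagrange
    expression is self-adjoint (lemma [helmholtz]). For [E G] the defect of
    self-adjointness is the same skew operator with coefficients [a] and [b] plus
    terms that contain [G] or its [x]-derivatives
    (lemma [self_adjoint_defect]). On solutions of the equation the latter vanish,
    so a variational operator also satisfies [a = b = 0]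
    (lemma [variational_necessary]).

    From the system to [kappa = d_H f]. Commuting the system with the partial
    derivatives shows that every partial derivative of [R] is a multiple of [R].
    Along coordinate lines [R] then solves linear ordinary differential equations,
    so it vanishes nowhere as soon as it is not zero, and [f = (1/2) log (R^2)]
    is globally defined and smooth (lemma [log_eqs_trivial]).

    From [kappa = d_H (log R)] to the operators. Order by order, [D (log R) = h]
    bounds the order of [log R] by three and expresses its two highest derivatives
    through [K]; the coefficient of [u_5] in [T (log R) = k] gives the one
    further relation [R_2 = D (R_3)] (lemma [log_symplectic]). This is the relation
    under which [dV Sigma] is [D]-exact, so that [E] is symplectic
    (lemma [deltaV_eq0]), and under which the terms containing [G] cancel
    in the defect of self-adjointness (lemma [bracket2_eq0]). The linearization of
    [E G] being self-adjoint, [E G] is the Euler-Lagrange expression of the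
    Lagrangian [u \int_0^1 (E G)(s u) ds] (lemma [self_adjoint_euler]).

    Smooth functions are bundled into a commutative ring with the partial
    derivatives as commuting derivations, so that the computations above become
    polynomial identities in finitely many derivatives. *)

(** * Partial derivatives in infinitely many coordinates *)

Section CoordinateLines.
Context {R : realType} {C : eqType}.
Implicit Types (p q : C -> R) (c d : C) (s : R) (f g : (C -> R) -> R).

Definition upd p c s : C -> R := @dfwith C (fun=> R) p c s.

Lemma updE p c s d : upd p c s d = if d == c then s else p d.
Proof.
rewrite /upd; have [->|dc] := eqVneq d c; first by rewrite dfwithin.
by rewrite dfwithout// eq_sym.
Qed.

Lemma upd_id p c : upd p c (p c) = p.
Proof. by apply/funext => d; rewrite updE; case: eqP => [->|]. Qed.

Lemma upd_upd p c s s' : upd (upd p c s) c s' = upd p c s'.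
Proof. by apply/funext => d; rewrite !updE; case: eqP. Qed.

Lemma updC p c d s s' : c != d -> upd (upd p c s) d s' = upd (upd p d s') c s.
Proof.
move=> cd; apply/funext => e; rewrite !updE.
by have [->|//] := eqVneq e d; rewrite eq_sym (negbTE cd).
Qed.

Lemma pd_updE c f p s : pd c f (upd p c s) = derive1 (fun s => f (upd p c s)) s.
Proof.
rewrite /pd -/(upd _ c _) updE eqxx; congr (derive1 _ _).
by apply/funext => s'; rewrite -/(upd _ c _) upd_upd.
Qed.

Lemma is_derive_upd c f p s : pderivable c f ->
  is_derive s 1 (fun s => f (upd p c s)) (pd c f (upd p c s)).
Proof.
move=> df; rewrite pd_updE derive1E; apply: DeriveDef => //.
have := df (upd p c s); rewrite -/(upd _ c) updE eqxx.
by under eq_fun do rewrite -/(upd _ c _) upd_upd.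
Qed.

Lemma pd_eq c f p (l : R) :
  is_derive (p c) 1 (fun s => f (upd p c s)) l -> pd c f p = l.
Proof. by move=> df; rewrite /pd derive1E; exact: derive_val. Qed.

Lemma cvg_pointwise (T : Type) (F : set_system T) (h : T -> C -> R) q :
  Filter F -> (forall c, h ^~ c @ F --> q c) ->
  h @ F --> (q : {ptws C -> R}).
Proof.
move=> FF hq; apply/cvg_sup => c; apply/cvg_image.
  apply/seteqP; split=> // y _; exists (fun=> y) => //.
move=> A /hq /= FA; exists [set u : C -> R | A (u c)] => //.
by apply/seteqP; split=> [_ [u Au <-]//|y Ay]; exists (fun=> y).
Qed.

Lemma cvg_coord p c : (fun q : {ptws C -> R} => q c) @ (p : {ptws C -> R}) --> p c.
Proof. exact: (@proj_continuous C (fun=> R) c p). Qed.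

Definition contin f := continuous (f : {ptws C -> R} -> R).

(** Mean-value arguments evaluate partial derivatives at intermediate points
    that need not depend continuously on anything, so continuity for pointwise
    convergence is used in epsilon-delta form. It is tested on the filter of the
    points that differ from [p] only, and little, in the coordinates of [S]. *)
Lemma contin_eps f S p (e : R) : contin f -> depends_on S f -> 0 < e ->
  exists2 d : R, 0 < d & forall q, {in S, forall c, `|q c - p c| < d} ->
    `|f q - f p| < e.
Proof.
move=> cf dS e0.
pose B (d : R) := [set q : C -> R | forall c,
  (c \in S -> `|q c - p c| < d) /\ (c \notin S -> q c = p c)].
pose F : set_system (C -> R) := filter_from [set d : R | 0 < d] B.
have FF : Filter F.
  apply: filter_from_filter; first by exists 1 => /=.
  move=> i j i0 j0; exists (Num.min i j); first by rewrite /= lt_min i0.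
  move=> q Bq; split=> c; have [qS qN] := Bq c; split=> //;
    by move=> /qS; rewrite lt_min => /andP[].
have Fp : F --> (p : {ptws C -> R}).
  rewrite -[X in X --> _]/(id @ F); apply: cvg_pointwise => c.
  apply/cvgrPdist_lt => d d0 /=; exists d => // q /(_ c) [qS qN].
  have [/qS|/qN] := boolP (c \in S); first by rewrite distrC.
  by move=> /= ->; rewrite subrr normr0.
have /cvgrPdist_lt/(_ e e0) : f @ F --> f p.
  exact: (cvg_comp _ _ Fp (cf p)).
move=> [d /= d0 dB]; exists d => // q qd.
have /dS-> : {in S, q =1 fun c => if c \in S then q c else p c}.
  by move=> c /= ->.
rewrite distrC; apply: dB => c; split=> [cS|/negbTE->//].
by rewrite cS; exact: qd.
Qed.

End CoordinateLines.

(** * Operations on smooth functions *)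

Section SmoothClosure.
Context {R : realType} {C : eqType}.
Implicit Types (p q : C -> R) (c d : C) (s : R) (f g : (C -> R) -> R).

Lemma depends_on_sub (S S' : seq C) f :
  {subset S <= S'} -> depends_on S f -> depends_on S' f.
Proof. by move=> SS' dS p q pq; apply: dS => c /SS'; exact: pq. Qed.

Lemma pd_indep S f c : depends_on S f -> c \notin S -> pd c f = cst 0.
Proof.
move=> dS cS; apply/funext => p; apply: pd_eq.
rewrite (_ : (fun s => _) = cst (f p)); first exact: is_derive_cst.
apply/funext => s; apply: dS => d dS; rewrite updE.
by case: eqP => // dc; rewrite -dc dS in cS.
Qed.

Lemma depends_on_pd S f c : depends_on S f -> depends_on S (pd c f).
Proof.
move=> dS; have [cS|cS] := boolP (c \in S); last by rewrite (pd_indep dS cS).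
move=> p q pq; rewrite /pd (pq c cS); congr (derive1 _ _).
apply/funext => s; apply: dS => d dS.
by rewrite -!/(upd _ c s) !updE; case: eqP => // _; exact: pq.
Qed.

Lemma smooth_dep f : smooth f -> exists S, depends_on S f.
Proof. by case. Qed.

Lemma smooth_contin f : smooth f -> contin f.
Proof. by case=> _ /(_ [::]) []. Qed.

Lemma smooth_pderivable f c : smooth f -> pderivable c f.
Proof. by case=> _ /(_ [::]) []. Qed.

Lemma smooth_pd f c : smooth f -> smooth (pd c f).
Proof.
case=> -[S dS] sf; split; first by exists S; exact: depends_on_pd.
by move=> l; have := sf (rcons l c); rewrite foldr_rcons.
Qed.

(** Smoothness speaks of all iterated partial derivatives; a class of functions
    stable under partial derivatives only has to be examined at order one. *)
Lemma smooth_coind (P : ((C -> R) -> R) -> Prop) :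
  (forall f, P f -> [/\ exists S, depends_on S f, contin f,
     forall c, pderivable c f & forall c, P (pd c f)]) ->
  forall f, P f -> smooth f.
Proof.
move=> PP f Pf; split; first by have [] := PP _ Pf.
move=> l; suff : P (foldr pd f l) by case/PP => _ cf df _; split.
by elim: l => [//|c l /PP [_ _ _ IH]] /=; exact: IH.
Qed.

Lemma is_derive_pd c f p : pderivable c f ->
  is_derive (p c) 1 (fun s => f (upd p c s)) (pd c f p).
Proof.
by move=> df; have := @is_derive_upd R C c f p (p c) df; rewrite upd_id.
Qed.

Lemma pderivable_ex c f :
  (forall p, exists l, is_derive (p c) 1 (fun s => f (upd p c s)) l) ->
  pderivable c f.
Proof. by move=> df p; have [l []] := df p. Qed.

(** Smooth functions are closed under the pointwise operations below; all
    closure properties are obtained at once, because the class of expressions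
    built from smooth functions with these operations is stable under partial
    derivatives. *)
Inductive elementary : ((C -> R) -> R) -> Prop :=
| elem_smooth f : smooth f -> elementary f
| elem_cst a : elementary (cst a)
| elem_coord c : elementary (fun p => p c)
| elem_add f g : elementary f -> elementary g -> elementary (fun p => f p + g p)
| elem_mul f g : elementary f -> elementary g -> elementary (fun p => f p * g p)
| elem_exp f : elementary f -> elementary (fun p => expR (f p))
| elem_inv f : elementary f -> (forall p, f p != 0) ->
    elementary (fun p => (f p)^-1)
| elem_ln f : elementary f -> (forall p, 0 < f p) ->
    elementary (fun p => ln (f p)).

Lemma is_derive_upd_D f g c : pderivable c f -> pderivable c g ->
  forall p, is_derive (p c) 1 (fun s => f (upd p c s) + g (upd p c s))
   (pd c f p + pd c g p).
Proof.
by move=> df dg p; apply: is_deriveD; exact: is_derive_pd.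
Qed.

Lemma is_derive_upd_M f g c : pderivable c f -> pderivable c g ->
  forall p, is_derive (p c) 1 (fun s => f (upd p c s) * g (upd p c s))
   (f p * pd c g p + g p * pd c f p).
Proof.
move=> df dg p; have := is_deriveM (is_derive_pd p df) (is_derive_pd p dg).
by rewrite upd_id.
Qed.

Lemma is_derive_upd_exp f c : pderivable c f ->
  forall p, is_derive (p c) 1 (fun s => expR (f (upd p c s)))
   (expR (f p) * pd c f p).
Proof.
move=> df p; apply: (@is_derive1_comp _ (@expR R)); last exact: is_derive_pd.
by rewrite upd_id; exact: is_derive_expR.
Qed.

Lemma is_derive_upd_inv f c : pderivable c f -> (forall p, f p != 0) ->
  forall p, is_derive (p c) 1 (fun s => (f (upd p c s))^-1)
   (- ((f p)^-1 * (f p)^-1) * pd c f p).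
Proof.
move=> df f0 p.
have := @is_deriveV R (fun s => f (upd p c s)) (p c) (pd c f p) 1.
rewrite upd_id => /(_ (f0 _) (is_derive_pd p df)).
by rewrite expr2 invfM.
Qed.

Lemma is_derive_upd_ln f c : pderivable c f -> (forall p, 0 < f p) ->
  forall p, is_derive (p c) 1 (fun s => ln (f (upd p c s)))
   ((f p)^-1 * pd c f p).
Proof.
move=> df f0 p; apply: (@is_derive1_comp _ (@ln R)); last exact: is_derive_pd.
by rewrite upd_id; exact: is_derive1_ln.
Qed.

Lemma is_derive_upd_coord c d : forall p, is_derive (p d) 1 (fun s => upd p d s c)
  ((c == d)%:R : R).
Proof.
move=> p; rewrite (_ : (fun s => _) = if c == d then id else cst (p c)).
  by case: eqP => _; [exact: is_derive_id|exact: is_derive_cst].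
by apply/funext => s; rewrite updE; case: eqP.
Qed.

Lemma elementary_smooth f : elementary f -> smooth f.
Proof.
apply: smooth_coind => {}f; elim=> {f}.
- move=> f sf; split; [exact: smooth_dep|exact: smooth_contin| |].
    by move=> c; exact: smooth_pderivable.
  by move=> c; apply: elem_smooth; exact: smooth_pd.
- move=> a; split=> [||c|c].
  + by exists [::].
  + by move=> p; exact: (@cst_continuous {ptws C -> R} R a p).
  + by apply: pderivable_ex => p; exists 0; exact: is_derive_cst.
  + rewrite (_ : pd c _ = cst 0); first exact: elem_cst.
    by apply/funext => p; apply: pd_eq; exact: is_derive_cst.
- move=> c; split=> [||d|d].
  + by exists [:: c] => p q; apply; rewrite mem_head.
  + by move=> p; exact: cvg_coord.
  + by apply: pderivable_ex => p; eexists; exact: is_derive_upd_coord.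
  + rewrite (_ : pd d _ = cst (c == d)%:R); first exact: elem_cst.
    by apply/funext => p; apply: pd_eq; exact: is_derive_upd_coord.
- move=> f g ef [[S dS] cf df ef'] eg [[S' dS'] cg dg eg']; split=> [||c|c].
  + exists (S ++ S') => p q pq; congr (_ + _); [apply: dS|apply: dS'];
      by move=> c cS; apply: pq; rewrite mem_cat cS ?orbT.
  + by move=> p; exact: (cvgD (cf p) (cg p)).
  + by apply: pderivable_ex => p; eexists; exact: is_derive_upd_D.
  + rewrite (_ : pd c _ = (fun p => pd c f p + pd c g p)); first exact: elem_add.
    by apply/funext => p; apply: pd_eq; exact: is_derive_upd_D.
- move=> f g ef [[S dS] cf df ef'] eg [[S' dS'] cg dg eg']; split=> [||c|c].
  + exists (S ++ S') => p q pq; congr (_ * _); [apply: dS|apply: dS'];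
      by move=> c cS; apply: pq; rewrite mem_cat cS ?orbT.
  + by move=> p; exact: (cvgM (cf p) (cg p)).
  + by apply: pderivable_ex => p; eexists; exact: is_derive_upd_M.
  + rewrite (_ : pd c _ = (fun p => f p * pd c g p + g p * pd c f p)).
      by apply: elem_add; exact: elem_mul.
    by apply/funext => p; apply: pd_eq; exact: is_derive_upd_M.
- move=> f ef [[S dS] cf df ef']; split=> [||c|c].
  + by exists S => p q pq; congr (expR _); exact: dS.
  + by move=> p; exact: (cvg_comp _ _ (cf p) (@continuous_expR R (f p))).
  + by apply: pderivable_ex => p; eexists; exact: is_derive_upd_exp.
  + rewrite (_ : pd c _ = (fun p => expR (f p) * pd c f p)).
      by apply: elem_mul => //; exact: elem_exp.
    by apply/funext => p; apply: pd_eq; exact: is_derive_upd_exp.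
- move=> f ef [[S dS] cf df ef'] f0; split=> [||c|c].
  + by exists S => p q pq; congr (_^-1); exact: dS.
  + by move=> p; exact: (cvgV (f0 p) (cf p)).
  + by apply: pderivable_ex => p; eexists; exact: is_derive_upd_inv.
  + rewrite (_ : pd c _ =
      (fun p => (cst (-1) p * ((f p)^-1 * (f p)^-1)) * pd c f p)).
      apply: elem_mul => //; apply: elem_mul; first exact: elem_cst.
      by apply: elem_mul; exact: elem_inv.
    by apply/funext => p; apply: pd_eq; rewrite mulN1r; exact: is_derive_upd_inv.
- move=> f ef [[S dS] cf df ef'] f0; split=> [||c|c].
  + by exists S => p q pq; congr (ln _); exact: dS.
  + by move=> p; exact: (cvg_comp _ _ (cf p) (continuous_ln (f0 p))).
  + by apply: pderivable_ex => p; eexists; exact: is_derive_upd_ln.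
  + rewrite (_ : pd c _ = (fun p => (f p)^-1 * pd c f p)).
      by apply: elem_mul => //; apply: elem_inv => // p; rewrite gt_eqF.
    by apply/funext => p; apply: pd_eq; exact: is_derive_upd_ln.
Qed.

End SmoothClosure.

(** * Symmetry of second derivatives *)

Section Schwarz.
Context {R : realType} {C : eqType}.
Implicit Types (p q : C -> R) (c d : C) (f g : (C -> R) -> R).

(** Locating the intermediate point by its distance to [a] spares any
    comparison of [a] with [b]. *)
Lemma MVT_everywhere (g dg : R -> R) (a b : R) :
  (forall s : R, is_derive s 1 g (dg s)) ->
  exists2 xi, `|xi - a| <= `|b - a| & g b - g a = dg xi * (b - a).
Proof.
move=> dg'.
have cg (i j : R) : {within `[i, j], continuous g}.
  by apply: derivable_within_continuous => s _; have [] := dg' s.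
have [ab|/ltW ba] := leP a b.
- have [xi] := MVT_segment ab (fun s _ => dg' s) (cg a b).
  rewrite in_itv /= => /andP[h1 h2] e; exists xi => //.
  by rewrite !ger0_norm ?subr_ge0 // lerD2r.
- have [xi] := MVT_segment ba (fun s _ => dg' s) (cg b a).
  rewrite in_itv /= => /andP[h1 h2] e; exists xi; last first.
    by rewrite -opprB e -mulrN opprB.
  by rewrite !ler0_norm ?subr_le0 // lerN2 lerD2r.
Qed.

Lemma MVT_upd f c p (a b : R) : pderivable c f ->
  exists2 xi, `|xi - a| <= `|b - a| &
    f (upd p c b) - f (upd p c a) = pd c f (upd p c xi) * (b - a).
Proof. by move=> df; exact: (MVT_everywhere a b (fun s => is_derive_upd p s df)). Qed.

(** The double difference is the increment of a difference in [d] along the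
    coordinate [c]; the mean value theorem applies to it in [c], then in [d]. *)
Lemma mixed_difference f c d p (h k : R) : c != d -> 
  pderivable c f -> pderivable d (pd c f) ->
  exists q, [/\ forall e, `|q e - p e| <= Num.max `|h| `|k| &
    f (upd (upd p c (p c + h)) d (p d + k)) - f (upd p c (p c + h))
    - (f (upd p d (p d + k)) - f p)
    = pd d (pd c f) q * k * h].
Proof.
move=> cd dc ddc; have dc' : d != c by rewrite eq_sym.
pose g s := f (upd (upd p d (p d + k)) c s) - f (upd p c s).
pose dg s := pd c f (upd (upd p d (p d + k)) c s) - pd c f (upd p c s).
have Dg (s : R) : is_derive s 1 g (dg s).
  by apply: is_deriveB; exact: is_derive_upd.
have [xi xi_le eg] := MVT_everywhere (p c) (p c + h) Dg.
have [eta eta_le eh] := MVT_upd (upd p c xi) (p d) (p d + k) ddc.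
exists (upd (upd p c xi) d eta); split.
  move=> e; rewrite !updE le_max; case: eqP => [->|_].
    by move: eta_le; rewrite [p d + k]addrC addrK => ->; rewrite orbT.
  case: eqP => [->|_]; last by rewrite subrr normr0 normr_ge0.
  by move: xi_le; rewrite [p c + h]addrC addrK => ->.
have upd_same (r : C -> R) c1 s : r c1 = s -> upd r c1 s = r.
  by move=> <-; exact: upd_id.
have -> : f (upd (upd p c (p c + h)) d (p d + k)) - f (upd p c (p c + h))
    - (f (upd p d (p d + k)) - f p) = g (p c + h) - g (p c).
  rewrite /g upd_id (updC p _ _ cd) (upd_same (upd p d _) c (p c)).
    by ring.
  by rewrite updE (negbTE cd).
rewrite eg (_ : p c + h - p c = h); last by ring.
congr (_ * _).
rewrite /dg (updC p _ _ dc').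
have <- : upd (upd p c xi) d (p d) = upd p c xi.
  by apply: upd_same; rewrite updE (negbTE dc').
by rewrite !upd_upd eh; congr (_ * _); ring.
Qed.

Let cancel_square (z z' a b h : R) :
  h != 0 -> z = a * h * h -> z' = b * h * h -> z = z' -> a = b.
Proof. by move=> h0 -> -> /(mulIf h0)/(mulIf h0). Qed.

Let swap_diff (x y z w : R) : x - y - (z - w) = x - z - (y - w).
Proof. ring. Qed.

Let dist_half_le (x a b e : R) :
  `|x - a| < e / 2 -> `|x - b| < e / 2 -> `|a - b| <= e.
Proof.
move=> xa xb; rewrite (splitr e) -(subrKA x); apply: le_trans (ler_normD _ _) _.
by rewrite lerD// ltW// distrC.
Qed.

(** Both mixed derivatives are limits of the same double difference quotient. *)
Lemma pdC f c d : smooth f -> pd c (pd d f) = pd d (pd c f).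
Proof.
move=> sf; have [->//|cd] := eqVneq c d.
have [S dS] := smooth_dep sf.
apply/funext => p; apply/eqP; rewrite -subr_eq0 -normr_le0.
apply/ler_addgt0Pr => e e0; rewrite add0r.
have e20 : 0 < e / 2 by rewrite divr_gt0.
have dep c1 c2 : depends_on S (pd c1 (pd c2 f)).
  by do 2 apply: depends_on_pd.
have con c1 c2 : contin (pd c1 (pd c2 f)).
  by apply: smooth_contin; do 2 apply: smooth_pd.
have [d1 d10 near1] := contin_eps p (con c d) (dep c d) e20.
have [d2 d20 near2] := contin_eps p (con d c) (dep d c) e20.
pose h := Num.min d1 d2 / 2.
have m0 : 0 < Num.min d1 d2 by rewrite lt_min d10.
have h0 : 0 < h by rewrite divr_gt0.
have hlt : h < Num.min d1 d2 by rewrite /h; move: m0; set m := Num.min _ _; lra.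
have dc : d != c by rewrite eq_sym.
have der c1 : pderivable c1 f by exact: smooth_pderivable.
have der2 c1 c2 : pderivable c1 (pd c2 f).
  by apply: smooth_pderivable; exact: smooth_pd.
have [q1 [q1p e1]] := mixed_difference p h h cd (der c) (der2 d c).
have [q2 [q2p e2]] := mixed_difference p h h dc (der d) (der2 c d).
have eq12 : pd d (pd c f) q1 = pd c (pd d f) q2.
  apply: (cancel_square _ e1 e2); first by rewrite gt_eqF.
  by rewrite (updC p _ _ cd) swap_diff.
have close q : (forall e, `|q e - p e| <= Num.max `|h| `|h|) ->
    {in S, forall c, `|q c - p c| < Num.min d1 d2}.
  move=> qp c' _; apply: le_lt_trans (qp c') _.
  by rewrite maxxx gtr0_norm.
have n1 : `|pd d (pd c f) q1 - pd d (pd c f) p| < e / 2.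
  apply: near2 => c' /(close q1 q1p); rewrite lt_min; by case/andP.
have n2 : `|pd c (pd d f) q2 - pd c (pd d f) p| < e / 2.
  apply: near1 => c' /(close q2 q2p); rewrite lt_min; by case/andP.
by move: n1; rewrite eq12 => n1; exact: dist_half_le n2 n1.
Qed.

End Schwarz.

(** * The ring of smooth functions and its derivations *)

Section SmoothRing.
Context (R : realType) (C : eqType).

(** Bundling the functions with their smoothness gives a commutative ring, in
    which identities between derivatives can be proved as ring identities. *)
Record smfun := SFun { sfval : (C -> R) -> R; sfvalP : smooth sfval }.

Lemma sfun_val_inj (f g : smfun) : sfval f = sfval g -> f = g.
Proof.
case: f g => f sf [g sg] /= e; case: _ / e sg => sg.
by congr SFun; exact: Prop_irrelevance.
Qed.

HB.instance Definition _ := gen_eqMixin smfun.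
HB.instance Definition _ := gen_choiceMixin smfun.

Let sm_elem (f : smfun) : elementary (sfval f).
Proof. by apply: elem_smooth; exact: sfvalP. Qed.

Fact sf_add_key (f g : smfun) : smooth (fun p => sfval f p + sfval g p).
Proof. by apply: elementary_smooth; apply: elem_add. Qed.
Fact sf_mul_key (f g : smfun) : smooth (fun p => sfval f p * sfval g p).
Proof. by apply: elementary_smooth; apply: elem_mul. Qed.
Fact sf_cst_key (a : R) : smooth (cst a : (C -> R) -> R).
Proof. by apply: elementary_smooth; apply: elem_cst. Qed.
Fact sf_opp_key (f : smfun) : smooth (fun p => - sfval f p).
Proof.
rewrite (_ : (fun p => _) = (fun p => cst (-1) p * sfval f p)).
  by apply: elementary_smooth; apply: elem_mul => //; apply: elem_cst.
by apply/funext => p; rewrite mulN1r.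
Qed.
Fact sf_coord_key (c : C) : smooth (fun p : C -> R => p c).
Proof. by apply: elementary_smooth; apply: elem_coord. Qed.

Definition sf_cst a := SFun (sf_cst_key a).
Definition sf_coord c := SFun (sf_coord_key c).
Let sf_add f g := SFun (sf_add_key f g).
Let sf_mul f g := SFun (sf_mul_key f g).
Let sf_opp f := SFun (sf_opp_key f).

Lemma smfunP (f g : smfun) : (forall p, sfval f p = sfval g p) -> f = g.
Proof. by move=> fg; apply: sfun_val_inj; apply/funext. Qed.

Let addA : associative sf_add.
Proof. by move=> f g h; apply: smfunP => p /=; rewrite addrA. Qed.
Let addC : commutative sf_add.
Proof. by move=> f g; apply: smfunP => p /=; rewrite addrC. Qed.
Let add0 : left_id (sf_cst 0) sf_add.
Proof. by move=> f; apply: smfunP => p /=; rewrite add0r. Qed.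
Let addN : left_inverse (sf_cst 0) sf_opp sf_add.
Proof. by move=> f; apply: smfunP => p /=; rewrite addNr. Qed.
HB.instance Definition _ := GRing.isZmodule.Build smfun addA addC add0 addN.

Let mulA : associative sf_mul.
Proof. by move=> f g h; apply: smfunP => p /=; rewrite mulrA. Qed.
Let mulC : commutative sf_mul.
Proof. by move=> f g; apply: smfunP => p /=; rewrite mulrC. Qed.
Let mul1 : left_id (sf_cst 1) sf_mul.
Proof. by move=> f; apply: smfunP => p /=; rewrite mul1r. Qed.
Let mulD : left_distributive sf_mul sf_add.
Proof. by move=> f g h; apply: smfunP => p /=; rewrite mulrDl. Qed.
Let one_neq0 : sf_cst 1 != 0.
Proof.
apply/eqP => /(congr1 (fun f => sfval f (fun=> 0))) /= /eqP.
by rewrite oner_eq0.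
Qed.
HB.instance Definition _ :=
  GRing.Zmodule_isComNzRing.Build smfun mulA mulC mul1 mulD one_neq0.

Lemma sfvalD (f g : smfun) p : sfval (f + g) p = sfval f p + sfval g p.
Proof. by []. Qed.
Lemma sfvalM (f g : smfun) p : sfval (f * g) p = sfval f p * sfval g p.
Proof. by []. Qed.
Lemma sfvalN (f : smfun) p : sfval (- f) p = - sfval f p.
Proof. by []. Qed.
Lemma sfval0 p : sfval 0 p = 0.
Proof. by []. Qed.
Lemma sfval1 p : sfval 1 p = 1.
Proof. by []. Qed.
Lemma sfvalB (f g : smfun) p : sfval (f - g) p = sfval f p - sfval g p.
Proof. by []. Qed.
Lemma sfvalMn (f : smfun) n p : sfval (f *+ n) p = sfval f p *+ n.
Proof. by elim: n => [|n IH]; rewrite ?mulr0n// !mulrS sfvalD IH. Qed.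
Lemma sfval_nat n p : sfval n%:R p = n%:R.
Proof. exact: sfvalMn. Qed.
Lemma sfvalX (f : smfun) n p : sfval (f ^+ n) p = sfval f p ^+ n.
Proof. by elim: n => [|n IH]; rewrite ?expr0// !exprS sfvalM IH. Qed.
Lemma sfval_sum (J : Type) (r : seq J) (P : pred J) (F : J -> smfun) p :
  sfval (\sum_(j <- r | P j) F j) p = \sum_(j <- r | P j) sfval (F j) p.
Proof. by apply: (big_morph (fun f => sfval f p)). Qed.
Definition sfvalE :=
  (sfvalD, sfvalM, sfvalN, sfval0, sfval1, sfvalMn, sfvalX, sfval_sum).

Definition spd c (f : smfun) : smfun := SFun (smooth_pd c (sfvalP f)).

Let der (f : smfun) c : pderivable c (sfval f).
Proof. by apply: smooth_pderivable; exact: sfvalP. Qed.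

Lemma spdD c : {morph spd c : f g / f + g}.
Proof.
by move=> f g; apply: smfunP => p; apply: pd_eq; exact: is_derive_upd_D.
Qed.

Lemma spdM c f g : spd c (f * g) = f * spd c g + g * spd c f.
Proof. by apply: smfunP => p; apply: pd_eq; exact: is_derive_upd_M. Qed.

Lemma spd_coord c d : spd c (sf_coord d) = (d == c)%:R.
Proof.
by apply: smfunP => p; rewrite sfval_nat; apply: pd_eq; exact: is_derive_upd_coord.
Qed.

Lemma spdC c d f : spd c (spd d f) = spd d (spd c f).
Proof. by apply: sfun_val_inj => /=; apply: pdC; exact: sfvalP. Qed.

End SmoothRing.

Section Derivations.
Context {A : comNzRingType} (d : A -> A).

Definition derivation := {morph d : f g / f + g} /\
  forall f g, d (f * g) = f * d g + g * d f.

Hypothesis dD : derivation.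
Lemma derD f g : d (f + g) = d f + d g. Proof. by case: dD. Qed.
Lemma derM f g : d (f * g) = f * d g + g * d f. Proof. by case: dD. Qed.
Lemma der0 : d 0 = 0.
Proof. by apply: (addrI (d 0)); rewrite -derD !addr0. Qed.
Lemma derN f : d (- f) = - d f.
Proof. by apply: (addrI (d f)); rewrite -derD !subrr der0. Qed.
Lemma derB f g : d (f - g) = d f - d g. Proof. by rewrite derD derN. Qed.
Lemma der1 : d 1 = 0.
Proof. by apply: (addrI (d 1)); rewrite -{3}[1]mulr1 derM !mul1r addr0. Qed.
Lemma derMn f n : d (f *+ n) = d f *+ n.
Proof. by elim: n => [|n IH]; rewrite ?mulr0n ?der0// !mulrS derD IH. Qed.
Lemma der_nat n : d n%:R = 0. Proof. by rewrite derMn der1 mul0rn. Qed.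
Lemma der_sum (J : Type) (r : seq J) (P : pred J) (F : J -> A) :
  d (\sum_(j <- r | P j) F j) = \sum_(j <- r | P j) d (F j).
Proof. exact: (big_morph d derD der0). Qed.
Lemma derNn f n : d ((-1) ^+ n * f) = (-1) ^+ n * d f.
Proof.
elim: n => [|n IH]; first by rewrite expr0 !mul1r.
by rewrite exprS -!mulrA !mulN1r derN IH.
Qed.

End Derivations.

(** * Vector fields *)

Section VectorFields.
Context {R : realType} {C : eqType}.
Local Notation sf := (smfun R C).
Implicit Types (f g : sf) (A B : C -> sf) (S : seq C).

Lemma spd_der c : derivation (@spd R C c).
Proof. by split; [exact: spdD|exact: spdM]. Qed.

Definition dep S f := depends_on S (sfval f).

Lemma dep_sub S S' f : {subset S <= S'} -> dep S f -> dep S' f.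
Proof. exact: depends_on_sub. Qed.

Lemma dep_spd S f c : dep S f -> dep S (spd c f).
Proof. exact: depends_on_pd. Qed.

Lemma spd_indep S f c : dep S f -> c \notin S -> spd c f = 0.
Proof. by move=> dS cS; apply: sfun_val_inj; exact: pd_indep dS cS. Qed.

Fact dep_ex f : {S | dep S f}.
Proof. by apply/cid; have [] := smooth_dep (sfvalP f) => S; exists S. Qed.

Lemma big_uniq_support (V : nmodType) (T : eqType) (s s' : seq T) (F : T -> V) :
  uniq s -> uniq s' -> (forall i, i \notin s -> F i = 0) ->
  (forall i, i \notin s' -> F i = 0) ->
  \sum_(i <- s) F i = \sum_(i <- s') F i.
Proof.
suff H s1 s2 : uniq s1 -> uniq s2 -> {subset s1 <= s2} ->
    (forall i, i \notin s1 -> F i = 0) ->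
    \sum_(i <- s1) F i = \sum_(i <- s2) F i.
  move=> us us' F0 F0'; pose u := undup (s ++ s').
  rewrite (H s u) ?undup_uniq//; last first.
    by move=> i; rewrite mem_undup mem_cat => ->.
  rewrite (H s' u) ?undup_uniq// => i.
  by rewrite mem_undup mem_cat => ->; rewrite orbT.
move=> u1 u2 s12 F0; rewrite [RHS](bigID (mem s1)) /=.
rewrite [X in _ + X]big1 => [|i /F0//]; rewrite addr0 -[RHS]big_filter.
apply: perm_big; apply: uniq_perm => //; first exact: filter_uniq.
by move=> i; rewrite mem_filter; case: (boolP (i \in s1)) => // /s12 ->.
Qed.

(** The vector field with components [A]. Only the coordinates on which [f]
    depends contribute, which makes the sum finite. *)
Definition vf A f : sf := \sum_(c <- undup (sval (dep_ex f))) A c * spd c f.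

Lemma vfE S A f : uniq S -> dep S f -> vf A f = \sum_(c <- S) A c * spd c f.
Proof.
move=> uS dS; apply: big_uniq_support => //; first exact: undup_uniq.
  by move=> c; rewrite mem_undup => /(spd_indep (svalP (dep_ex f))) ->;
    rewrite mulr0.
by move=> c /(spd_indep dS) ->; rewrite mulr0.
Qed.

Lemma dep_common f g : exists S, [/\ uniq S, dep S f & dep S g].
Proof.
have [S dS] := dep_ex f; have [S' dS'] := dep_ex g.
exists (undup (S ++ S')); split; first exact: undup_uniq.
  by apply: dep_sub dS => c; rewrite mem_undup mem_cat => ->.
by apply: dep_sub dS' => c; rewrite mem_undup mem_cat => ->; rewrite orbT.
Qed.

Lemma dep_uniq f : exists2 S, uniq S & dep S f.
Proof. by have [S []] := dep_common f f; exists S. Qed.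

Lemma depD S f g : dep S f -> dep S g -> dep S (f + g).
Proof. by move=> df dg p q pq; rewrite !sfvalD (df p q pq) (dg p q pq). Qed.

Lemma depM S f g : dep S f -> dep S g -> dep S (f * g).
Proof. by move=> df dg p q pq; rewrite !sfvalM (df p q pq) (dg p q pq). Qed.

Lemma vf_der A : derivation (vf A).
Proof.
split=> f g; have [S [uS df dg]] := dep_common f g.
  rewrite (vfE _ uS df) (vfE _ uS dg) (vfE _ uS (depD df dg)) -big_split.
  by apply: eq_bigr => c _; rewrite spdD mulrDr.
rewrite (vfE _ uS df) (vfE _ uS dg) (vfE _ uS (depM df dg)) !mulr_sumr -big_split.
by apply: eq_bigr => c _ /=; rewrite spdM; ring.
Qed.

Lemma vf_coord A c : vf A (sf_coord R c) = A c.
Proof.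
have dc : dep [:: c] (sf_coord R c) by move=> p q; apply; rewrite mem_head.
by rewrite (vfE _ _ dc)// big_seq1 spd_coord eqxx mulr1.
Qed.

Lemma spd_vf A c f : spd c (vf A f) = vf A (spd c f) + vf (spd c \o A) f.
Proof.
have [S uS df] := dep_uniq f.
rewrite !(vfE _ uS df) (vfE _ uS (dep_spd c df)) (der_sum (spd_der c)).
rewrite -big_split; apply: eq_bigr => d _ /=.
by rewrite spdM spdC [spd d f * _]mulrC.
Qed.

(** Both sides are the second-order part of the composition, symmetric in [A]
    and [B] because partial derivatives commute. *)
Lemma vf_vf A B f : vf A (vf B f) - vf (vf A \o B) f =
  vf B (vf A f) - vf (vf B \o A) f.
Proof.
have [S uS df] := dep_uniq f.
have H A' B' : vf A' (vf B' f) - vf (vf A' \o B') f =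
    \sum_(c <- S) \sum_(d <- S) B' c * (A' d * spd d (spd c f)).
  rewrite !(vfE _ uS df) (der_sum (vf_der A')) -sumrB.
  apply: eq_bigr => c _; rewrite (derM (vf_der A')).
  rewrite [spd c f * _]mulrC addrK (vfE _ uS (dep_spd c df)).
  by rewrite mulr_sumr.
rewrite !H exchange_big /=; apply: eq_bigr => c _; apply: eq_bigr => d _.
by rewrite mulrCA spdC.
Qed.

(** The bracket of two vector fields is a vector field, hence determined by its
    values on the coordinates. *)
Lemma vfC A B : (forall c, vf A (B c) = vf B (A c)) ->
  forall f, vf A (vf B f) = vf B (vf A f).
Proof.
move=> AB f; have := vf_vf A B f.
by rewrite (_ : vf A \o B = vf B \o A); [apply: addIr|apply/funext].
Qed.

End VectorFields.

(** * Total derivatives *)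

Section JetFunctions.
Context {R : realType} {I : choiceType}.
Local Notation C := (jcoord I).
Local Notation sf := (smfun R C).
Implicit Types (f g : sf) (A B : C -> sf) (s : seq I).

Lemma cu_eq (i j : I) : (@cu I i == cu j) = (i == j).
Proof. by apply/eqP/eqP => [[]|->]. Qed.

Lemma cu_inj : injective (@cu I).
Proof. by move=> i j []. Qed.

Definition coords s : seq C := [:: ct, cx & map cu s].

Lemma coords_uniq s : uniq s -> uniq (coords s).
Proof.
move=> us; rewrite /= inE !negb_or (map_inj_uniq cu_inj) us andbT.
by apply/andP; split; [apply/andP; split=> //|]; apply/negP => /mapP[].
Qed.

Lemma cu_coords s i : (cu i \in coords s) = (i \in s).
Proof. by rewrite !inE /= (mem_map cu_inj). Qed.

(** Dependence on [t] and [x] is always allowed: only the dependent variables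
    are recorded. *)
Definition jdep s f := uniq s /\ dep (coords s) f.

Lemma jdep_sub s s' f : uniq s' -> {subset s <= s'} -> jdep s f -> jdep s' f.
Proof.
move=> us' ss' [us ds]; split=> //; apply: dep_sub ds => -[||i] //.
by rewrite !cu_coords; exact: ss'.
Qed.

Lemma jdep_ex f : exists s, jdep s f.
Proof.
have [S uS dS] := dep_uniq f.
exists (undup (pmap (fun c : C => if c is cu i then Some i else None) S)).
split; first exact: undup_uniq.
apply: dep_sub dS => -[||i] iS //; rewrite cu_coords mem_undup mem_pmap.
by apply/mapP; exists (cu i).
Qed.

Lemma jdep_common f g : exists s, jdep s f /\ jdep s g.
Proof.
have [s df] := jdep_ex f; have [s' dg] := jdep_ex g.
exists (undup (s ++ s')); split; [move: df|move: dg]; apply: jdep_sub;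
  rewrite ?undup_uniq// => i; by rewrite mem_undup mem_cat => ->; rewrite ?orbT.
Qed.

Lemma jdep_spd s f c : jdep s f -> jdep s (spd c f).
Proof. by case=> us ds; split=> //; exact: dep_spd. Qed.

Lemma jdep0 s f i : jdep s f -> i \notin s -> spd (cu i) f = 0.
Proof. by case=> _ df; rewrite -cu_coords; exact: spd_indep. Qed.

Lemma jvfE s A f : jdep s f -> vf A f =
  A ct * spd ct f + A cx * spd cx f + \sum_(i <- s) A (cu i) * spd (cu i) f.
Proof.
case=> us df; rewrite (vfE _ (coords_uniq us) df).
by rewrite /coords !big_cons big_map addrA.
Qed.

Lemma fsum_seq (V : nmodType) s (F : I -> V) : uniq s ->
  (forall i, i \notin s -> F i = 0) ->
  \sum_(i \in [set: I]) F i = \sum_(i <- s) F i.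
Proof.
move=> us F0; rewrite [RHS]fsbig_seq//; apply: esym.
by apply: fsbig_widen => // i /= [_ /negP]; exact: F0.
Qed.

(** This identifies total derivatives and evolutions given by sums with finite
    support, over all dependent variables, with vector fields. *)
Lemma fsum_vf A f p :
  sfval (vf A f) p = sfval (A ct) p * pd ct (sfval f) p
    + sfval (A cx) p * pd cx (sfval f) p
    + \sum_(i \in [set: I]) sfval (A (cu i)) p * pd (cu i) (sfval f) p.
Proof.
have [s df] := jdep_ex f; rewrite (jvfE _ df) !sfvalE; congr (_ + _).
rewrite (fsum_seq (s := s))//; first by case: df.
move=> i /(jdep0 df) /(congr1 (fun g => sfval g p)) /= ->.
by rewrite mulr0.
Qed.

Variables (b : bool) (sh : I -> I).

Definition tot_comp : C -> sf := fun c => match c with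
  | ct => (~~ b)%:R | cx => b%:R | cu i => sf_coord R (cu (sh i)) end.

(** The total derivative in the direction [x] if [b], and [t] otherwise, when
    differentiation of the dependent variable [u_i] gives [u_(sh i)]. *)
Definition tot : sf -> sf := vf tot_comp.

Lemma tot_der : derivation tot. Proof. exact: vf_der. Qed.

Lemma tot_u i : tot (sf_coord R (cu i)) = sf_coord R (cu (sh i)).
Proof. exact: vf_coord. Qed.

(** The commutator: [u_j] occurs in the total derivative as coefficient of
    [d/du_k] exactly when [sh k = j]. *)
Lemma spd_tot s f j : jdep s f -> spd (cu j) (tot f) =
  tot (spd (cu j) f) + \sum_(k <- s) (sh k == j)%:R * spd (cu k) f.
Proof.
move=> df; rewrite spd_vf; congr (_ + _); rewrite (jvfE _ df) /=.
rewrite !(der_nat (spd_der _)) !mul0r !add0r.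
by apply: eq_bigr => k _; rewrite spd_coord cu_eq.
Qed.

End JetFunctions.

(** * Linearization, its adjoint and the Euler operator *)

Section EulerOperator.
Context {R : realType}.
Local Notation sf := (smfun R jcoord2).
Implicit Types (f g phi psi : sf) (k : nat * nat).

Definition shx k := (k.1, k.2.+1).
Definition sht k := (k.1.+1, k.2).
Definition DX : sf -> sf := tot true shx.
Definition DT : sf -> sf := tot false sht.

Lemma DX_der : derivation DX. Proof. exact: tot_der. Qed.
Lemma DT_der : derivation DT. Proof. exact: tot_der. Qed.

Lemma DXT f : DX (DT f) = DT (DX f).
Proof.
apply: vfC => -[||k] /=; rewrite ?vf_coord//;
  by rewrite (der_nat (vf_der _)) (der_nat (vf_der _)).
Qed.

Definition Dk k f := iter k.2 DX (iter k.1 DT f).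

Lemma iterDT_DX n f : iter n DT (DX f) = DX (iter n DT f).
Proof. by elim: n => //= n ->; rewrite DXT. Qed.

Lemma iterDX_DT n f : iter n DX (DT f) = DT (iter n DX f).
Proof. by elim: n => //= n ->; rewrite DXT. Qed.

Lemma DkX k f : Dk k (DX f) = DX (Dk k f).
Proof. by rewrite /Dk iterDT_DX -iterSr. Qed.

Lemma DkT k f : Dk k (DT f) = DT (Dk k f).
Proof. by rewrite /Dk -iterSr /= iterDX_DT. Qed.

Lemma Dk_shx k f : Dk (shx k) f = DX (Dk k f). Proof. by []. Qed.

Lemma Dk_sht k f : Dk (sht k) f = DT (Dk k f).
Proof. by rewrite /Dk /= iterDX_DT. Qed.

Lemma iter_derD (d : sf -> sf) n f g : derivation d ->
  iter n d (f + g) = iter n d f + iter n d g.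
Proof. by move=> dd; elim: n => //= n ->; rewrite derD. Qed.

Lemma DkD k f g : Dk k (f + g) = Dk k f + Dk k g.
Proof. by rewrite /Dk (iter_derD _ _ _ DT_der) (iter_derD _ _ _ DX_der). Qed.

Lemma Dk0 k : Dk k 0 = 0.
Proof. by apply: (addrI (Dk k 0)); rewrite -DkD !addr0. Qed.

Lemma DkN k f : Dk k (- f) = - Dk k f.
Proof. by apply: (addrI (Dk k f)); rewrite -DkD !subrr Dk0. Qed.

Lemma Dk_sum (J : Type) (r : seq J) (F : J -> sf) k :
  Dk k (\sum_(j <- r) F j) = \sum_(j <- r) Dk k (F j).
Proof. exact: (big_morph (Dk k) (DkD k) (Dk0 k)). Qed.

(** [Pk k] is the formal adjoint of the derivative of multi-index [k]. *)
Definition Pk k f := (-1) ^+ (k.1 + k.2) * Dk k f.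

Lemma PkD k f g : Pk k (f + g) = Pk k f + Pk k g.
Proof. by rewrite /Pk DkD mulrDr. Qed.

Lemma Pk0 k : Pk k 0 = 0. Proof. by rewrite /Pk Dk0 mulr0. Qed.

Lemma PkN k f : Pk k (- f) = - Pk k f.
Proof. by rewrite /Pk DkN mulrN. Qed.

Lemma Pk_sum (J : Type) (r : seq J) (F : J -> sf) k :
  Pk k (\sum_(j <- r) F j) = \sum_(j <- r) Pk k (F j).
Proof. exact: (big_morph (Pk k) (PkD k) (Pk0 k)). Qed.

Lemma Pk_shx k f : Pk (shx k) f = - Pk k (DX f).
Proof. by rewrite /Pk Dk_shx DkX /= addnS exprS mulN1r mulNr. Qed.

Lemma Pk_sht k f : Pk (sht k) f = - Pk k (DT f).
Proof. by rewrite /Pk Dk_sht DkT /= addSn exprS mulN1r mulNr. Qed.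

(** The linearization of [f] applied to [phi], that is, the evolutionary vector
    field of characteristic [phi] applied to [f]. *)
Definition ev phi : sf -> sf :=
  vf (fun c => if c is cu k then Dk k phi else 0).

Lemma ev_der phi : derivation (ev phi). Proof. exact: vf_der. Qed.

Lemma evE s phi f : jdep s f -> ev phi f = \sum_(k <- s) Dk k phi * spd (cu k) f.
Proof. by move=> df; rewrite /ev (jvfE _ df) !mul0r !add0r. Qed.

Lemma ev_DX phi f : ev phi (DX f) = DX (ev phi f).
Proof.
apply: vfC => -[||k] /=.
- by rewrite (der_nat (vf_der _)) (der0 (vf_der _)).
- by rewrite (der_nat (vf_der _)) (der0 (vf_der _)).
- by rewrite vf_coord Dk_shx.
Qed.

Lemma ev_DT phi f : ev phi (DT f) = DT (ev phi f).
Proof.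
apply: vfC => -[||k] /=.
- by rewrite (der_nat (vf_der _)) (der0 (vf_der _)).
- by rewrite (der_nat (vf_der _)) (der0 (vf_der _)).
- by rewrite vf_coord Dk_sht.
Qed.

Lemma ev_Dk phi k f : ev phi (Dk k f) = Dk k (ev phi f).
Proof.
have H (d : sf -> sf) (Hd : forall g, ev phi (d g) = d (ev phi g)) n g :
  ev phi (iter n d g) = iter n d (ev phi g) by elim: n => //= n <-.
by rewrite /Dk (H DX (ev_DX _)) (H DT (ev_DT _)).
Qed.

(** The adjoint of the linearization of [f], applied to [phi]; for [phi = 1]
    this is the Euler operator. *)
Definition evs phi f : sf :=
  \sum_(k <- sval (cid (jdep_ex f))) Pk k (phi * spd (cu k) f).

Lemma evsE s phi f : jdep s f ->
  evs phi f = \sum_(k <- s) Pk k (phi * spd (cu k) f).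
Proof.
rewrite /evs; case: cid => s' /= df' df.
by apply: big_uniq_support; [by case: df'|by case: df| |] => k;
  [move/(jdep0 df')|move/(jdep0 df)] => ->; rewrite mulr0 Pk0.
Qed.

Definition Euler : sf -> sf := evs 1.

Lemma evsDl phi psi f : evs (phi + psi) f = evs phi f + evs psi f.
Proof.
have [s df] := jdep_ex f; rewrite !(evsE _ df) -big_split.
by apply: eq_bigr => k _ /=; rewrite mulrDl PkD.
Qed.

Lemma evsNl phi f : evs (- phi) f = - evs phi f.
Proof.
have [s df] := jdep_ex f; rewrite !(evsE _ df) -sumrN.
by apply: eq_bigr => k _ /=; rewrite mulNr PkN.
Qed.

Lemma jdepD s f g : jdep s f -> jdep s g -> jdep s (f + g).
Proof. by case=> us df [_ dg]; split=> //; exact: depD. Qed.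

Lemma jdepM s f g : jdep s f -> jdep s g -> jdep s (f * g).
Proof. by case=> us df [_ dg]; split=> //; exact: depM. Qed.

Lemma evsD phi f g : evs phi (f + g) = evs phi f + evs phi g.
Proof.
have [s [df dg]] := jdep_common f g.
rewrite (evsE _ df) (evsE _ dg) (evsE _ (jdepD df dg)) -big_split.
by apply: eq_bigr => k _ /=; rewrite spdD mulrDr PkD.
Qed.

Lemma evs0 phi : evs phi 0 = 0.
Proof. by apply: (addrI (evs phi 0)); rewrite -evsD !addr0. Qed.

Lemma evsN phi f : evs phi (- f) = - evs phi f.
Proof. by apply: (addrI (evs phi f)); rewrite -evsD !subrr evs0. Qed.

Lemma evs_sum (J : Type) (r : seq J) (F : J -> sf) phi :
  evs phi (\sum_(j <- r) F j) = \sum_(j <- r) evs phi (F j).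
Proof. exact: (big_morph (evs phi) (evsD phi) (evs0 phi)). Qed.

Lemma evsM phi f g : evs phi (f * g) = evs (phi * f) g + evs (phi * g) f.
Proof.
have [s [df dg]] := jdep_common f g.
rewrite (evsE _ df) (evsE _ dg) (evsE _ (jdepM df dg)) -big_split.
by apply: eq_bigr => k _ /=; rewrite spdM mulrDr PkD !mulrA.
Qed.

Section Shift.
Variables (b : bool) (sh : nat * nat -> nat * nat).
Hypothesis Psh : forall k f, Pk (sh k) f = - Pk k (tot b sh f).

(** Integration by parts. The commutator of [d/du_j] with the total derivative
    shifts the index by [sh], where [Pk] produces one more total derivative and
    a sign; by the Leibniz rule only the derivative of [phi] survives. *)
Lemma evs_tot phi f : evs phi (tot b sh f) = - evs (tot b sh phi) f.
Proof.
have [s [df dDf]] : exists s, jdep s f /\ jdep s (tot b sh f).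
  exact: jdep_common.
have us : uniq s by case: df.
pose s' := undup (s ++ map sh s).
have us' : uniq s' by exact: undup_uniq.
have ss' : {subset s <= s'} by move=> k; rewrite mem_undup mem_cat => ->.
have df' := jdep_sub us' ss' df; have dDf' := jdep_sub us' ss' dDf.
rewrite (evsE _ dDf').
have -> : \sum_(k <- s') Pk k (phi * spd (cu k) (tot b sh f)) =
    \sum_(k <- s') Pk k (phi * tot b sh (spd (cu k) f))
    + \sum_(j <- s) \sum_(k <- s') (k == sh j)%:R * Pk k (phi * spd (cu j) f).
  rewrite exchange_big -big_split; apply: eq_bigr => k _ /=.
  rewrite (spd_tot b sh k df) mulrDr PkD; congr (_ + _).
  rewrite mulr_sumr Pk_sum; apply: eq_bigr => j _.
  by rewrite [k == _]eq_sym; case: eqP; rewrite ?mul1r// !mul0r mulr0 Pk0.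
have -> : \sum_(j <- s) \sum_(k <- s') (k == sh j)%:R * Pk k (phi * spd (cu j) f)
    = \sum_(k <- s') Pk (sh k) (phi * spd (cu k) f).
  transitivity (\sum_(k <- s) Pk (sh k) (phi * spd (cu k) f)).
    apply: eq_big_seq => j js; rewrite (bigD1_seq (sh j)) //=; last first.
      by rewrite mem_undup mem_cat map_f// orbT.
    rewrite eqxx mul1r big1 ?addr0// => k /negbTE ->; by rewrite mul0r.
  apply: big_uniq_support => // k.
    by move/(jdep0 df) ->; rewrite mulr0 Pk0.
  by move/(jdep0 df') ->; rewrite mulr0 Pk0.
rewrite (evsE _ df') -big_split -sumrN; apply: eq_bigr => k _ /=.
rewrite Psh (derM (tot_der b sh)) PkD opprD addNKr//.
by rewrite [tot b sh phi * _]mulrC.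
Qed.

End Shift.

Lemma evs_DX phi f : evs phi (DX f) = - evs (DX phi) f.
Proof. by apply: evs_tot; exact: Pk_shx. Qed.

Lemma evs_DT phi f : evs phi (DT f) = - evs (DT phi) f.
Proof. by apply: evs_tot; exact: Pk_sht. Qed.

Lemma evs_Pk phi k f : evs phi (Pk k f) = evs (Dk k phi) f.
Proof.
have sgn n (psi g : sf) : evs psi ((-1) ^+ n * g) = (-1) ^+ n * evs psi g.
  elim: n => [|n IH]; first by rewrite expr0 !mul1r.
  by rewrite exprS -!mulrA !mulN1r evsN IH.
rewrite /Pk sgn; case: k => a i; rewrite /Dk /=.
have H (d : sf -> sf) (Hd : forall psi g, evs psi (d g) = - evs (d psi) g) n
    psi g : evs psi (iter n d g) = (-1) ^+ n * evs (iter n d psi) g.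
  elim: n psi => [|n IH] psi; first by rewrite expr0 mul1r.
  by rewrite iterS Hd IH -iterSr exprS mulN1r mulNr.
rewrite (H DX evs_DX) (H DT evs_DT) !mulrA -!exprD.
rewrite -signr_odd (_ : odd _ = false) ?mul1r; last by rewrite !oddD; lia.
congr (evs _ _); rewrite -/(Dk (a, i) phi).
by elim: i {H} => //= i IH; rewrite iterDT_DX IH.
Qed.

(** The Helmholtz condition: the linearization of an Euler-Lagrange expression
    is self-adjoint, because its coefficients are iterated derivatives of the
    Hessian of the Lagrangian. *)
Lemma helmholtz phi L : evs phi (Euler L) = ev phi (Euler L).
Proof.
have [s dL] := jdep_ex L.
rewrite /Euler (evsE _ dL) evs_sum (der_sum (ev_der phi)).
transitivity (\sum_(k <- s) \sum_(j <- s)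
    Pk j (Dk k phi * spd (cu j) (spd (cu k) L))).
  apply: eq_bigr => k _; rewrite mul1r evs_Pk.
  by rewrite (evsE _ (jdep_spd (cu k) dL)).
rewrite exchange_big; apply: eq_bigr => k _ /=.
rewrite mul1r /Pk (derNn (ev_der phi)) ev_Dk (evE _ (jdep_spd (cu k) dL)).
rewrite Dk_sum mulr_sumr; apply: eq_bigr => j _.
by rewrite spdC.
Qed.

End EulerOperator.

(** * The equation manifold and the jet space *)

Section Equation.
Context {R : realType}.
Local Notation sf := (smfun R ecoord).
Local Notation sfj := (smfun R jcoord2).
Implicit Types (f g K : sf).

Definition X : sf -> sf := tot true S.

Lemma X_der : derivation X. Proof. exact: tot_der. Qed.

Lemma DxE f : Dx (sfval f) = sfval (X f).
Proof. by apply/funext => p; rewrite fsum_vf /= mul0r mul1r add0r. Qed.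

Lemma iter_DxE n f : iter n Dx (sfval f) = sfval (iter n X f).
Proof. by elim: n => //= n ->; rewrite DxE. Qed.

Lemma spd_X j f : spd (cu j) (X f) =
  X (spd (cu j) f) + (if j is i.+1 then spd (cu i) f else 0).
Proof.
have [s df] := jdep_ex f; rewrite (spd_tot true S j df); congr (_ + _).
have us : uniq s by case: df.
case: j => [|i]; first by rewrite big1// => k _; rewrite mul0r.
have [is_|iNs] := boolP (i \in s); last first.
  rewrite (jdep0 df iNs) big1_seq// => k /= ks.
  by rewrite eqSS; case: eqP => [ki|_]; [rewrite -ki ks in iNs|rewrite mul0r].
rewrite (bigD1_seq i)//= eqxx mul1r big1 ?addr0// => k /negbTE ki.
by rewrite eqSS ki mul0r.
Qed.

Definition Tv K : sf -> sf := vf (fun c =>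
  match c with ct => 1 | cx => 0 | cu i => iter i X K end).

Lemma Tv_der K : derivation (Tv K). Proof. exact: vf_der. Qed.

Lemma TvfE K f : Tvf (sfval K) (sfval f) = sfval (Tv K f).
Proof.
apply/funext => p; rewrite fsum_vf /= mul1r mul0r addr0; congr (_ + _).
by apply: eq_fsbigr => i _; rewrite iter_DxE.
Qed.

Lemma TvE s K f : jdep s f ->
  Tv K f = spd ct f + \sum_(i <- s) iter i X K * spd (cu i) f.
Proof. by move=> df; rewrite /Tv (jvfE _ df) mul1r mul0r addr0. Qed.

Lemma jDxE (f : sfj) : jDx (sfval f) = sfval (DX f).
Proof. by apply/funext => p; rewrite fsum_vf /= mul0r mul1r add0r. Qed.

Lemma jDtE (f : sfj) : jDt (sfval f) = sfval (DT f).
Proof. by apply/funext => p; rewrite fsum_vf /= mul0r mul1r addr0. Qed.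

Lemma iter_jDE (f : sfj) k :
  iter k.2 jDx (iter k.1 jDt (sfval f)) = sfval (Dk k f).
Proof.
rewrite /Dk; elim: k.2 => [|n /= ->]; last by rewrite jDxE.
by rewrite /=; elim: k.1 => //= n ->; rewrite jDtE.
Qed.

Lemma sfval_sign (C : eqType) (f : smfun R C) n p :
  sfval ((-1) ^+ n * f) p = (-1) ^+ n * sfval f p.
Proof. by rewrite !sfvalE. Qed.

Lemma eulerE (L : sfj) : euler (sfval L) = sfval (Euler L).
Proof.
apply/funext => p; have [s dL] := jdep_ex L; rewrite /Euler (evsE _ dL) sfvalE.
have H k : (-1) ^+ (k.1 + k.2) *
    iter k.2 jDx (iter k.1 jDt (pd (cu k) (sfval L))) p =
    sfval (Pk k (1 * spd (cu k) L)) p.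
  by rewrite -[pd _ _]/(sfval (spd (cu k) L)) iter_jDE mul1r /Pk sfval_sign.
rewrite /euler; under eq_fsbigr do rewrite H.
apply: fsum_seq; first by case: dL.
by move=> k /(jdep0 dL) ->; rewrite mulr0 Pk0.
Qed.

Definition restr (p : jcoord2 -> R) : ecoord -> R := fun c =>
  match c with ct => p ct | cx => p cx | cu i => p (cu (0%N, i)) end.

(** There is no such coordinate for the derivatives [u_(a,i)] with [a > 0], which
    functions pulled back from [E] do not involve. *)
Definition ecoord_of (c : jcoord2) : option ecoord :=
  match c with
  | ct => Some ct | cx => Some cx
  | cu (a, i) => if a is 0 then Some (cu i) else None
  end.

Lemma restr_upd p c s : restr (upd p c s) =
  if ecoord_of c is Some c' then upd (restr p) c' s else restr p.
Proof.
apply/funext => d; case: c => [||[[|a] i]]; case: d => [||j];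
  by rewrite /= /restr ?updE ?cu_eq ?xpair_eqE.
Qed.

Lemma restr_coord p c c' : ecoord_of c = Some c' -> p c = restr p c'.
Proof. by case: c => [||[[|a] i]] //= [<-]. Qed.

Lemma pd_to_jet c (f : efun R) : pd c (to_jet f) =
  if ecoord_of c is Some c' then to_jet (pd c' f) else cst 0.
Proof.
apply/funext => p; rewrite {1}/pd /to_jet.
under eq_fun do rewrite -/(upd p c _) -/(restr _) restr_upd.
case e: ecoord_of => [c'|]; last by rewrite derive1_cst.
by rewrite (restr_coord p e).
Qed.

Lemma smooth_to_jet (f : efun R) : smooth f -> smooth (to_jet f).
Proof.
move=> sf0; pose P (g : jfun R) := exists2 f, smooth f & g = to_jet f.
suff : forall h : jfun R, P h -> smooth h by apply; exists f.
apply: smooth_coind => _ [{sf0}f sf0 ->]; split.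
- have [S dS] := smooth_dep sf0.
  exists (map (fun c => match c with ct => ct | cx => cx | cu i => cu (0%N, i) end) S).
  move=> p q pq; apply: dS => c cS.
  by case: c cS => [||i] cS; apply: pq; apply/mapP; [exists ct|exists cx|exists (cu i)].
- move=> p.
  have rp : restr @ (p : {ptws jcoord2 -> R}) --> (restr p : {ptws ecoord -> R}).
    apply: (cvg_pointwise (@nbhs_filter {ptws jcoord2 -> R} p)).
    by move=> -[||i]; exact: cvg_coord.
  have -> : to_jet f = f \o restr by [].
  have cf : contin f := smooth_contin sf0.
  exact: (cvg_comp _ _ rp (cf (restr p))).
- move=> c p; rewrite /to_jet.
  under eq_fun do rewrite -/(upd p c _) -/(restr _) restr_upd.
  case e: ecoord_of => [c'|]; last exact: derivable_cst.
  by rewrite (restr_coord p e); exact: smooth_pderivable.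
- move=> c; rewrite pd_to_jet; case: ecoord_of => [c'|].
    exists (pd c' f); [exact: smooth_pd|reflexivity].
  exists (cst 0); [exact: sf_cst_key|reflexivity].
Qed.

Definition tj f : sfj := SFun (smooth_to_jet (sfvalP f)).

Lemma tjD f g : tj (f + g) = tj f + tj g. Proof. exact: smfunP. Qed.
Lemma tjM f g : tj (f * g) = tj f * tj g. Proof. exact: smfunP. Qed.
Lemma tjN f : tj (- f) = - tj f. Proof. exact: smfunP. Qed.
Lemma tj0 : tj 0 = 0. Proof. exact: smfunP. Qed.
Lemma tj1 : tj 1 = 1. Proof. exact: smfunP. Qed.
Lemma tj_coord i : tj (sf_coord R (cu i)) = sf_coord R (cu (0%N, i)).
Proof. exact: smfunP. Qed.

Lemma spd_tj c f : spd c (tj f) =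
  if ecoord_of c is Some c' then tj (spd c' f) else 0.
Proof.
by apply: sfun_val_inj; rewrite /= pd_to_jet; case: ecoord_of.
Qed.

Lemma jdep_tj s f : jdep s f -> jdep [seq (0%N, i) | i <- s] (tj f).
Proof.
case=> us df; split; first by rewrite map_inj_uniq// => i j [].
move=> p q pq; apply: df => -[||i] ci; apply: pq => //.
by move: ci; rewrite !cu_coords => ?; exact: map_f.
Qed.

Lemma DX_tj f : DX (tj f) = tj (X f).
Proof.
have [s df] := jdep_ex f; rewrite /DX /X /tot (jvfE _ (jdep_tj df)) (jvfE _ df).
rewrite !spd_tj /= !tjD !tjM tj0 tj1; congr (_ + _).
rewrite big_map (big_morph tj tjD tj0); apply: eq_bigr => i _.
by rewrite tjM tj_coord spd_tj.
Qed.

Lemma iter_DX_tj n f : iter n DX (tj f) = tj (iter n X f).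
Proof. by elim: n => //= n ->; rewrite DX_tj. Qed.

Lemma ev_tj s phi f : jdep s f ->
  ev phi (tj f) = \sum_(i <- s) iter i DX phi * tj (spd (cu i) f).
Proof.
move=> df; rewrite (evE _ (jdep_tj df)) big_map.
by apply: eq_bigr => i _; rewrite spd_tj.
Qed.

Lemma evs_tj s phi f : jdep s f ->
  evs phi (tj f) = \sum_(i <- s) (-1) ^+ i * iter i DX (phi * tj (spd (cu i) f)).
Proof.
move=> df; rewrite (evsE _ (jdep_tj df)) big_map.
by apply: eq_bigr => i _; rewrite spd_tj.
Qed.

Definition u_ k : sfj := sf_coord R (cu k).

(** The equation: [Geq K = u_t - K]. *)
Definition Geq K : sfj := u_ (1%N, 0%N) - tj K.

Lemma iter_DX_u n k : iter n DX (u_ k) = u_ (k.1, k.2 + n)%N.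
Proof.
elim: n => [|n IH] /=; first by rewrite addn0; case: k.
by rewrite IH [LHS]tot_u addnS.
Qed.

Lemma iterDX_D n (f g : sfj) : iter n DX (f + g) = iter n DX f + iter n DX g.
Proof. by apply: iter_derD; exact: DX_der. Qed.

Lemma iterDX_0 n : iter n DX (0 : sfj) = 0.
Proof. by elim: n => //= n ->; rewrite (der0 DX_der). Qed.

Lemma iterDX_N n (f : sfj) : iter n DX (- f) = - iter n DX f.
Proof. by elim: n => //= n ->; rewrite (derN DX_der). Qed.

Lemma iter_DX_Geq n K :
  iter n DX (Geq K) = u_ (1, n)%N - tj (iter n X K).
Proof. by rewrite iterDX_D iterDX_N iter_DX_u iter_DX_tj. Qed.

(** Off the equation, the time derivative differs from [T] by the
    linearization applied to [u_t - K]. *)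
Lemma DT_tj K f : DT (tj f) = tj (Tv K f) + ev (Geq K) (tj f).
Proof.
have [s df] := jdep_ex f; rewrite (TvE _ df) (ev_tj _ df).
rewrite /DT /tot (jvfE _ (jdep_tj df)) !spd_tj /= mul1r mul0r addr0 tjD -addrA.
congr (_ + _); rewrite big_map (big_morph tj tjD tj0) -big_split.
apply: eq_bigr => i _ /=; rewrite spd_tj iter_DX_Geq tjM.
by rewrite -mulrDl addrC subrK.
Qed.

Lemma ev_Geq phi K : ev phi (Geq K) = DT phi - ev phi (tj K).
Proof. by rewrite (derB (ev_der phi)) [ev phi (u_ _)]vf_coord. Qed.

Lemma evs_Geq phi K : evs phi (Geq K) = - DT phi - evs phi (tj K).
Proof.
rewrite evsD evsN; congr (_ - _).
have du : jdep [:: (1%N, 0%N)] (u_ (1%N, 0%N)).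
  by split=> // p q; apply; rewrite cu_coords mem_head.
by rewrite (evsE _ du) big_seq1 spd_coord eqxx mulr1 /Pk expr1 mulN1r.
Qed.

End Equation.

(** * Identities between differential operators *)

Section DifferentialIdentities.
Context {A : comNzRingType} (D : A -> A) (dD : derivation D).
Implicit Types R S T K G phi psi : A.

Definition derE := (derD dD, derB dD, derN dD, derM dD, derMn dD, der_nat dD).

Definition lin3 K0 K1 K2 K3 phi :=
  K0 * phi + K1 * D phi + K2 * D (D phi) + K3 * D (D (D phi)).
Definition adj3 K0 K1 K2 K3 psi :=
  K0 * psi - D (K1 * psi) + D (D (K2 * psi)) - D (D (D (K3 * psi))).
Definition first_op R psi := R *+ 2 * D psi + D R * psi.

(** The coefficients [b] and [a] of the normal form
    [2 theta^0 (a theta^1 + b theta^3)], modulo [D]-exact forms, of the Lie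
    derivative of [2 R theta^0 theta^1]; [T] stands for the derivative of [R]
    along the evolution. *)
Definition order3_coef K2 K3 R := R *+ 2 * (K2 - D K3) - K3 *+ 3 * D R.
Definition order1_coef K0 K1 K2 K3 R T :=
  T - D R * K1 + D (D R * K2) + R *+ 2 * K0 - D (D (R * K2)) *+ 2
  + D (D (D (R * K3))) *+ 2.

(** The left-hand side is the invariance condition [T(E) + E l_K + l_K^* E] of
    the operator [E], applied to [phi]. It is skew-adjoint of order three, because
    the terms of order four cancel, hence determined by two coefficients. *)
Lemma hamiltonian_bracket K0 K1 K2 K3 R T phi :
  let a := order1_coef K0 K1 K2 K3 R T in let b := order3_coef K2 K3 R in
  first_op T phi + first_op R (lin3 K0 K1 K2 K3 phi)
    + adj3 K0 K1 K2 K3 (first_op R phi)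
  = a *+ 2 * D phi + D a * phi + (b *+ 2 * D (D (D phi)) 
    + D b *+ 3 * D (D phi) + D (D b) *+ 3 * D phi + D (D (D b)) * phi).
Proof.
rewrite /first_op /lin3 /adj3 /order1_coef /order3_coef !derE.
by ring.
Qed.

(** The closure of [2 R theta^0 theta^1] tested on three arguments, when [R] has
    order three: the relation [R2 = D R3] makes its exterior derivative
    [D]-exact. *)
Lemma symplectic_bracket R0 R1 R3 G phi :
  let R2 := D R3 in
  first_op (lin3 R0 R1 R2 R3 G) phi + adj3 R0 R1 R2 R3 (phi * D G - G * D phi)
  = lin3 R0 R1 R2 R3 phi *+ 2 * D G + D (lin3 R0 R1 R2 R3 phi) * G.
Proof.
rewrite /first_op /lin3 /adj3 !derE.
by ring.
Qed.

(** The alternating sum [\sum_i (- D)^i] that defines the source form, for the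
    five rows of the matrix of the Lie derivative. *)
Lemma adjoint_lie_sum K0 K1 K2 K3 R T L phi : let N f := - D f in
  - (T *+ 2 * D phi + K0 * R *+ 2 * D phi - D K0 * R *+ 2 * phi + R *+ 2 * D L)
  + (N (- (- (T *+ 2) * phi + K1 * R *+ 2 * D phi
           - (D K1 + K0) * R *+ 2 * phi - R *+ 2 * L))
  + (N (N (- (K2 * R *+ 2 * D phi - (D K2 + K1) * R *+ 2 * phi)))
  + (N (N (N (- (K3 * R *+ 2 * D phi - (D K3 + K2) * R *+ 2 * phi))))
  + N (N (N (N (- (- K3 * R *+ 2 * phi)))))))) =
  - (first_op T phi + first_op R L + adj3 K0 K1 K2 K3 (first_op R phi)) *+ 2.
Proof.
move=> N; rewrite {}/N /first_op /adj3 !derE.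
by ring.
Qed.

(** The same alternating sum for the exterior derivative of
    [2 R theta^0 theta^1]; it is [symplectic_bracket] in another arrangement. *)
Lemma adjoint_dV_sum R0 R1 R3 phi psi : let N f := - D f in
  let R2 := D R3 in let b := phi * D psi - D phi * psi in
  let Lphi := lin3 R0 R1 R2 R3 phi in let Lpsi := lin3 R0 R1 R2 R3 psi in
  - (- (R0 *+ 2 * b) + Lphi *+ 2 * D psi - Lpsi *+ 2 * D phi)
  + (N (- (- (R1 *+ 2 * b) - Lphi *+ 2 * psi + Lpsi *+ 2 * phi))
  + (N (N (- - (R2 *+ 2 * b))) + N (N (N (- - (R3 *+ 2 * b)))))) = 0.
Proof.
move=> N R2 b Lphi Lpsi; rewrite {}/N {}/Lphi {}/Lpsi {}/b {}/R2 /lin3 !derE.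
by ring.
Qed.

(** With [K2 = D K3 + 3 K3 q], that is, [q = (K2 - D K3) / (3 K3)]. *)
Lemma order3_coefE K2 K3 R q : K2 = D K3 + K3 *+ 3 * q ->
  order3_coef K2 K3 R = K3 *+ 3 * (R * (q *+ 2) - D R).
Proof. by move=> ->; rewrite /order3_coef; ring. Qed.

(** The [dt] component of [kappa], written with [q = K2hat / 2] to clear the
    denominators. *)
Definition kappa_t K0 K1 K3 q := - (K0 *+ 2) + K1 * q *+ 2
  - (D K3 * q ^+ 2 *+ 2 + K3 * q ^+ 3 *+ 4) + D (K3 * D q) *+ 2.

(** Substituting [K2] and [D R] leaves a multiple of [R]: this is how the [dt]
    component of [kappa] arises. *)
Lemma order1_coefE K0 K1 K2 K3 R T q : K2 = D K3 + K3 *+ 3 * q ->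
  D R = R * (q *+ 2) ->
  order1_coef K0 K1 K2 K3 R T = T - R * kappa_t K0 K1 K3 q.
Proof.
move=> -> DR; rewrite /order1_coef /kappa_t !derE !DR !derE !DR !derE !DR.
by ring.
Qed.

End DifferentialIdentities.

Arguments sfval : simpl never.

(** * Forms by components, and the source operator *)

Section Components.
Context {R : realType}.
Local Notation sf := (smfun R ecoord).
Implicit Types (w : @Defs.form R) (v : nat -> sf) (M : nat -> nat -> sf)
  (N : nat -> nat -> nat -> sf) (l : seq ecoord).

(** Forms with one factor [dx] and one, two or three factors [theta]. They are
    recorded by their values with [D_x] as first argument; moving [D_x] to
    another place changes the sign. No antisymmetry of the arrays is imposed. *)
Definition form1 v : Defs.form := fun l => match l with
  | [:: cx; cu j] => sfval (v j)
  | [:: cu j; cx] => sfval (- v j)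
  | _ => cst 0 end.

Definition form2 M : Defs.form := fun l => match l with
  | [:: cx; cu i; cu j] => sfval (M i j)
  | [:: cu i; cx; cu j] => sfval (- M i j)
  | [:: cu i; cu j; cx] => sfval (M i j)
  | _ => cst 0 end.

Definition form3 N : Defs.form := fun l => match l with
  | [:: cx; cu i; cu j; cu k] => sfval (N i j k)
  | [:: cu i; cx; cu j; cu k] => sfval (- N i j k)
  | [:: cu i; cu j; cx; cu k] => sfval (N i j k)
  | [:: cu i; cu j; cu k; cx] => sfval (- N i j k)
  | _ => cst 0 end.

Lemma iprod_form2 M i : iprod (cu i) (form2 M) = form1 (fun j => - M i j).
Proof.
apply/funext => -[|[||a] [|[||b] [|c l]]] //=.
by rewrite opprK.
Qed.

Lemma iprod_form3 N i : iprod (cu i) (form3 N) = form2 (fun j k => - N i j k).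
Proof.
apply/funext => -[|[||a] [|[||b] [|[||c] [|d l]]]] //=.
by rewrite opprK.
Qed.

Lemma Dx0 : Dx (cst 0 : efun R) = cst 0.
Proof. by rewrite -[cst 0]/(sfval (0 : sf)) DxE (der0 X_der). Qed.

(** [D_x] acts on an array by differentiating the entries and by shifting each
    index, since [D_x theta^i = theta^(i+1)]. *)
Definition dv1 v : nat -> sf := fun j =>
  X (v j) + (if j is k.+1 then v k else 0).

Definition dv2 M : nat -> nat -> sf := fun i j =>
  X (M i j) + (if i is k.+1 then M k j else 0) + (if j is k.+1 then M i k else 0).

Lemma DxF_form1 v : DxF (form1 v) = form1 (dv1 v).
Proof.
apply/funext => l; apply/funext => p; rewrite /DxF.
case: l => [|a [|b [|c l]]]; last first.
- have f0 v' l' : (2 < size l')%N -> form1 v' l' = cst 0.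
    by case: l' => [|a' [|b' [|c' l']]]//; case: a' b' => [||?] [||?].
  rewrite !f0 // Dx0 big1 ?addr0// => j _.
  case: (nth _ _ _) => [||[|i]] //.
  by rewrite f0// size_set_nth leq_max orbT.
- rewrite !big_ord_recl big_ord0 addr0.
  case: a => [||[|a]]; case: b => [||[|b]]; rewrite /= ?Dx0 ?addr0 ?add0r //;
    by rewrite DxE /dv1 ?(derN X_der) ?addr0 ?opprD.
- by rewrite big_ord1 /=; case: a => [||[|a]]; rewrite /= Dx0 addr0.
- by rewrite big_ord0 addr0 /= Dx0.
Qed.

Lemma DxF_form2 M : DxF (form2 M) = form2 (dv2 M).
Proof.
apply/funext => l; apply/funext => p; rewrite /DxF.
case: l => [|a [|b [|c [|d l]]]]; last first.
- have f0 M' l' : (3 < size l')%N -> form2 M' l' = cst 0.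
    case: l' => [|a' [|b' [|c' [|d' l']]]]//.
    by case: a' b' c' => [||?] [||?] [||?].
  rewrite !f0 // Dx0 big1 ?addr0// => j _.
  case: (nth _ _ _) => [||[|i]] //.
  by rewrite f0// size_set_nth leq_max orbT.
- rewrite !big_ord_recl big_ord0 addr0.
  case: a => [||[|a]]; case: b => [||[|b]]; case: c => [||[|c]];
    rewrite /= ?Dx0 ?addr0 ?add0r //;
    by rewrite DxE /dv2 ?(derN X_der) ?addr0 ?add0r ?opprD ?addrA.
- rewrite !big_ord_recl big_ord0 addr0.
  by case: a => [||[|a]]; case: b => [||[|b]]; rewrite /= ?Dx0 ?addr0.
- by rewrite big_ord1 /=; case: a => [||[|a]]; rewrite /= Dx0 addr0.
- by rewrite big_ord0 addr0 /= Dx0.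
Qed.

Definition ndv1 v : nat -> sf := fun j => - dv1 v j.
Definition ndv2 M : nat -> nat -> sf := fun i j => - dv2 M i j.

Lemma opp_form1 v : opp_form (form1 v) = form1 (fun j => - v j).
Proof.
apply/funext => l; apply/funext => p; rewrite /opp_form.
by case: l => [|[||i] [|[||j] [|c l]]]; rewrite /= ?oppr0.
Qed.

Lemma opp_form2 M : opp_form (form2 M) = form2 (fun i j => - M i j).
Proof.
apply/funext => l; apply/funext => p; rewrite /opp_form.
by case: l => [|[||i] [|[||j] [|[||k] [|c l]]]]; rewrite /= ?oppr0.
Qed.

Lemma iter_form1 n v :
  iter n (fun h => opp_form (DxF h)) (form1 v) = form1 (iter n ndv1 v).
Proof. by elim: n => //= n ->; rewrite DxF_form1 opp_form1. Qed.

Lemma iter_form2 n M :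
  iter n (fun h => opp_form (DxF h)) (form2 M) = form2 (iter n ndv2 M).
Proof. by elim: n => //= n ->; rewrite DxF_form2 opp_form2. Qed.

Definition support1 n v := forall j, (n <= j)%N -> v j = 0.

Lemma ndv1_0 : ndv1 (fun=> 0) = fun=> 0.
Proof.
by apply/funext => -[|j]; rewrite /ndv1 /dv1 (der0 X_der) addr0 oppr0.
Qed.

Lemma ndv2_0 : ndv2 (fun _ _ => 0) = fun _ _ => 0.
Proof.
by apply/funext => -[|i]; apply/funext => -[|j];
  rewrite /ndv2 /dv2 (der0 X_der) !addr0 oppr0.
Qed.

Lemma iter_ndv1_0 n : iter n ndv1 (fun=> 0) = fun=> 0.
Proof. by elim: n => //= n ->; exact: ndv1_0. Qed.

Lemma iter_ndv2_0 n : iter n ndv2 (fun _ _ => 0) = fun _ _ => 0.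
Proof. by elim: n => //= n ->; exact: ndv2_0. Qed.

(** The coefficients of [\sum_i (- D_x)^i (d/du_i _| w)] when the contractions
    of [w] with [d/du_i] vanish from the index [n] on; the inner sign comes from
    moving [d/du_i] past [dx]. *)
Definition source1 n M : nat -> sf := fun j =>
  \sum_(i < n) iter i ndv1 (fun j => - M i j) j.

Definition source2 n N : nat -> nat -> sf := fun j k =>
  \sum_(i < n) iter i ndv2 (fun j k => - N i j k) j k.

Lemma fsum_ord n (F : nat -> R) : (forall i, (n <= i)%N -> F i = 0) ->
  \sum_(i \in [set: nat]) F i = \sum_(i < n) F i.
Proof.
move=> F0; rewrite (fsum_seq (s := iota 0 n)) ?iota_uniq//.
  by rewrite -(big_mkord xpredT) /index_iota subn0.
by move=> i; rewrite mem_iota add0n -leqNgt; exact: F0.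
Qed.

Lemma form1_sum n (F : nat -> nat -> sf) l p :
  \sum_(i < n) form1 (F i) l p = form1 (fun j => \sum_(i < n) F i j) l p.
Proof.
case: l => [|[||i] [|[||j] [|c l]]] /=;
  first [by rewrite big1|by rewrite -?sumrN sfval_sum].
Qed.

Lemma form2_sum n (F : nat -> nat -> nat -> sf) l p :
  \sum_(i < n) form2 (F i) l p = form2 (fun j k => \sum_(i < n) F i j k) l p.
Proof.
case: l => [|[||i] [|[||j] [|[||k] [|c l]]]] /=;
  first [by rewrite big1|by rewrite -?sumrN sfval_sum].
Qed.

Lemma IE_form2 s n M : (forall j, support1 n (M^~ j)) ->
  IE s (form2 M) = fun l p =>
    s%:R^-1 * wedge (theta 0) (form1 (source1 n M)) l p.
Proof.
move=> Mn; apply/funext => l; apply/funext => p; rewrite /IE.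
congr (_ * wedge _ _ _ _); apply/funext => l'; apply/funext => q.
under eq_fsbigr do rewrite iprod_form2 iter_form1.
rewrite (fsum_ord (n := n)); last first.
  move=> i ni; rewrite (_ : (fun j => - M i j) = fun=> 0).
    by rewrite iter_ndv1_0; case: l' => [|[||?] [|[||?] [|? ?]]] //=;
      rewrite !sfvalE ?oppr0.
  by apply/funext => j; rewrite (Mn j i ni) oppr0.
exact: (form1_sum n (fun i => iter i ndv1 (fun j => - M i j))).
Qed.

Lemma IE_form3 s n N : (forall j k, support1 n (fun i => N i j k)) ->
  IE s (form3 N) = fun l p =>
    s%:R^-1 * wedge (theta 0) (form2 (source2 n N)) l p.
Proof.
move=> Nn; apply/funext => l; apply/funext => p; rewrite /IE.
congr (_ * wedge _ _ _ _); apply/funext => l'; apply/funext => q.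
under eq_fsbigr do rewrite iprod_form3 iter_form2.
rewrite (fsum_ord (n := n)); last first.
  move=> i ni; rewrite (_ : (fun j k => - N i j k) = fun _ _ => 0).
    by rewrite iter_ndv2_0; case: l' => [|[||?] [|[||?] [|[||?] [|? ?]]]] //=;
      rewrite !sfvalE ?oppr0.
  by apply/funext => j; apply/funext => k; rewrite (Nn j k i ni) oppr0.
exact: (form2_sum n (fun i => iter i ndv2 (fun j k => - N i j k))).
Qed.

End Components.

(** * Forms as differential operators *)

Section Pairing.
Context {R : realType}.
Local Notation sf := (smfun R ecoord).
Implicit Types (f g phi psi : sf) (v : nat -> sf) (M : nat -> nat -> sf)
  (N : nat -> nat -> nat -> sf).

(** An array of coefficients is read as a differential operator, or a
    bidifferential one. Under this pairing the action of [D_x] on forms becomes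
    [D_x] applied to the value, by the Leibniz rule, and no bookkeeping of
    indices remains. *)
Definition pair1 n v phi := \sum_(j < n) v j * iter j X phi.
Definition pair2 n M phi psi :=
  \sum_(j < n) \sum_(k < n) M j k * iter j X phi * iter k X psi.

Lemma spd_iterX_u i j n : spd (cu i) (iter j X (sf_coord R (cu n))) = (i == n + j)%N%:R.
Proof.
have -> : iter j X (sf_coord R (cu n)) = sf_coord R (cu (n + j)%N).
  elim: j => [|j IH] /=; first by rewrite addn0.
  by rewrite IH [LHS]tot_u addnS.
by rewrite spd_coord cu_eq eq_sym.
Qed.

Lemma spd_large (s : seq sf) :
  exists n, forall f, f \in s -> forall i, (n <= i)%N -> spd (cu i) f = 0.
Proof.
elim: s => [|f s [n IH]]; first by exists 0%N.
have [t df] := jdep_ex f.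
exists (n + \max_(i <- t) i.+1)%N => g; rewrite inE => /orP[/eqP->|/IH H] i ni.
  apply: (jdep0 df); apply/negP => it.
  have : (i < \max_(i <- t) i.+1)%N by rewrite (big_rem i)//= leq_max leqnn.
  by rewrite ltnNge (leq_trans (leq_addl _ _) ni).
by apply: H; rewrite (leq_trans (leq_addr _ _) ni).
Qed.

(** Applied to a coordinate [u_m] of order higher than those occurring in the
    coefficients, an operator has as derivative with respect to [u_(m+j)] its
    [j]-th coefficient. *)
Lemma coef_eq0 n v : (forall phi, pair1 n v phi = 0) ->
  forall j, (j < n)%N -> v j = 0.
Proof.
move=> v0 j jn; have [m mP] := spd_large [seq v i | i <- iota 0 n].
have := congr1 (spd (cu (m + j)%N)) (v0 (sf_coord R (cu m))).
rewrite (der0 (spd_der _)) (der_sum (spd_der _)) (bigD1 (Ordinal jn)) //=.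
rewrite big1 => [|i ij]; rewrite spdM spd_iterX_u.
  rewrite eqxx mulr1 (mP (v j)) ?mulr0 ?addr0// ?leq_addr//.
  by apply: map_f; rewrite mem_iota.
rewrite eqn_add2l (mP (v i)) ?leq_addr//; last first.
  by apply: (map_f v); rewrite mem_iota add0n ltn_ord.
have -> : (j == i)%N = false.
  by apply/negP => /eqP e; case/negP: ij; apply/eqP/val_inj.
by rewrite !mulr0 addr0.
Qed.

Lemma pair1_widen n m v phi : (n <= m)%N -> support1 n v ->
  pair1 m v phi = pair1 n v phi.
Proof.
move=> nm sv; rewrite /pair1 [RHS](big_ord_widen_cond m xpredT (fun j => v j * iter j X phi))//=.
rewrite [RHS]big_mkcond; apply: eq_bigr => j _.
by case: ltnP => // /sv ->; rewrite mul0r.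
Qed.

Definition NX f : sf := - X f.

Lemma pair_dv1 n v phi : support1 n v ->
  pair1 n.+1 (ndv1 v) phi = NX (pair1 n v phi).
Proof.
move=> sv; rewrite /NX /pair1 (der_sum X_der) -[RHS]sumrN.
under eq_bigr do rewrite /ndv1 /dv1 mulNr mulrDl opprD.
rewrite big_split /= big_ord_recr/= sv// (der0 X_der) mul0r subr0.
rewrite big_ord_recl /= mul0r oppr0 add0r -big_split.
by apply: eq_bigr => j _ /=; rewrite (derM X_der); ring.
Qed.

Lemma support_ndv1 n v : support1 n v -> support1 n.+1 (ndv1 v).
Proof.
move=> sv [//|j] nj.
by rewrite /ndv1 /dv1 !sv ?(der0 X_der) ?addr0 ?oppr0// ltnW.
Qed.

Lemma pair_iter1 n v phi i : support1 n v ->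
  support1 (i + n)%N (iter i ndv1 v) /\ pair1 (i + n)%N (iter i ndv1 v) phi = iter i NX (pair1 n v phi).
Proof.
move=> sv; elim: i => // i [IHs IH] /=; split; first exact: support_ndv1.
by rewrite (pair_dv1 _ IHs) IH.
Qed.

Lemma pair_source1 n m M phi : (forall i, support1 n (M i)) ->
  pair1 (m + n)%N (source1 m M) phi =
  \sum_(i < m) iter i NX (- pair1 n (M i) phi).
Proof.
move=> sM; rewrite {1}/pair1 /source1.
under eq_bigr do rewrite mulr_suml.
rewrite exchange_big; apply: eq_bigr => i _ /=.
have sN : support1 n (fun j => - M i j) by move=> j /sM ->; rewrite oppr0.
have [si pi] := pair_iter1 phi i sN.
rewrite -[LHS]/(pair1 _ _ _) (pair1_widen _ _ si); last first.
  by rewrite leq_add2r ltnW.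
rewrite pi; congr (iter i NX _); rewrite /pair1 -sumrN.
by apply: eq_bigr => j _; rewrite mulNr.
Qed.

Lemma support_source1 n m M : (forall i, support1 n (M i)) ->
  support1 (m + n)%N (source1 m M).
Proof.
move=> sM j mnj; rewrite /source1 big1// => i _.
have sN : support1 n (fun j => - M i j) by move=> k /sM ->; rewrite oppr0.
have [si _] := pair_iter1 0 i sN; apply: si.
by apply: leq_trans mnj; rewrite leq_add2r ltnW.
Qed.

Definition support2 n M := forall i j, (n <= i)%N || (n <= j)%N -> M i j = 0.

Lemma pair2_widen n m M phi psi : (n <= m)%N -> support2 n M ->
  pair2 m M phi psi = pair2 n M phi psi.
Proof.
move=> nm sM; rewrite /pair2.
rewrite [RHS](big_ord_widen_cond m xpredT
  (fun j => \sum_(k < n) M j k * iter j X phi * iter k X psi))//=.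
rewrite [RHS]big_mkcond; apply: eq_bigr => j _.
case: ltnP => nj; last by rewrite big1// => k _; rewrite sM ?nj// !mul0r.
rewrite [RHS](big_ord_widen_cond m xpredT
  (fun k => M j k * iter j X phi * iter k X psi))//=.
rewrite [RHS]big_mkcond; apply: eq_bigr => k _.
by case: ltnP => // nk; rewrite sM ?nk ?orbT// !mul0r.
Qed.

Lemma pair_dv2 n M phi psi : support2 n M ->
  pair2 n.+1 (ndv2 M) phi psi = NX (pair2 n M phi psi).
Proof.
move=> sM; rewrite /NX /pair2 (der_sum X_der) -[RHS]sumrN.
pose F j k := M j k * iter j X phi * iter k X psi.
transitivity (\sum_(j < n.+1) \sum_(k < n.+1)
   - (X (M j k) * iter j X phi * iter k X psi
     + (if val j is i.+1 then M i k else 0) * iter j X phi * iter k X psi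
     + (if val k is i.+1 then M j i else 0) * iter j X phi * iter k X psi)).
  apply: eq_bigr => j _; apply: eq_bigr => k _.
  by rewrite /ndv2 /dv2 mulNr mulNr !mulrDl.
under eq_bigr do rewrite sumrN !big_split /=.
rewrite [LHS]sumrN [RHS]sumrN !big_split /=; congr (- _).
have -> : \sum_(j < n.+1) \sum_(k < n.+1)
    X (M j k) * iter j X phi * iter k X psi =
    \sum_(j < n) \sum_(k < n) X (M j k) * iter j X phi * iter k X psi.
  rewrite big_ord_recr /= [X in _ + X]big1 ?addr0 => [|k _]; last first.
    by rewrite sM ?leqnn// (der0 X_der) !mul0r.
  apply: eq_bigr => j _; rewrite big_ord_recr /= sM ?leqnn ?orbT//.
  by rewrite (der0 X_der) !mul0r addr0.
have -> : \sum_(j < n.+1) \sum_(k < n.+1)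
    (if val j is i.+1 then M i k else 0) * iter j X phi * iter k X psi =
    \sum_(j < n) \sum_(k < n) M j k * iter j.+1 X phi * iter k X psi.
  rewrite big_ord_recl [X in X + _]big1 ?add0r => [|k _]; last first.
    by rewrite /= !mul0r.
  apply: eq_bigr => j _; rewrite big_ord_recr /= sM ?leqnn ?orbT//.
  by rewrite !mul0r addr0.
have -> : \sum_(j < n.+1) \sum_(k < n.+1)
    (if val k is i.+1 then M j i else 0) * iter j X phi * iter k X psi =
    \sum_(j < n) \sum_(k < n) M j k * iter j X phi * iter k.+1 X psi.
  rewrite big_ord_recr /= [X in _ + X]big1 ?addr0 => [|[[|k] kn] _]; last 2 first.
  - by rewrite /= !mul0r.
  - by rewrite /= sM ?leqnn// !mul0r.
  by apply: eq_bigr => j _; rewrite big_ord_recl /= !mul0r add0r.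
rewrite -!big_split; apply: eq_bigr => j _ /=.
rewrite (der_sum X_der) -!big_split; apply: eq_bigr => k _ /=.
by rewrite !(derM X_der); ring.
Qed.

Lemma support_ndv2 n M : support2 n M -> support2 n.+1 (ndv2 M).
Proof.
move=> sM i j nij; have nij' : (n <= i)%N || (n <= j)%N.
  by case/orP: nij => /ltnW ->; rewrite ?orbT.
rewrite /ndv2 /dv2 sM// (der0 X_der) add0r.
have -> : (if i is k.+1 then M k j else 0) = 0.
  case: i nij {nij'} => // i /orP[ni|nj]; apply: sM; first by rewrite -ltnS ni.
  by rewrite (ltnW nj) orbT.
have -> : (if j is k.+1 then M i k else 0) = 0.
  case: j nij {nij'} => // j /orP[ni|nj]; apply: sM; first by rewrite (ltnW ni).
  by apply/orP; right; rewrite -ltnS.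
by rewrite addr0 oppr0.
Qed.

Lemma pair_iter2 n M phi psi i : support2 n M ->
  support2 (i + n)%N (iter i ndv2 M) /\ pair2 (i + n)%N (iter i ndv2 M) phi psi = iter i NX (pair2 n M phi psi).
Proof.
move=> sv; elim: i => // i [IHs IH] /=; split; first exact: support_ndv2.
by rewrite (pair_dv2 _ _ IHs) IH.
Qed.

Lemma pair_source2 n m N phi psi : (forall i, support2 n (N i)) ->
  pair2 (m + n)%N (source2 m N) phi psi =
  \sum_(i < m) iter i NX (- pair2 n (N i) phi psi).
Proof.
move=> sN; rewrite {1}/pair2 /source2.
under eq_bigr => j _ do under eq_bigr => k _ do rewrite !mulr_suml.
under eq_bigr => j _ do rewrite exchange_big.
rewrite exchange_big; apply: eq_bigr => i _ /=.
have sN' : support2 n (fun j k => - N i j k) by move=> j k /sN ->; rewrite oppr0.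
have [si pi] := pair_iter2 phi psi i sN'.
rewrite -[LHS]/(pair2 _ _ _ _) (pair2_widen _ _ _ si); last first.
  by rewrite leq_add2r ltnW.
rewrite pi; congr (iter i NX _); rewrite /pair2 -sumrN.
by apply: eq_bigr => j _; rewrite -sumrN; apply: eq_bigr => k _; rewrite !mulNr.
Qed.

Lemma support_source2 n m N : (forall i, support2 n (N i)) ->
  support2 (m + n)%N (source2 m N).
Proof.
move=> sN j k mnj; rewrite /source2 big1// => i _.
have sN' : support2 n (fun j k => - N i j k) by move=> j' k' /sN ->; rewrite oppr0.
have [si _] := pair_iter2 0 0 i sN'; apply: si.
by case/orP: mnj => mn; apply/orP; [left|right]; apply: leq_trans mn;
  rewrite leq_add2r ltnW.
Qed.

Lemma coef2_eq0 n M : support2 n M -> (forall phi psi, pair2 n M phi psi = 0) ->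
  M = fun _ _ => 0.
Proof.
move=> sM M0; apply/funext => j; apply/funext => k.
have [nj|jn] := leqP n j; first by rewrite sM ?nj.
have [nk|kn] := leqP n k; first by rewrite sM ?nk ?orbT.
apply: (coef_eq0 (v := M j) _ kn) => psi.
apply: (coef_eq0 (v := fun j => pair1 n (M j) psi) _ jn) => phi.
rewrite -[RHS](M0 phi psi); apply: eq_bigr => i _.
rewrite mulr_suml; apply: eq_bigr => l _; ring.
Qed.

End Pairing.

(** * The Lie derivative of a vertical two-form *)

Section LieDerivative.
Context {R : realType}.
Local Notation sf := (smfun R ecoord).
Implicit Types (f g r K : sf) (w : @Defs.form R) (v : nat -> sf)
  (M : nat -> nat -> sf) (l s : seq ecoord).

Lemma wedge_eq0 (a : ecoord -> efun R) w l :
  (forall l', (size l').+1 = size l -> w l' = cst 0) -> wedge a w l = cst 0.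
Proof.
move=> w0; apply/funext => p; rewrite /wedge big1// => j _.
rewrite w0 ?mulr0// size_cat size_take size_drop ltn_ord.
by rewrite -addnS -subSn ?ltn_ord// subSS subnKC// ltnW.
Qed.

(** The expansion of a three by three determinant along its first row. *)
Lemma wedge3E (a b c : ecoord -> efun R) x y z p :
  wedge a (wedge b (form_of1 c)) [:: x; y; z] p =
    a x p * (b y p * c z p - b z p * c y p)
  - a y p * (b x p * c z p - b z p * c x p)
  + a z p * (b x p * c y p - b y p * c x p).
Proof.
rewrite /wedge /=; do 8?[rewrite ?big_ord_recl ?big_ord0 /=].
by ring.
Qed.

Lemma coframeE (g h : ecoord) (p : ecoord -> R) : coframe g h p = (h == g)%:R.
Proof. by []. Qed.

(** The matrix of [dx /\ theta^0 /\ (2 r theta^1)]. *)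
Definition Mr r : nat -> nat -> sf := fun i j => match i, j with
  | 0%N, 1%N => r *+ 2 | 1%N, 0%N => - (r *+ 2) | _, _ => 0 end.

Lemma Sigma_form2 r : Sigma_of (first_order_op (sfval r)) = form2 (Mr r).
Proof.
apply/funext => l; rewrite /Sigma_of.
case: (eqVneq (size l) 3%N) => [|l3]; last first.
  rewrite wedge_eq0 => [|l' e].
    by case: l l3 => [|[||?] [|[||?] [|[||?] [|? ?]]]].
  rewrite wedge_eq0// => l'' e'.
  case: l'' e' => [|? [|? ?]] e'; rewrite /form_of1//.
  by exfalso; move: l3; rewrite -e -e'.
case: l => [|x [|y [|z [|? ?]]]] // _; apply/funext => p.
rewrite wedge3E !big_ord_recl !big_ord0 /= /theta /dx ?coframeE.
have HX : sfval (r *+ 2) p = 2 * sfval r p by rewrite sfvalE mulr_natl.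
case: x => [||[|[|i]]]; case: y => [||[|[|j]]]; case: z => [||[|[|k]]];
  rewrite ?cu_eq /= ?sfvalE ?opprK ?HX; ring.
Qed.

Definition udep (c : ecoord) : option nat := if c is cu i then Some i else None.

(** Only the indices present in [l] contribute to the infinite sum. *)
Lemma dVE w l p : dV w l p = \sum_(j < size l) (-1) ^+ j *
  (if nth ct l j is cu i then pd (cu i) (w (take j l ++ drop j.+1 l)) p else 0).
Proof.
have lE i : (i \in undup (pmap udep l)) = (cu i \in l).
  rewrite mem_undup mem_pmap; apply/mapP/idP => [[[||j] // jl [->]] //|il].
  by exists (cu i).
rewrite /dV (fsum_seq (s := undup (pmap udep l))) ?undup_uniq//; last first.
  move=> i; rewrite lE => il; rewrite /wedge big1// => j _.
  rewrite /theta /coframe; case: eqP => [e|]; last by rewrite mulr0 mul0r.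
  by rewrite -e mem_nth in il.
rewrite /wedge exchange_big; apply: eq_bigr => j _ /=.
under eq_bigr do rewrite -mulrA.
rewrite -mulr_sumr; congr (_ * _); rewrite /theta /coframe.
have := @mem_nth _ ct l j (ltn_ord j); case: (nth ct l j) => [||i] il.
- by rewrite big1// => i _; rewrite mul0r.
- by rewrite big1// => i _; rewrite mul0r.
rewrite (bigD1_seq i) ?undup_uniq ?lE//= eqxx mul1r big1 ?addr0// => k ki.
by rewrite cu_eq eq_sym (negbTE ki) mul0r.
Qed.

Lemma pdE c f : pd c (sfval f) = sfval (spd c f). Proof. by []. Qed.

Lemma pd0 c : pd c (cst 0 : efun R) = cst 0.
Proof. by rewrite -[cst 0]/(sfval (0 : sf)) pdE (der0 (spd_der c)). Qed.

Lemma form1_scale f v l p :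
  sfval f p * form1 v l p = form1 (fun j => f * v j) l p.
Proof.
case: l => [|[||i] [|[||j] [|? ?]]] /=; rewrite ?mulr0//;
  by rewrite ?sfvalE ?mulrN.
Qed.

(** The contraction of [form2 M] by [T]. *)
Definition contr K M : nat -> sf := fun j =>
  \sum_(k < 2) iter k X K * - M k j.

Lemma iprodT_form2 K M : (forall j, support1 2 (M^~ j)) ->
  iprodT (sfval K) (form2 M) = form1 (contr K M).
Proof.
move=> sM; apply/funext => l; apply/funext => p; rewrite /iprodT.
rewrite {1}/iprod (_ : form2 M (ct :: l) = cst 0); last first.
  by case: l => [|[||?] [|[||?] [|? ?]]].
rewrite add0r; under eq_fsbigr do rewrite iprod_form2 iter_DxE form1_scale.
rewrite (fsum_ord (n := 2)); first exact: (form1_sum 2 (fun k j => iter k X K * - M k j)).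
move=> k k2; rewrite (_ : (fun j => _) = fun=> 0).
  by case: l => [|[||?] [|[||?] [|? ?]]] //=; rewrite ?sfvalE ?oppr0.
by apply/funext => j; rewrite (sM j k k2) oppr0 mulr0.
Qed.

(** The three places of [D_x] among the arguments; [(-1) ^+ e] is the sign of
    the permutation that brings it to the front. *)
Definition shape2 (e : nat) (i j : nat) : seq ecoord := match e with
  | 0 => [:: cx; cu i; cu j] | 1 => [:: cu i; cx; cu j]
  | _ => [:: cu i; cu j; cx] end.

Lemma dE_form1 v e i j p : (e < 3)%N -> dE (form1 v) (shape2 e i j) p =
  (-1) ^+ e * sfval (spd (cu j) (v i) - spd (cu i) (v j)) p.
Proof.
rewrite /dE /add_form dVE DxF_form1 /wedge.
by case: e => [|[|[|e]]]// _; do 8?[rewrite ?big_ord_recl ?big_ord0 /=];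
  rewrite /dt /dx ?coframeE /= ?pdE ?pd0 ?(derN (spd_der _)) !sfvalE; ring.
Qed.

Lemma dE_form2_t M e i j p : (e < 3)%N ->
  dE (form2 M) (ct :: shape2 e i j) p = (-1) ^+ e * sfval (spd ct (M i j)) p.
Proof.
rewrite /dE /add_form dVE DxF_form2 /wedge.
by case: e => [|[|[|e]]]// _; do 8?[rewrite ?big_ord_recl ?big_ord0 /=];
  rewrite /dt /dx ?coframeE /= ?pdE ?pd0 ?(derN (spd_der _)) ?(sfvalN, sfvalD) /=; ring.
Qed.

Lemma dE_form2_u M e k i j p : (e < 3)%N ->
  dE (form2 M) (cu k :: shape2 e i j) p = (-1) ^+ e *
   sfval (spd (cu k) (M i j) - spd (cu i) (M k j) + spd (cu j) (M k i)) p.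
Proof.
rewrite /dE /add_form dVE DxF_form2 /wedge.
by case: e => [|[|[|e]]]// _; do 8?[rewrite ?big_ord_recl ?big_ord0 /=];
  rewrite /dt /dx ?coframeE /= ?pdE ?pd0 ?(derN (spd_der _)) ?(sfvalN, sfvalD) /=; ring.
Qed.

Definition Lie_mx K M : nat -> nat -> sf := fun i j => Tv K (M i j)
  + \sum_(k < 2) (spd (cu i) (iter k X K) * M k j - spd (cu j) (iter k X K) * M k i).

Lemma Tv_ord K f n : (forall i, (n <= i)%N -> spd (cu i) f = 0) ->
  Tv K f = spd ct f + \sum_(i < n) iter i X K * spd (cu (i : nat)) f.
Proof.
move=> fn; have [s df] := jdep_ex f; rewrite (TvE _ df); congr (_ + _).
rewrite -(big_mkord xpredT (fun i => iter i X K * spd (cu i) f)) /index_iota subn0.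
apply: big_uniq_support; rewrite ?iota_uniq//; first by case: df.
- by move=> i /(jdep0 df) ->; rewrite mulr0.
- by move=> i; rewrite mem_iota add0n -leqNgt => /fn ->; rewrite mulr0.
Qed.

(** Cartan's formula. The terms in which [T] differentiates nothing cancel
    between the two halves of the formula, and what remains is the derivative of
    the entries together with the action of the linearization of [K] on each
    factor [theta]. *)
Lemma LieT_form2 K M e i j p : (e < 3)%N -> (forall j, support1 2 (M^~ j)) ->
  LieT (sfval K) (form2 M) (shape2 e i j) p = (-1) ^+ e * sfval (Lie_mx K M i j) p.
Proof.
move=> e3 sM; rewrite /LieT /add_form (iprodT_form2 _ sM) dE_form1//.
(* Beyond [n] neither [M i j] depends on [u_k] nor is the row [k] nonzero. *)
have [n0 nP] := spd_large [:: M i j]; pose n := (n0 + 2)%N.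
rewrite /iprodT {1}/iprod dE_form2_t//.
have -> : \sum_(k \in [set: nat]) iter k Dx (sfval K) p *
    iprod (cu k) (dE (form2 M)) (shape2 e i j) p =
  \sum_(k < n) (-1) ^+ e * sfval (iter k X K *
    (spd (cu (k : nat)) (M i j) - spd (cu i) (M k j) + spd (cu j) (M k i))) p.
  rewrite (fsum_ord (n := n)).
    apply: eq_bigr => k _; rewrite iter_DxE /iprod dE_form2_u// sfvalM; ring.
  move=> k nk; rewrite iter_DxE /iprod dE_form2_u//.
  have nk2 : (2 <= k)%N := leq_trans (leq_addl _ _) nk.
  rewrite (sM j k nk2) (sM i k nk2) !(der0 (spd_der _)) subr0 addr0.
  rewrite (nP (M i j)) ?mem_head// ?(leq_trans (leq_addr _ _) nk)//.
  by rewrite sfval0 !mulr0.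
rewrite -mulr_sumr -!mulrDr; congr (_ * _); rewrite -sfval_sum -!sfvalD.
congr (sfval _ p); rewrite /Lie_mx (Tv_ord K (n := n)); last first.
  move=> k nk; apply: nP; rewrite ?mem_head//; exact: leq_trans (leq_addr _ _) nk.
rewrite -!addrA; congr (_ + _).
under eq_bigr do rewrite -addrA mulrDr.
rewrite big_split /= -!addrA; congr (_ + _).
have -> : \sum_(k < n) iter k X K * (- spd (cu i) (M k j) + spd (cu j) (M k i)) =
    \sum_(k < 2) iter k X K * (- spd (cu i) (M k j) + spd (cu j) (M k i)).
  rewrite [RHS](big_ord_widen_cond n xpredT (fun k => iter k X K *
    (- spd (cu i) (M k j) + spd (cu j) (M k i))))/=; last exact: leq_addl.
  rewrite [RHS]big_mkcond; apply: eq_bigr => k _.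
  case: ltnP => // k2; rewrite (sM j k k2) (sM i k k2) !(der0 (spd_der _)).
  by rewrite oppr0 addr0 mulr0.
rewrite /contr !(der_sum (spd_der _)) -!sumrB -!big_split /=.
apply: eq_bigr => k _; rewrite !(derM (spd_der _)) !(derN (spd_der _)); ring.
Qed.

Lemma pi12_LieT K M : (forall j, support1 2 (M^~ j)) ->
  pi12 (LieT (sfval K) (form2 M)) = form2 (Lie_mx K M).
Proof.
move=> sM; apply/funext => l; rewrite /pi12; case: ifPn.
  have L e i j : (e < 3)%N -> LieT (sfval K) (form2 M) (shape2 e i j) =
      sfval ((-1) ^+ e * Lie_mx K M i j).
    by move=> e3; apply/funext => p; rewrite LieT_form2// sfval_sign.
  case: l => [|[||a] [|[||b] [|[||c] [|? ?]]]] //= _.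
  - by rewrite (L 0%N) // expr0 mul1r.
  - by rewrite (L 1%N) // expr1 mulN1r.
  - by rewrite (L 2%N) // expr2 mulrNN !mul1r.
by case: l => [|[||a] [|[||b] [|[||c] [|? ?]]]].
Qed.

End LieDerivative.

(** * The Hamiltonian condition *)

Section HamiltonianCondition.
Context {R : realType}.
Local Notation sf := (smfun R ecoord).
Implicit Types (f g r K : sf).

Definition order_le n f := forall i, (n < i)%N -> spd (cu i) f = 0.

Definition kd K (i : nat) : sf := spd (cu i) K.

Definition acoef K r :=
  order1_coef X (kd K 0) (kd K 1) (kd K 2) (kd K 3) r (Tv K r).
Definition bcoef K r := order3_coef X (kd K 2) (kd K 3) r.
Definition linK K := lin3 X (kd K 0) (kd K 1) (kd K 2) (kd K 3).
Definition adjK K := adj3 X (kd K 0) (kd K 1) (kd K 2) (kd K 3).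

Lemma smfun_mulrn_eq0 f n : f *+ n.+1 = 0 -> f = 0.
Proof.
move=> f0; apply: smfunP => p; have := congr1 (fun g => sfval g p) f0.
by rewrite sfvalMn sfval0 => /eqP; rewrite mulrn_eq0 /= => /eqP.
Qed.

(** The coefficient of [D^3] gives [b], and once [b = 0] that of [D] gives [a]. *)
Lemma skew_coefs (w a b : sf) :
  (forall phi, w * phi + (a *+ 2 * X phi + (b *+ 2 * X (X (X phi))
     + X b *+ 3 * X (X phi) + X (X b) *+ 3 * X phi)) = 0) ->
  a = 0 /\ b = 0.
Proof.
move=> H.
pose v (i : nat) : sf := match i with 0 => w | 1 => a *+ 2 + X (X b) *+ 3
  | 2 => X b *+ 3 | _ => b *+ 2 end.
have v0 phi : pair1 4 v phi = 0.
  by rewrite -[RHS](H phi) /pair1 !big_ord_recl big_ord0 /=; ring.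
have b0 : b = 0 by apply: (smfun_mulrn_eq0 (n := 1)); exact: (coef_eq0 v0 (j := 3)).
split=> //; apply: (smfun_mulrn_eq0 (n := 1)).
have := coef_eq0 v0 (j := 1) isT.
by rewrite /v b0 !(der0 X_der) mul0rn addr0.
Qed.

Section Fixed.
Variables (K r : sf).
Hypothesis K3 : order_le 3 K.

Let M := Lie_mx K (Mr r).

Lemma support_Mr j : support1 2 ((Mr r)^~ j).
Proof. by move=> [|[|i]]. Qed.

Lemma support_Lie_mx : (forall j, support1 5 (M^~ j)) /\ (forall i, support1 5 (M i)).
Proof.
have h k i : (k < 2)%N -> (5 <= i)%N -> spd (cu i) (iter k X K) = 0.
  move=> k2 i5; case: k k2 => [|[|k]]//= _; first by apply: K3; exact: ltn_trans i5.
  case: i i5 => // i i5; rewrite spd_X !K3 ?(der0 X_der) ?addr0//.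
  by rewrite ltnW.
have Mr0 i k : (5 <= i)%N -> Mr r i k = 0 /\ Mr r k i = 0.
  by split; [case: i H k => [|[|i]]|case: k i H => [|[|k]] [|[|i]]].
split=> [j i|i j] i5; rewrite /M /Lie_mx.
  rewrite (Mr0 _ _ i5).1 (der0 (Tv_der K)) add0r big1// => k _.
  by rewrite (h _ i (ltn_ord k) i5) mul0r sub0r (Mr0 _ _ i5).2 mulr0 oppr0.
rewrite (Mr0 _ _ i5).2 (der0 (Tv_der K)) add0r big1// => k _.
by rewrite (h _ j (ltn_ord k) i5) mul0r subr0 (Mr0 _ _ i5).2 mulr0.
Qed.

Lemma pair_Lie_mx phi :
  let T := Tv K r in
  [/\ pair1 5 (M 0%N) phi = T *+ 2 * X phi + kd K 0 * r *+ 2 * X phi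
        - X (kd K 0) * r *+ 2 * phi + r *+ 2 * X (linK K phi),
      pair1 5 (M 1%N) phi = - (T *+ 2) * phi + kd K 1 * r *+ 2 * X phi
        - (X (kd K 1) + kd K 0) * r *+ 2 * phi - r *+ 2 * linK K phi,
      pair1 5 (M 2) phi = kd K 2 * r *+ 2 * X phi
        - (X (kd K 2) + kd K 1) * r *+ 2 * phi,
      pair1 5 (M 3) phi = kd K 3 * r *+ 2 * X phi
        - (X (kd K 3) + kd K 2) * r *+ 2 * phi
    & pair1 5 (M 4) phi = - kd K 3 * r *+ 2 * phi].
Proof.
have K4 : spd (cu 4%N) K = 0 by exact: K3.
rewrite /pair1 !big_ord_recl !big_ord0 /= /M /Lie_mx !big_ord_recl !big_ord0 /=.
rewrite !spd_X /= K4 !(derN (Tv_der K)) !(derMn (Tv_der K)) !(der0 (Tv_der K)).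
rewrite (der0 X_der) -!/(kd K _) /linK /lin3 !(derD X_der) !(derM X_der).
split; ring.
Qed.

(** Up to the factor [- 2], the source form of the Lie derivative is the operator of
    lemma [hamiltonian_bracket]. *)
Lemma pair_source_Lie phi : pair1 10 (source1 5 M) phi =
  - (first_op X (Tv K r) phi + first_op X r (linK K phi)
     + adjK K (first_op X r phi)) *+ 2.
Proof.
have [_ sM] := support_Lie_mx.
rewrite (pair_source1 (n := 5) 5 phi sM) !big_ord_recl big_ord0 /=.
have [-> -> -> -> ->] := pair_Lie_mx phi.
by rewrite addr0; exact: (adjoint_lie_sum X_der).
Qed.

(** [I_E] of the Lie derivative is [theta^0] wedged with the source form: its
    vanishing leaves the [theta^0] component of the source form free, but the
    other components already force [a = b = 0]. *)
Lemma hamiltonianE : is_hamiltonian_for (sfval K) (first_order_op (sfval r)) <->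
  acoef K r = 0 /\ bcoef K r = 0.
Proof.
have [sM1 sM2] := support_Lie_mx.
rewrite /is_hamiltonian_for Sigma_form2 (pi12_LieT _ support_Mr).
rewrite (IE_form2 2 (n := 5)) -/M//.
pose W := source1 5 M.
have WE phi : pair1 10 W phi = - (acoef K r *+ 2 * X phi + X (acoef K r) * phi
    + (bcoef K r *+ 2 * X (X (X phi)) + X (bcoef K r) *+ 3 * X (X phi)
    + X (X (bcoef K r)) *+ 3 * X phi + X (X (X (bcoef K r))) * phi)) *+ 2.
  by rewrite pair_source_Lie (hamiltonian_bracket X_der).
split=> [H|[a0 b0]]; last first.
  have W0 : W = fun=> 0.
    apply/funext => j; have [jn|jn] := ltnP j 10.
      apply: (coef_eq0 (n := 10)) => // phi; rewrite WE a0 b0 !(der0 X_der).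
      by ring.
    exact: (support_source1 (m := 5) sM2).
  apply/funext => l; apply/funext => p; rewrite -/W W0.
  rewrite wedge_eq0 ?mulr0// => l' _; apply/funext => q.
  by case: l' => [|[||?] [|[||?] [|? ?]]] //=; rewrite sfvalN oppr0.
have W0 j : (0 < j)%N -> W j = 0.
  move=> j0; apply: smfunP => p.
  have /eqP := congr1 (fun w => w [:: cu 0%N; cx; cu j] p) H.
  rewrite /zero_form mulf_eq0 invr_eq0 pnatr_eq0 /= /wedge.
  rewrite /= !big_ord_recl big_ord0 /= /theta /coframe !cu_eq /=.
  rewrite (gtn_eqF j0) -/W expr0 !mul1r !(mulr0, mul0r) !addr0.
  by move=> /eqP.
have [a0 b0] : acoef K r *+ 2 = 0 /\ bcoef K r *+ 2 = 0.
  apply: (@skew_coefs (W 0%N + (X (acoef K r) + X (X (X (bcoef K r)))) *+ 2)).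
  move=> phi; have := WE phi.
  rewrite /pair1 big_ord_recl big1 => [|i _]; last by rewrite W0// mul0r.
  rewrite addr0 /= => e; rewrite mulrDl e !(derMn X_der); ring.
by split; apply: (smfun_mulrn_eq0 (n := 1)).
Qed.

End Fixed.
End HamiltonianCondition.

(** * The form kappa and the equations for its density *)

Section ConservationLaw.
Context {R : realType}.
Local Notation sf := (smfun R ecoord).
Implicit Types (f g r : sf).

Fact sf_inv_key (C : eqType) (f : smfun R C) :
  (forall p, sfval f p != 0) -> smooth (fun p => (sfval f p)^-1).
Proof.
by move=> f0; apply: elementary_smooth; apply: elem_inv => //;
  apply: elem_smooth; exact: sfvalP.
Qed.

Variables (K : sf).
Hypothesis K3_neq0 : forall p, sfval (kd K 3) p != 0.

Definition inv_K3 : sf := SFun (sf_inv_key K3_neq0).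
Definition third : sf := sf_cst _ 3^-1.

Lemma inv_K3E p : sfval inv_K3 p = (sfval (kd K 3) p)^-1.
Proof. by []. Qed.

Lemma sf_cstE (C : eqType) (a : R) (p : C -> R) : sfval (sf_cst C a) p = a.
Proof. by []. Qed.

Lemma K3_inv : kd K 3 * inv_K3 = 1.
Proof. by apply: smfunP => p; rewrite sfvalM inv_K3E sfval1 (divff (K3_neq0 p)). Qed.

Lemma thirdE : third *+ 3 = 1.
Proof. by apply: smfunP => p; rewrite sfvalMn sf_cstE sfval1; field. Qed.

(** Half of [K2hat]. *)
Definition qK : sf := (kd K 2 - X (kd K 3)) * (inv_K3 * third).

Lemma qKE : kd K 2 = X (kd K 3) + kd K 3 *+ 3 * qK.
Proof.
have -> : kd K 3 *+ 3 * qK =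
  (kd K 2 - X (kd K 3)) * ((kd K 3 * inv_K3) * (third *+ 3)).
  by rewrite /qK; ring.
by rewrite K3_inv thirdE; ring.
Qed.

Definition kap1 : sf := qK *+ 2.
Definition kap2 : sf := kappa_t X (kd K 0) (kd K 1) (kd K 3) qK.

Lemma K2hatE : K2hat (sfval K) = sfval kap1.
Proof.
apply/funext => p; rewrite /K2hat pdE pdE DxE -!/(kd K _).
rewrite /kap1 sfvalMn /qK sfvalM sfvalB sfvalM.
rewrite inv_K3E /third sf_cstE.
by field; rewrite K3_neq0.
Qed.

Lemma kappaE : kappa (sfval K) = (sfval kap1, sfval kap2).
Proof.
rewrite /kappa K2hatE; congr pair; apply/funext => p.
rewrite !pdE DxE -!/(kd K _) DxE.
rewrite (_ : (fun q => _) = sfval (kd K 3 * X kap1)); last first.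
  by apply/funext => q; rewrite sfvalM ?DxE.
rewrite DxE /kap1 /kap2 /kappa_t (derMn X_der qK) mulrnAr (derMn X_der (_ * _)).
rewrite !(sfvalD, sfvalN, sfvalMn, sfvalM, sfvalX) -!/(kd K _).
by field.
Qed.

(** The two components of [kappa = d_H (log r)], cleared of denominators. *)
Definition log_eqs r := X r = r * kap1 /\ Tv K r = r * kap2.

(** Up to invertible factors [b] is [R h - D R], and modulo this equation [a] is
    [T R - R k]. *)
Lemma log_eqsP r : acoef K r = 0 /\ bcoef K r = 0 <-> log_eqs r.
Proof.
have bE : bcoef K r = kd K 3 *+ 3 * (r * kap1 - X r).
  by rewrite /bcoef (order3_coefE (D := X) (q := qK) _ qKE).
have aE : X r = r * kap1 -> acoef K r = Tv K r - r * kap2.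
  by move=> Xr; rewrite /acoef (order1_coefE X_der _ _ _ qKE Xr).
split=> [[a0 b0]|[Xr Tr]]; last by rewrite bE aE// Xr Tr !subrr mulr0.
have Xr : X r = r * kap1.
  have : inv_K3 * third * bcoef K r = 0 by rewrite b0 mulr0.
  rewrite bE (_ : _ * _ = (kd K 3 * inv_K3) * (third *+ 3) * (r * kap1 - X r)).
    by rewrite K3_inv thirdE !mul1r => /eqP; rewrite subr_eq0 => /eqP.
  by ring.
by split=> //; apply/eqP; rewrite -subr_eq0 -aE// a0.
Qed.

End ConservationLaw.

(** * The symplectic condition *)

Section SymplecticCondition.
Context {R : realType}.
Local Notation sf := (smfun R ecoord).
Implicit Types (f g r phi psi : sf) (M : nat -> nat -> sf).

Definition dM M : nat -> nat -> nat -> sf := fun i j k =>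
  - spd (cu i) (M j k) + spd (cu j) (M i k) - spd (cu k) (M i j).

(** The sign comes from moving [theta^i] past [dx]. *)
Lemma dV_form2 M : dV (form2 M) = form3 (dM M).
Proof.
apply/funext => l; apply/funext => p; rewrite dVE.
have [l4|l4] := eqVneq (size l) 4; last first.
  rewrite big1 => [|j _].
    by case: l l4 => [|[||?] [|[||?] [|[||?] [|[||?] [|? ?]]]]].
  case: nth => [||i]; rewrite ?mulr0//.
  suff -> : form2 M (take j l ++ drop j.+1 l) = cst 0 by rewrite pd0 mulr0.
  have : size (take j l ++ drop j.+1 l) != 3%N.
    apply: contra_neq l4; rewrite size_cat size_take size_drop ltn_ord.
    by have := ltn_ord j; lia.
  by case: (_ ++ _) => [|[||?] [|[||?] [|[||?] [|? ?]]]].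
case: l l4 => [|a [|b [|c [|d [|? ?]]]]] // _.
rewrite /=; do 8?[rewrite ?big_ord_recl ?big_ord0 /=].
case: a => [||a]; case: b => [||b]; case: c => [||c]; case: d => [||d];
  rewrite /= ?pdE ?pd0 ?(derN (spd_der _)) /dM ?(sfvalN, sfvalD) /=; ring.
Qed.

Lemma dM_support r : order_le 3 r ->
  (forall j k, support1 4 (fun i => dM (Mr r) i j k)) /\
  (forall i, support2 4 (dM (Mr r) i)).
Proof.
move=> r3.
have h i j k : (4 <= i)%N -> spd (cu i) (Mr r j k) = 0.
  move=> i4; case: j => [|[|j]]; case: k => [|[|k]] /=;
  by rewrite ?(der0 (spd_der _)) ?(derN (spd_der _)) ?(derMn (spd_der _)) ?r3 ?mul0rn ?oppr0.
have Mr0 i k : (4 <= i)%N -> Mr r i k = 0 /\ Mr r k i = 0.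
  by split; [case: i H k => [|[|i]]|case: k i H => [|[|k]] [|[|i]]].
split=> [j k i i4|i j k /orP[i4|i4]]; rewrite /dM !(h _ _ _ i4);
  by rewrite ?(Mr0 _ _ i4).1 ?(Mr0 _ _ i4).2 !(der0 (spd_der _)); ring.
Qed.

(** The source form of [dV Sigma] pairs with any two functions to the alternating
    sum of [adjoint_dV_sum], which vanishes. *)
Lemma deltaV_eq0 r : order_le 3 r -> spd (cu 2%N) r = X (spd (cu 3%N) r) ->
  deltaV 2 (Sigma_of (first_order_op (sfval r))) = zero_form.
Proof.
move=> r3 r2; have [s1 s2] := dM_support r3.
rewrite /deltaV Sigma_form2 dV_form2 (IE_form3 3 s1).
have -> : source2 4 (dM (Mr r)) = fun _ _ => 0.
  have sW := support_source2 (m := 4) s2.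
  apply: (coef2_eq0 sW) => phi psi; rewrite (pair_source2 _ _ _ s2).
  rewrite -[RHS](adjoint_dV_sum X_der (spd (cu 0%N) r) (spd (cu 1%N) r) (spd (cu 3%N) r) phi psi).
  rewrite -r2 !big_ord_recl big_ord0 /= addr0.
  rewrite /NX; congr (- _ + (- X (- _) + (- X (- X (- _)) + - X (- X (- X (- _))))));
  rewrite /pair2 !big_ord_recl !big_ord0 /= /dM /=
    !(derN (spd_der _)) !(derMn (spd_der _)) !(der0 (spd_der _)) /lin3; ring.
apply/funext => l; apply/funext => p.
rewrite wedge_eq0 ?mulr0// => l' _; apply/funext => q.
by case: l' => [|[||?] [|[||?] [|[||?] [|? ?]]]] //=; rewrite sfvalN oppr0.
Qed.

Lemma first_order_coefs r i :
  nth (cst 0) (first_order_op (sfval r)) i =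
  sfval (match i with 0 => X r | 1 => r *+ 2 | _ => 0 end : sf).
Proof.
case: i => [|[|i]] /=; rewrite ?DxE ?nth_nil//.
by apply/funext => p; rewrite sfvalMn mulr_natl.
Qed.

Lemma first_order_smooth r : smooth_coefs (first_order_op (sfval r)).
Proof. by move=> i; rewrite first_order_coefs; exact: sfvalP. Qed.

Lemma first_order_skew r : skew_adjoint (first_order_op (sfval r)).
Proof.
move=> f0 sf0 p; pose f : sf := SFun sf0; rewrite -[f0]/(sfval f).
have adjE : apply_adj Dx (first_order_op (sfval r)) (sfval f) p =
    sfval (X r * f - X (r *+ 2 * f)) p.
  rewrite /apply_adj -[size _]/2%N 2!big_ord_recl big_ord0 !first_order_coefs.
  rewrite -[X in _ + (_ * X + _)]/(Dx (sfval (r *+ 2 * f)) p) DxE.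
  by rewrite expr0 mul1r addr0 expr1 mulN1r sfvalB sfvalM.
have opE : apply_op Dx (first_order_op (sfval r)) (sfval f) p =
    sfval (X r * f + r *+ 2 * X f) p.
  rewrite /apply_op -[size _]/2%N 2!big_ord_recl big_ord0 !first_order_coefs.
  rewrite -[X in _ + (_ * X + _)]/(Dx (sfval f) p) DxE.
  by rewrite addr0 [RHS]sfvalD !sfvalM.
rewrite adjE opE -sfvalN; congr (sfval _ p).
by rewrite (derM X_der) (derMn X_der); ring.
Qed.

Lemma Sigma_neq0 r : (exists p, sfval r p != 0) ->
  Sigma_of (first_order_op (sfval r)) <> zero_form.
Proof.
case=> p rp; rewrite Sigma_form2.
move/(congr1 (fun w => w [:: cx; cu 0%N; cu 1%N] p)) => /eqP.
by rewrite /zero_form /= sfvalMn mulrn_eq0 /= (negbTE rp).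
Qed.

Lemma symplectic_first_order r : order_le 3 r ->
  spd (cu 2%N) r = X (spd (cu 3%N) r) -> (exists p, sfval r p != 0) ->
  Defs.is_symplectic (first_order_op (sfval r)).
Proof.
move=> r3 r2 r0; split; [exact: first_order_smooth|exact: first_order_skew| |].
  exact: Sigma_neq0.
exact: deltaV_eq0.
Qed.

End SymplecticCondition.

(** * The defect of self-adjointness *)

Section VariationalOperator.
Context {R : realType}.
Local Notation sf := (smfun R ecoord).
Local Notation sfj := (smfun R jcoord2).
Implicit Types (f g r K : sf) (phi psi h : sfj).

Lemma jdep_big (V : nmodType) s n f (F : nat -> V) : jdep s f ->
  (forall i, (n <= i)%N -> spd (cu i) f = 0) ->
  (forall i, spd (cu i) f = 0 -> F i = 0) ->
  \sum_(i <- s) F i = \sum_(i < n) F i.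
Proof.
move=> df fn F0; rewrite -(big_mkord xpredT F) /index_iota subn0.
apply: big_uniq_support; rewrite ?iota_uniq//; first by case: df.
- by move=> i /(jdep0 df)/F0.
- by move=> i; rewrite mem_iota add0n -leqNgt => /fn/F0.
Qed.

Lemma ev_ord n phi f : (forall i, (n <= i)%N -> spd (cu i) f = 0) ->
  ev phi (tj f) = \sum_(i < n) iter i DX phi * tj (spd (cu (i : nat)) f).
Proof.
move=> fn; have [s df] := jdep_ex f; rewrite (ev_tj _ df).
apply: (jdep_big (F := fun i => iter i DX phi * tj (spd (cu i) f)) df fn).
by move=> i ->; rewrite tj0 mulr0.
Qed.

Lemma evs_ord n phi f : (forall i, (n <= i)%N -> spd (cu i) f = 0) ->
  evs phi (tj f) =
  \sum_(i < n) (-1) ^+ i * iter i DX (phi * tj (spd (cu (i : nat)) f)).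
Proof.
move=> fn; have [s df] := jdep_ex f; rewrite (evs_tj _ df).
apply: (jdep_big (F := fun i => (-1) ^+ i * iter i DX (phi * tj (spd (cu i) f))) df fn).
by move=> i ->; rewrite tj0 mulr0 iterDX_0 mulr0.
Qed.

Lemma ev_order3 phi f : order_le 3 f -> ev phi (tj f) =
  lin3 DX (tj (kd f 0)) (tj (kd f 1)) (tj (kd f 2)) (tj (kd f 3)) phi.
Proof.
move=> f3; rewrite (ev_ord (n := 4))// !big_ord_recl big_ord0 /= /lin3 /kd; ring.
Qed.

Lemma evs_order3 phi f : order_le 3 f -> evs phi (tj f) =
  adj3 DX (tj (kd f 0)) (tj (kd f 1)) (tj (kd f 2)) (tj (kd f 3)) phi.
Proof.
move=> f3; rewrite (evs_ord (n := 4))// !big_ord_recl big_ord0 /= /adj3 /kd.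
have c (a b : sfj) : a * b = b * a by rewrite mulrC.
rewrite ![phi * _]mulrC; ring.
Qed.

(** The left-hand side [E (u_t - K)] of the variational operator equation. *)
Definition Delta K r : sfj := first_op DX (tj r) (Geq K).

Lemma apply_opE K r : apply_op jDx (map to_jet (first_order_op (sfval r)))
    (fun p => p (cu (1%N, 0%N)) - to_jet (sfval K) p) = sfval (Delta K r).
Proof.
apply/funext => p.
have -> : (fun p => p (cu (1%N, 0%N)) - to_jet (sfval K) p) = sfval (Geq K) by [].
rewrite /apply_op -[size _]/2%N 2!big_ord_recl big_ord0 /= jDxE.
rewrite -[to_jet (Dx _)]/(to_jet (Dx (sfval r))) DxE addr0.
rewrite /Delta /first_op [RHS]sfvalD !sfvalM DX_tj sfvalMn addrC.
have -> : to_jet (fun p0 => 2 * sfval r p0) p = sfval (tj r) p *+ 2.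
  by rewrite /to_jet mulr_natl.
reflexivity.
Qed.

(** The part of the defect of self-adjointness that comes from linearizing the
    coefficients of the operator; all its terms contain [u_t - K]. *)
Definition bracket2 K r phi : sfj :=
  first_op DX (ev (Geq K) (tj r)) phi
  + evs (phi * DX (Geq K) - Geq K * DX phi) (tj r)
  - (ev phi (tj r) *+ 2 * DX (Geq K) + DX (ev phi (tj r)) * Geq K).

(** The linearization of [E G] is [E] composed with that of [G], plus terms from
    the coefficients of [E]. As [E] is skew-adjoint and the linearization of
    [G = u_t - K] is [D_t - l_K], comparing with the adjoint leaves
    [D_t(E) + E l_K + l_K^* E]; by lemma [DT_tj] the first term is [T(E)] up to
    a term in [G], which joins [bracket2]. *)
Lemma self_adjoint_defect K r phi : order_le 3 K ->
  evs phi (Delta K r) - ev phi (Delta K r) =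
  tj (acoef K r) *+ 2 * DX phi + tj (X (acoef K r)) * phi
  + (tj (bcoef K r) *+ 2 * DX (DX (DX phi)) + tj (X (bcoef K r)) *+ 3 * DX (DX phi)
     + tj (X (X (bcoef K r))) *+ 3 * DX phi + tj (X (X (X (bcoef K r)))) * phi)
  + bracket2 K r phi.
Proof.
move=> K3.
have tjMn f n : tj (f *+ n) = tj f *+ n.
  by elim: n => [|n IH]; rewrite ?mulr0n ?tj0// !mulrS tjD IH.
have aE : tj (acoef K r) = order1_coef DX (tj (kd K 0)) (tj (kd K 1))
    (tj (kd K 2)) (tj (kd K 3)) (tj r) (tj (Tv K r)).
  rewrite /acoef /order1_coef.
  by rewrite !(tjD, tjN, tjMn, tjM, =^~ DX_tj).
have bE : tj (bcoef K r) = order3_coef DX (tj (kd K 2)) (tj (kd K 3)) (tj r).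
  rewrite /bcoef /order3_coef.
  by rewrite !(tjD, tjN, tjMn, tjM, =^~ DX_tj).
have hb : tj (acoef K r) *+ 2 * DX phi + tj (X (acoef K r)) * phi
  + (tj (bcoef K r) *+ 2 * DX (DX (DX phi)) + tj (X (bcoef K r)) *+ 3 * DX (DX phi)
     + tj (X (X (bcoef K r))) *+ 3 * DX phi + tj (X (X (X (bcoef K r)))) * phi) =
  first_op DX (tj (Tv K r)) phi + first_op DX (tj r) (ev phi (tj K))
    + evs (first_op DX (tj r) phi) (tj K).
  rewrite -(DX_tj (acoef K r)) -(DX_tj (X (X (bcoef K r)))).
  rewrite -(DX_tj (X (bcoef K r))) -(DX_tj (bcoef K r)) aE bE.
  rewrite (ev_order3 _ K3) (evs_order3 _ K3).
  exact: esym (hamiltonian_bracket DX_der _ _ _ _ _ _ _).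
rewrite hb {aE bE hb}.
have evsE : evs phi (Delta K r) =
    - evs (first_op DX (tj r) phi) (Geq K)
    + evs (phi * DX (Geq K) - Geq K * DX phi) (tj r).
  transitivity (evs (- DX (phi * (tj r *+ 2)) + phi * DX (tj r)) (Geq K)
      + evs ((phi * DX (Geq K)) *+ 2 - DX (phi * Geq K)) (tj r)).
    rewrite /Delta /first_op !mulr2n evsD !evsM !evs_DX (evsD _ (tj r)) !evsDl !evsNl.
    by ring.
  rewrite -evsNl; congr (evs _ _ + evs _ _); rewrite /first_op !(derM DX_der);
    rewrite ?(derMn DX_der (tj r)); ring.
have evE : ev phi (Delta K r) = first_op DX (tj r) (ev phi (Geq K))
    + (ev phi (tj r) *+ 2 * DX (Geq K) + DX (ev phi (tj r)) * Geq K).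
  rewrite /Delta /first_op (derD (ev_der phi)) !(derM (ev_der phi)).
  by rewrite (derMn (ev_der phi) (tj r)) !ev_DX; ring.
rewrite evsE evE evs_Geq ev_Geq /bracket2.
have -> : DT (first_op DX (tj r) phi) = first_op DX (tj r) (DT phi)
    + (tj (Tv K r) + ev (Geq K) (tj r)) *+ 2 * DX phi
    + DX (tj (Tv K r) + ev (Geq K) (tj r)) * phi.
  rewrite -DT_tj /first_op (derD DT_der) !(derM DT_der) (derMn DT_der (tj r)).
  by rewrite -!DXT; ring.
rewrite /first_op !(derD DX_der) !(derN DX_der); ring.
Qed.

End VariationalOperator.

(** * Variational operators satisfy the density equations *)

Section VariationalNecessity.
Context {R : realType}.
Local Notation sf := (smfun R ecoord).
Local Notation sfj := (smfun R jcoord2).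
Implicit Types (f g r K : sf) (phi psi h k : sfj).

Lemma bracket2_eq0 K r phi : order_le 3 r ->
  spd (cu 2%N) r = X (spd (cu 3%N) r) -> bracket2 K r phi = 0.
Proof.
move=> r3 r2; rewrite /bracket2 !(ev_order3 _ r3) (evs_order3 _ r3).
have -> : tj (kd r 2) = DX (tj (kd r 3)) by rewrite DX_tj -r2.
by apply/eqP; rewrite subr_eq0; apply/eqP; exact: (symplectic_bracket DX_der).
Qed.

Variable K : sf.

(** The jet over [e] of a solution of the equation, up to first order in [t]. *)
Definition lift (e : ecoord -> R) : jcoord2 -> R := fun c => match c with
  | ct => e ct | cx => e cx
  | cu (a, i) => match a with
    | 0 => e (cu i) | 1 => sfval (iter i X K) e | _ => 0 end
  end.

Lemma restr_lift e : restr (lift e) = e.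
Proof. by apply/funext => -[||i]. Qed.

Lemma tj_lift f e : sfval (tj f) (lift e) = sfval f e.
Proof. by rewrite -[in RHS](restr_lift e). Qed.

(** Functions that vanish, with all their [x]-derivatives, on solutions. *)
Definition onshell0 h := forall n e, sfval (iter n DX h) (lift e) = 0.

Lemma onshell0_Geq : onshell0 (Geq K).
Proof.
by move=> n e; rewrite iter_DX_Geq sfvalB tj_lift subrr.
Qed.

Lemma onshell0_DX h : onshell0 h -> onshell0 (DX h).
Proof. by move=> h0 n e; rewrite -iterSr. Qed.

Lemma onshell0_iter n h : onshell0 h -> onshell0 (iter n DX h).
Proof. by move=> h0; elim: n => //= n; exact: onshell0_DX. Qed.

Lemma onshell0_0 : onshell0 0.
Proof. by move=> n e; rewrite iterDX_0. Qed.

Lemma onshell0_D h k : onshell0 h -> onshell0 k -> onshell0 (h + k).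
Proof. by move=> h0 k0 n e; rewrite iterDX_D sfvalD h0 k0 addr0. Qed.

Lemma onshell0_N h : onshell0 h -> onshell0 (- h).
Proof. by move=> h0 n e; rewrite iterDX_N sfvalN h0 oppr0. Qed.

Lemma onshell0_M k h : onshell0 h -> onshell0 (k * h).
Proof.
move=> h0 n; elim: n k h h0 => [|n IH] k h h0 e.
  by rewrite sfvalM (h0 0%N) mulr0.
rewrite iterSr (derM DX_der) [h * _]mulrC iterDX_D sfvalD.
by rewrite (IH k _ (onshell0_DX h0)) (IH _ _ h0) addr0.
Qed.

Lemma onshell0_Mn h n : onshell0 h -> onshell0 (h *+ n).
Proof.
by move=> h0; rewrite -mulr_natl; exact: onshell0_M.
Qed.

Lemma onshell0_sum (J : Type) (s : seq J) (F : J -> sfj) :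
  (forall j, onshell0 (F j)) -> onshell0 (\sum_(j <- s) F j).
Proof. by move=> F0; apply: big_ind => //; [exact: onshell0_0|exact: onshell0_D]. Qed.

Lemma onshell0_first_op k h phi : onshell0 k -> onshell0 (first_op DX k phi).
Proof.
move=> k0; apply: onshell0_D; rewrite mulrC; apply: onshell0_M.
  exact: onshell0_Mn.
exact: onshell0_DX.
Qed.

Lemma onshell0_bracket2 r phi : onshell0 (bracket2 K r phi).
Proof.
have [s dr] := jdep_ex r.
have G0 := onshell0_Geq; have DG0 := onshell0_DX G0.
apply: onshell0_D; first apply: onshell0_D.
- apply: onshell0_first_op => //; rewrite (ev_tj _ dr).
  apply: onshell0_sum => i; rewrite mulrC; apply: onshell0_M.
  exact: onshell0_iter.
- rewrite (evs_tj _ dr); apply: onshell0_sum => i; apply: onshell0_M.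
  apply: onshell0_iter; rewrite mulrC; apply: onshell0_M.
  apply: onshell0_D; first exact: onshell0_M.
  by apply: onshell0_N; rewrite mulrC; exact: onshell0_M.
apply: onshell0_N; apply: onshell0_D; exact: onshell0_M.
Qed.

Hypothesis K3 : order_le 3 K.

(** By [helmholtz] the defect of self-adjointness is zero. Evaluated on solutions
    and on functions of [E] it only retains the skew operator with coefficients
    [a] and [b]. *)
Lemma variational_necessary r :
  admits_variational (sfval K) (first_order_op (sfval r)) ->
  acoef K r = 0 /\ bcoef K r = 0.
Proof.
case=> _ [L0 [sL]]; pose L : sfj := SFun sL; rewrite -[L0]/(sfval L).
rewrite apply_opE eulerE => /sfun_val_inj DL.
apply: (@skew_coefs _ (X (acoef K r) + X (X (X (bcoef K r))))) => f.
apply: smfunP => e; rewrite sfval0 -(tj_lift _ e).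
have := self_adjoint_defect r (tj f) K3.
rewrite DL helmholtz subrr => /esym/eqP.
rewrite addr_eq0 => /eqP/(congr1 (fun h => sfval h (lift e))).
rewrite sfvalN (onshell0_bracket2 r (tj f) 0%N) oppr0 !DX_tj => <-.
have tjMn g n : tj (g *+ n) = tj g *+ n.
  by elim: n => [|n IH]; rewrite ?mulr0n ?tj0// !mulrS tjD IH.
rewrite -!tjMn -!tjM -!tjD; congr (sfval (tj _) _); ring.
Qed.

End VariationalNecessity.

(** * The order of the density *)

Section Logarithm.
Context {R : realType}.
Local Notation sf := (smfun R ecoord).
Implicit Types (f g r : sf).

Fact sf_ln_key r : (forall p, 0 < sfval r p) -> smooth (fun p => ln (sfval r p)).
Proof.
by move=> r0; apply: elementary_smooth; apply: elem_ln => //;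
  apply: elem_smooth; exact: sfvalP.
Qed.

Definition sf_ln r (r0 : forall p, 0 < sfval r p) : sf := SFun (sf_ln_key r0).

Lemma spd_ln c r (r0 : forall p, 0 < sfval r p) :
  spd c r = r * spd c (sf_ln r0).
Proof.
apply: smfunP => p; rewrite sfvalM.
have -> : sfval (spd c (sf_ln r0)) p = (sfval r p)^-1 * sfval (spd c r) p.
  apply: pd_eq; apply: is_derive_upd_ln => //.
  by apply: smooth_pderivable; exact: sfvalP.
by rewrite mulrA divff ?mul1r// gt_eqF.
Qed.

Lemma vf_ln A r (r0 : forall p, 0 < sfval r p) : vf A r = r * vf A (sf_ln r0).
Proof.
have [S [uS dr df]] := dep_common r (sf_ln r0).
rewrite (vfE _ uS dr) (vfE _ uS df) mulr_sumr; apply: eq_bigr => c _.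
by rewrite (spd_ln c r0) mulrCA.
Qed.

(** The variable [u_5] enters only through the last term, where two total
    derivatives act on [g], of order four. *)
Lemma spd5_kappa_t (k0 k1 k3 g : sf) :
  spd (cu 5%N) k0 = 0 -> spd (cu 5%N) k1 = 0 -> order_le 3 k3 -> order_le 4 g ->
  spd (cu 5%N) (kappa_t X k0 k1 k3 g) = (X (k3 * spd (cu 4%N) g)
   + k3 * X (spd (cu 4%N) g) + k3 * spd (cu 3%N) g) *+ 2.
Proof.
move=> k05 k15 k3o go.
have k34 : spd (cu 4%N) k3 = 0 by exact: k3o.
have k35 : spd (cu 5%N) k3 = 0 by exact: k3o.
have g5 : spd (cu 5%N) g = 0 by exact: go.
have Xk5 : spd (cu 5%N) (X k3) = 0 by rewrite spd_X k35 k34 (der0 X_der) addr0.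
have Xg4 : spd (cu 4%N) (X g) = X (spd (cu 4%N) g) + spd (cu 3%N) g.
  by rewrite spd_X.
have Xg5 : spd (cu 5%N) (X g) = spd (cu 4%N) g.
  by rewrite spd_X g5 (der0 X_der) add0r.
have in5 : spd (cu 5%N) (X (k3 * X g)) = X (k3 * spd (cu 4%N) g)
    + k3 * X (spd (cu 4%N) g) + k3 * spd (cu 3%N) g.
  rewrite spd_X (derM (spd_der _) k3) (derM (spd_der _) k3) Xg4 Xg5 k35 k34.
  by rewrite !(mulr0, addr0); ring.
rewrite /kappa_t; have dd : derivation (@spd R _ (cu 5%N : ecoord)) by exact: spd_der.
rewrite !(derD dd) !(derN dd) !(derD dd).
rewrite ?(derMn dd k0) ?(derMn dd (k1 * g)) ?(derMn dd (X k3 * _)).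
rewrite ?(derMn dd (k3 * _)) ?(derMn dd (X (k3 * _))) in5.
rewrite !exprS expr0 mulr1 !(derM dd k1) !(derM dd (X k3)) !(derM dd k3).
by rewrite !(derM dd g) k05 k15 k35 g5 Xk5; ring.
Qed.

Variable K : sf.
Hypothesis K3 : order_le 3 K.
Hypothesis K3_neq0 : forall p, sfval (kd K 3) p != 0.
Local Notation q := (qK K3_neq0).
Local Notation kap1 := (kap1 K3_neq0).
Local Notation kap2 := (kap2 K3_neq0).

Lemma K3_cancel f : kd K 3 * f = 0 -> f = 0.
Proof. by move=> e; rewrite -[f]mul1r -(K3_inv K3_neq0) mulrAC e mul0r. Qed.

Lemma kd_order i : order_le 3 (kd K i).
Proof. by move=> j j3; rewrite /kd spdC K3// (der0 (spd_der _)). Qed.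

Lemma XkdE j : order_le 4 (X (kd K j)).
Proof. by case=> // i i4; rewrite spd_X !kd_order ?(der0 X_der) ?addr0// ltnW. Qed.

Lemma spd_qK i : spd (cu i) (kd K 2) = spd (cu i) (X (kd K 3))
  + kd K 3 *+ 3 * spd (cu i) q + q * (spd (cu i) (kd K 3) *+ 3).
Proof.
rewrite {1}(qKE K3_neq0) (derD (spd_der _)) (derM (spd_der _)).
by rewrite (derMn (spd_der _)) addrA.
Qed.

Lemma q_order : order_le 4 q.
Proof.
move=> i i4; apply: K3_cancel; apply: (smfun_mulrn_eq0 (n := 2)).
have := spd_qK i; rewrite XkdE// !kd_order ?(ltn_trans _ i4)//.
by rewrite mul0rn mulr0 addr0 add0r mulrnAl => <-.
Qed.

Lemma q4E : kd K 3 *+ 3 * spd (cu 4%N) q = - spd (cu 3%N) (kd K 3).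
Proof.
have k4 j : spd (cu 4%N) (kd K j) = 0 by exact: kd_order.
have := spd_qK 4; rewrite spd_X !k4 (der0 X_der).
by rewrite !add0r mul0rn mulr0 addr0 => /esym/eqP; rewrite addrC addr_eq0 => /eqP.
Qed.

Lemma q3E : kd K 3 *+ 3 * spd (cu 3%N) q =
  - X (spd (cu 3%N) (kd K 3)) - spd (cu 3%N) (kd K 3) *+ 3 * q.
Proof.
have := spd_qK 3; rewrite spd_X /= [spd (cu 2%N) _]spdC -/(kd K 2) => e.
apply: (addrI (X (spd (cu 3%N) (kd K 3)) + spd (cu 3%N) (kd K 2)
  + q * (spd (cu 3%N) (kd K 3) *+ 3))).
by rewrite addrAC -e; ring.
Qed.

Section Potential.
Variable f : sf.
Hypothesis Xf : X f = kap1.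
Hypothesis Tf : Tv K f = kap2.

Lemma potential_step i : spd (cu i) f =
  spd (cu i.+1) q *+ 2 - X (spd (cu i.+1) f).
Proof.
rewrite -(derMn (spd_der _) q) -[q *+ 2]Xf spd_X.
by rewrite addrAC subrr add0r.
Qed.

(** Downward induction from the finite order of [f]: [h] has order four. *)
Lemma potential_order : order_le 3 f.
Proof.
have [m mP] := spd_large [:: f].
have H d i : (3 < i)%N -> (m <= i + d)%N -> spd (cu i) f = 0.
  elim: d i => [|d IH] i i3; first by rewrite addn0; apply: mP; rewrite mem_head.
  rewrite addnS -addSn => mi; rewrite potential_step.
  have -> : spd (cu i.+1) f = 0 by apply: IH => //; exact: ltnW.
  have -> : spd (cu i.+1) q = 0 by exact: q_order.
  by rewrite mul0rn (der0 X_der) subr0.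
by move=> i i3; apply: (H m) => //; exact: leq_addl.
Qed.

Lemma f3E : spd (cu 3%N) f = spd (cu 4%N) q *+ 2.
Proof. by rewrite potential_step potential_order// (der0 X_der) subr0. Qed.

Lemma f2E : spd (cu 2%N) f = spd (cu 3%N) q *+ 2 - X (spd (cu 4%N) q) *+ 2.
Proof. by rewrite potential_step f3E (derMn X_der (spd (cu 4%N) q)). Qed.

(** The coefficient of [u_5] in [T f = kap2]. *)
Lemma coef5 : kd K 3 * spd (cu 2%N) f
    + (X (kd K 3) *+ 3 + kd K 2) * spd (cu 3%N) f =
  (X (kd K 3 * spd (cu 4%N) q) + kd K 3 * X (spd (cu 4%N) q)
   + kd K 3 * spd (cu 3%N) q) *+ 2.
Proof.
have f0 c i : (3 < i)%N -> spd (cu i) (spd c f) = 0.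
  by move=> i3; rewrite spdC potential_order// (der0 (spd_der _)).
have K0 i : (3 < i)%N -> spd (cu i) K = 0 by exact: K3.
have XK i : (4 < i)%N -> spd (cu i) (X K) = 0.
  by case: i => // i i4; rewrite spd_X !K0 ?(der0 X_der) ?addr0// ltnW.
have XK4 : spd (cu 4%N) (X K) = kd K 3.
  by rewrite spd_X (K0 4%N isT) (der0 X_der) add0r.
have XXK5 : spd (cu 5%N) (X (X K)) = kd K 3.
  by rewrite spd_X (XK 5%N isT) (der0 X_der) add0r.
have XXK4 : spd (cu 4%N) (X (X K)) = X (kd K 3) *+ 2 + kd K 2.
  by rewrite spd_X XK4 spd_X -!/(kd K _); ring.
have XXXK5 : spd (cu 5%N) (X (X (X K))) = X (kd K 3) *+ 3 + kd K 2.
  by rewrite spd_X XXK5 XXK4; ring.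
have TfE : spd (cu 5%N) (Tv K f) = kd K 3 * spd (cu 2%N) f
    + (X (kd K 3) *+ 3 + kd K 2) * spd (cu 3%N) f.
  have fn i : (4 <= i)%N -> spd (cu i) f = 0 by exact: potential_order.
  rewrite (Tv_ord K fn) (derD (spd_der _)) (der_sum (spd_der _)).
  rewrite !big_ord_recl big_ord0 /= !(derM (spd_der _)) !f0//.
  by rewrite XXXK5 XXK5 (XK 5%N isT) (K0 5%N isT); ring.
rewrite -TfE Tf; apply: spd5_kappa_t; [exact: kd_order|exact: kd_order| |exact: q_order].
exact: kd_order.
Qed.

(** The relation is an identity between [q_3], [q_4] and [D q_4], where [q_i] is
    the derivative of [q] with respect to [u_i]. Differentiating
    [K_2 = D K_3 + 3 K_3 q] gives two equations, lemmas [q4E] and [q3E], and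
    [coef5] a third; together they imply it after multiplication by [3 K_3]. *)
Lemma potential_symplectic :
  spd (cu 2%N) f = X (spd (cu 3%N) f) + kap1 * spd (cu 3%N) f.
Proof.
have e4 := q4E; have e3 := q3E; have e5 := coef5.
move: e5; rewrite f2E f3E /kap1 (derM X_der) (qKE K3_neq0) => e5.
rewrite (derMn X_der (spd (cu 4%N) q)).
set a := spd (cu 4%N) q in e3 e4 e5 *; set b := spd (cu 3%N) q in e3 e4 e5 *.
have e6 : spd (cu 3%N) (kd K 3) = - (kd K 3 *+ 3 * a) by rewrite e4 opprK.
have Xe6 : X (spd (cu 3%N) (kd K 3)) =
    - (kd K 3 *+ 3 * X a + a * (X (kd K 3) *+ 3)).
  by rewrite e6 (derN X_der) (derM X_der) (derMn X_der (kd K 3)).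
apply/eqP; rewrite -subr_eq0; apply/eqP; apply: K3_cancel.
apply: (smfun_mulrn_eq0 (n := 2)).
move: e3; rewrite Xe6 e6 => e3.
have -> : kd K 3 * (b *+ 2 - X a *+ 2 - (X a *+ 2 + q *+ 2 * (a *+ 2))) *+ 3 =
  (kd K 3 *+ 3 * b) *+ 2 - kd K 3 * X a *+ 12 - kd K 3 * q * a *+ 12 by ring.
by rewrite e3; move/eqP: e5; rewrite -subr_eq0 => /eqP <-; ring.
Qed.

End Potential.

(** The relation of [potential_symplectic] for the logarithm, multiplied by
    [r]. *)
Lemma log_symplectic r : (forall p, 0 < sfval r p) -> 
  log_eqs K3_neq0 r ->
  order_le 3 r /\ spd (cu 2%N) r = X (spd (cu 3%N) r).
Proof.
move=> r0 [Xr Tr]; pose f := sf_ln r0.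
have cancel g h : r * g = r * h -> g = h.
  move=> e; apply: smfunP => p; have := congr1 (fun k => sfval k p) e.
  by rewrite !sfvalM; apply: mulfI; rewrite gt_eqF.
have Xf : X f = kap1 by apply: cancel; rewrite -Xr; exact: esym (vf_ln _ r0).
have Tf : Tv K f = kap2 by apply: cancel; rewrite -Tr; exact: esym (vf_ln _ r0).
split=> [i i3|]; first by rewrite (spd_ln _ r0) (potential_order Xf)// mulr0.
rewrite !(spd_ln _ r0) (potential_symplectic Xf Tf) (derM X_der) Xr.
by rewrite mulrDr; ring.
Qed.

Lemma log_eqs_ln r (r0 : forall p, 0 < sfval r p) :
  X (sf_ln r0) = kap1 -> Tv K (sf_ln r0) = kap2 -> log_eqs K3_neq0 r.
Proof.
move=> Xf Tf; split; first by rewrite -Xf; exact: (vf_ln _ r0).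
by rewrite -Tf; exact: (vf_ln _ r0).
Qed.

End Logarithm.

(** * Densities vanish nowhere *)

Section Nonvanishing.
Context {R : realType}.

(** A solution of a scalar linear ordinary differential equation [y' = y g]
    vanishes everywhere or nowhere: multiplying [y ^+ 2] by an exponential whose
    rate dominates [g] between the two points gives a monotone function. *)
Lemma linear_ode_neq0 (y g : R -> R) (a b : R) :
  (forall s : R, is_derive s 1 y (y s * g s)) ->
  (forall s : R, derivable g s 1) -> y a != 0 -> y b != 0.
Proof.
move=> dy dg ya; pose d := `|b - a|.
have dab : a - d <= a + d by have : 0 <= d := normr_ge0 _; lra.
have cg : {within `[a - d, a + d], continuous (fun t : R => g t * g t)}.
  apply: derivable_within_continuous => s _; exact: derivableM.
have [c _ cmax] := EVT_max dab cg.
pose M := (g c * g c + 1) * Num.sg (b - a).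
pose z s := y s ^+ 2 * expR (M * s *+ 2).
have dz (s : R) : is_derive s 1 z ((y s ^+ 2 * expR (M * s *+ 2)) *+ 2 * (g s + M)).
  rewrite /z.
  have dexp : is_derive s 1 (fun s => expR (M * s *+ 2)) (expR (M * s *+ 2) * (M *+ 2)).
    apply: (@is_derive1_comp _ (@expR R)).
    rewrite (_ : (fun s => _) = (fun s => (M *+ 2) *: s)); last first.
      by apply/funext => t; rewrite -mulrnAl.
    rewrite -[X in is_derive _ _ _ X]mulr1.
    exact: is_deriveZ.
  have dy2 : is_derive s 1 (fun s => y s ^+ 2) (y s * (y s * g s) *+ 2).
    rewrite (_ : (fun s => _) = (fun s => y s * y s)); last first.
      by apply/funext.
    apply: is_derive_eq (is_deriveM (dy s) (dy s)) _.
    by rewrite /GRing.scale /= mulr2n.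
  apply: is_derive_eq (is_deriveM dy2 dexp) _.
  by rewrite /GRing.scale /=; ring.
have [xi xile e] := MVT_everywhere a b dz.
have zb : 0 < z b.
  have za : 0 < z a by rewrite mulr_gt0 ?expR_gt0// exprn_even_gt0.
  rewrite -(subrK (z a) (z b)) ltr_wpDl// e -mulrA.
  have xiI : xi \in `[a - d, a + d]%R.
    by rewrite in_itv /=; move: xile; rewrite ler_norml /d => /andP[h1 h2]; lra.
  apply: mulr_ge0; first by rewrite mulrn_wge0// mulr_ge0 ?sqr_ge0 ?expR_ge0.
  rewrite mulrDl /M -mulrA -normrEsg.
  have gx : `|g xi| <= g c * g c + 1.
    apply: le_trans (_ : g xi * g xi + 1 <= _); last by rewrite lerD2r cmax.
    rewrite -[g xi * _]expr2 -real_normK ?num_real//; set n := `|g xi|; nra.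
  have : - (`|g xi| * `|b - a|) <= g xi * (b - a).
    by rewrite -normrM lerNl -normrN ler_norm.
  have : `|g xi| * `|b - a| <= (g c * g c + 1) * `|b - a|.
    by rewrite ler_wpM2r.
  by lra.
by apply/eqP => yb; move: zb; rewrite /z yb expr0n mul0r ltxx.
Qed.

Section Divisible.
Variables (C : eqType).
Local Notation sfc := (smfun R C).
Implicit Types (f g r : sfc).

Definition divides r f := exists g, f = r * g.

Lemma divides_mul r f g : divides r f -> divides r (g * f).
Proof. by case=> h ->; exists (g * h); rewrite mulrCA. Qed.

Lemma divides_add r f g : divides r f -> divides r g -> divides r (f + g).
Proof. by case=> h -> [k ->]; exists (h + k); rewrite mulrDr. Qed.

Lemma divides_sub r f g : divides r f -> divides r g -> divides r (f - g).
Proof. by case=> h -> [k ->]; exists (h - k); rewrite mulrBr. Qed.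

Lemma divides0 r : divides r 0.
Proof. by exists 0; rewrite mulr0. Qed.

Lemma divides_sum r (J : Type) (s : seq J) (F : J -> sfc) :
  (forall j, divides r (F j)) -> divides r (\sum_(j <- s) F j).
Proof.
by move=> rF; apply: big_ind => //; [exact: divides0|exact: divides_add].
Qed.

(** Along every coordinate line [r] solves a linear equation, and it depends on
    finitely many coordinates: it vanishes everywhere or nowhere. *)
Lemma divides_neq0 r p q : (forall c, divides r (spd c r)) ->
  sfval r p != 0 -> sfval r q != 0.
Proof.
move=> rdiv rp; have line c p' s : sfval r p' != 0 -> sfval r (upd p' c s) != 0.
  have [g rc] := rdiv c; rewrite -{1}(upd_id p' c).
  apply: (linear_ode_neq0 (y := fun s => sfval r (upd p' c s))
    (g := fun s => sfval g (upd p' c s))) => t.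
    have -> : sfval r (upd p' c t) * sfval g (upd p' c t)
       = pd c (sfval r) (upd p' c t) by rewrite -sfvalM -rc.
    by apply: is_derive_upd; apply: smooth_pderivable; exact: sfvalP.
  have dg : pderivable c (sfval g) by apply: smooth_pderivable; exact: sfvalP.
  by have [] := is_derive_upd p' t dg.
have [S dS] := dep_ex r.
suff [p' p'0 pq] : exists2 p', sfval r p' != 0 & {in S, p' =1 q}.
  by rewrite -(dS p' q).
elim: S {dS} => [|c S [p' p'0 pq]]; first by exists p.
exists (upd p' c (q c)); first exact: line.
move=> d; rewrite inE updE; case: eqP => [->//|_ /= dS]; exact: pq.
Qed.

End Divisible.

Section LogEquations.
Local Notation sf := (smfun R ecoord).
Variables (K r : sf).
Hypothesis K3_neq0 : forall p, sfval (kd K 3) p != 0.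
Hypothesis r_eqs : log_eqs K3_neq0 r.

(** For the variables [u_i] by downward induction: differentiating [D r = r h]
    with respect to [u_(i+1)] expresses [r_i] through [r_(i+1)], and the terms
    [D r] that appear are again multiples of [r]. Then [r_x] and [r_t] are read off
    from [D r] and [T r]. *)
Lemma log_eqs_divides c : divides r (spd c r).
Proof.
case: r_eqs => Xr Tr; have [s dr] := jdep_ex r.
have div_cu i : divides r (spd (cu i) r).
  have [m mP] := spd_large [:: r].
  have H d j : (m <= j + d)%N -> divides r (spd (cu j) r).
    elim: d j => [|d IH] j.
      by rewrite addn0 => mj; rewrite mP ?mem_head//; exact: divides0.
    rewrite addnS -addSn => /IH [g rg].
    have := spd_X j.+1 r; rewrite rg Xr !(derM (spd_der _) r) (derM X_der r) Xr rg.
    move=> e; exists (spd (cu j.+1) (kap1 K3_neq0) - X g).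
    apply: (addrI (r * X g + g * (r * kap1 K3_neq0))); rewrite -e; ring.
  by apply: (H m); exact: leq_addl.
case: c => [||//].
- have := TvE K dr; rewrite Tr => /eqP; rewrite -subr_eq => /eqP <-.
  apply: divides_sub; first by eexists.
  by apply: divides_sum => i; exact: divides_mul.
- have := jvfE (tot_comp true S) dr; rewrite -[vf _ r]/(X r) Xr /=.
  rewrite mul0r mul1r add0r => /eqP; rewrite -subr_eq => /eqP <-.
  apply: divides_sub; first by eexists.
  by apply: divides_sum => i; exact: divides_mul.
Qed.

Lemma log_eqs_trivial : (exists p, sfval r p != 0) ->
  trivial_claw (sfval K) (kappa (sfval K)).
Proof.
case=> p rp.
have r0 q : sfval r q != 0 := divides_neq0 q log_eqs_divides rp.
have r20 q : 0 < sfval (r * r) q.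
  by rewrite sfvalM lt_def mulf_neq0 ?r0//= -expr2 sqr_ge0.
case: r_eqs => Xr Tr.
(* The square makes the logarithm independent of the sign of [r]. *)
pose half : sf := sf_cst _ 2^-1; pose f := half * sf_ln r20.
have halfE A g : vf A half = 0 -> vf A r = r * g -> vf A f = g.
  move=> h0 rg; rewrite /f (derM (vf_der A)) h0 mulr0 addr0.
  have := vf_ln A r20; rewrite (derM (vf_der A)) rg => e.
  apply: smfunP => q; have := congr1 (fun h => sfval h q) e.
  rewrite !(sfvalD, sfvalM) /half sf_cstE => e'.
  apply: (mulfI (r0 q)); apply: (mulfI (r0 q)).
  move: e'; move: (sfval r q) (sfval g q) (sfval (vf A _) q) => x y z e'. lra.
have half0 A : vf A half = 0.
  have d0 : dep [::] half by [].
  by rewrite (vfE _ _ d0)// big_nil.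
have Xf : X f = kap1 K3_neq0 := halfE _ _ (half0 _) Xr.
have Tf : Tv K f = kap2 K3_neq0 := halfE _ _ (half0 _) Tr.
exists (sfval f); split; first exact: sfvalP.
by rewrite (kappaE K3_neq0) /dH DxE TvfE Xf Tf.
Qed.

End LogEquations.

End Nonvanishing.

(** * Integrals over the unit interval *)

Section UnitIntegral.
Context {R : realType}.
Implicit Types (f g : R -> R).

Definition int01 f : R := \int[@lebesgue_measure R]_(s in `[0, 1]) f s.

Lemma int01_integrable f : continuous f ->
  (@lebesgue_measure R).-integrable `[0, 1] (EFin \o f).
Proof.
move=> cf; apply: continuous_compact_integrable; first exact: segment_compact.
exact: continuous_subspaceT.
Qed.

Lemma continuous_add f g : continuous f -> continuous g ->
  continuous (fun s => f s + g s).
Proof. by move=> cf cg s; exact: (cvgD (cf s) (cg s)). Qed.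

Lemma continuous_scale (a : R) f : continuous f -> continuous (fun s => a * f s).
Proof. by move=> cf s; exact: (cvgM (cvg_cst a) (cf s)). Qed.

Lemma int01D f g : continuous f -> continuous g ->
  int01 (fun s => f s + g s) = int01 f + int01 g.
Proof. by move=> cf cg; apply: RintegralD => //; exact: int01_integrable. Qed.

Lemma int01Z (a : R) f : continuous f -> int01 (fun s => a * f s) = a * int01 f.
Proof. by move=> cf; apply: RintegralZl => //; exact: int01_integrable. Qed.

Lemma int01_cst (a : R) : int01 (cst a) = a.
Proof.
rewrite /int01 Rintegral_cst//= lebesgue_measure_itv/= lte_fin ltr01.
by rewrite oppr0 adde0 mulr1.
Qed.

Lemma int01_le f (e : R) : continuous f ->
  (forall s, 0 <= s <= 1 -> `|f s| <= e) -> `|int01 f| <= e.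
Proof.
move=> cf fe; apply: le_trans (le_normr_Rintegral _ (int01_integrable cf)) _ => //.
rewrite -[X in _ <= X](int01_cst e); apply: le_Rintegral => //.
- apply: int01_integrable => s; apply: continuous_comp; first exact: cf.
  exact: norm_continuous.
- by apply: int01_integrable => s; exact: cvg_cst.
Qed.

Lemma int01_FTC (F f : R -> R) : (forall s : R, is_derive s 1 F (f s)) ->
  continuous f -> int01 f = F 1 - F 0.
Proof.
move=> dF cf; rewrite /int01 /Rintegral (@continuous_FTC2 _ _ F)//.
- exact: continuous_subspaceT.
- have cF s : {for s, continuous F}.
    by apply: differentiable_continuous; apply/derivable1_diffP; have [] := dF s.
  split=> [s _||]; first by have [] := dF s.
  + exact/cvg_at_right_filter/cF.
  + exact/cvg_at_left_filter/cF.
- by move=> s _; rewrite derive1E; have [] := dF s.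
Qed.

(** A form of differentiability that matches the uniform estimates below. *)
Lemma is_derive_eps (E : R -> R) (t v : R) :
  (forall e, 0 < e -> exists2 d, 0 < d & forall s, `|s - t| < d ->
    `|E s - E t - v * (s - t)| <= e * `|s - t|) ->
  is_derive t 1 E v.
Proof.
move=> HE.
have cv : h^-1 *: ((E \o shift t) (h *: 1) - E t) @[h --> 0^'] --> v.
  apply/cvgrPdist_le => e e0; have [d d0 dE] := HE e e0.
  near=> h.
  have h0 : h != 0 by near: h; exact: nbhs_dnbhs_neq.
  have hd : `|h| < d.
    near: h; apply: dnbhs0_lt => //.
  rewrite /= /shift [h *: 1]mulr1.
  have := dE (h + t); rewrite addrK => /(_ hd).
  move=> le_d; rewrite /GRing.scale /=.
  have -> : v - h^-1 * (E (h + t) - E t) = - (h^-1 * (E (h + t) - E t - v * h)).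
    by field.
  by rewrite normrN normrM normfV ler_pdivrMl ?normr_gt0// [_ * e]mulrC.
by apply: DeriveDef; [apply/cvg_ex; exists v|exact/cvg_lim].
Unshelve. all: by end_near. Qed.

End UnitIntegral.

(** * Chain rule and homotopy *)

Section ChainRule.
Context {R : realType} {C : eqType}.
Local Notation sf := (smfun R C).
Implicit Types (f : sf) (p a b : C -> R) (S l : seq C).

Let bound S b : R := 1 + \sum_(c <- S) `|b c|.

Let bound_gt0 S b : 0 < bound S b.
Proof. by rewrite ltr_pwDl// sumr_ge0. Qed.

Let le_bound S b c : c \in S -> `|b c| <= bound S b.
Proof.
move=> cS; rewrite /bound (big_rem c)//= addrCA lerDl addr_ge0// sumr_ge0//.
Qed.

(** The chain rule along a line is proved by moving the coordinates one at a
    time, with the mean value theorem for each of them. *)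
Lemma is_derive_line f a b (t : R) S : uniq S -> dep S f ->
  is_derive t 1 (fun s => sfval f (fun c => a c + s * b c))
    (\sum_(c <- S) b c * sfval (spd c f) (fun c => a c + t * b c)).
Proof.
move=> uS dS.
pose g l s c := if c \in l then a c + s * b c else a c + t * b c.
suff H l : uniq l -> is_derive t 1 (fun s => sfval f (g l s))
    (\sum_(c <- l) b c * sfval (spd c f) (fun c => a c + t * b c)).
  have := H S uS; congr (is_derive t 1 _ _); apply/funext => s.
  by apply: dS => c cS; rewrite /g cS.
have gt l' : g l' t = fun c => a c + t * b c.
  by apply/funext => c; rewrite /g; case: ifP.
elim: l => [_|c l IH /= /andP[cl ul]].
  rewrite big_nil (_ : (fun s => _) = cst (sfval f (g [::] t))).
    exact: is_derive_cst.
  by apply/funext => s; congr (sfval f _); apply/funext.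
pose v := sfval (spd c f) (fun c => a c + t * b c).
pose E s := sfval f (g (c :: l) s) - sfval f (g l s).
have gE s : g (c :: l) s = upd (g l s) c (a c + s * b c).
  apply/funext => d; rewrite updE /g inE.
  by case: eqP => [->|]//.
have gE0 s : g l s = upd (g l s) c (a c + t * b c).
  by rewrite -[RHS]/(upd (g l s) c _) -[X in upd _ c X](_ : g l s c = _) ?upd_id// /g (negbTE cl).
have dE : is_derive t 1 E (b c * v).
  apply: is_derive_eps => e e0.
  have e'0 : 0 < e / (1 + `|b c|) by rewrite divr_gt0// ltr_pwDl.
  have cpd : contin (sfval (spd c f)) by apply: smooth_contin; exact: sfvalP.
  have [d d0 dP] := contin_eps (fun c => a c + t * b c) cpd (dep_spd c dS) e'0.
  exists (d / bound (c :: S) b); first by rewrite divr_gt0.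
  move=> s sd; have sd' : `|s - t| * bound (c :: S) b < d by rewrite -ltr_pdivlMr.
  have Et : E t = 0 by rewrite /E !gt subrr.
  rewrite Et subr0 {1}/E gE [g l s]gE0 upd_upd.
  have df : pderivable c (sfval f) by apply: smooth_pderivable; exact: sfvalP.
  have [xi xile ->] := MVT_upd (g l s) (a c + t * b c) (a c + s * b c) df.
  have eb : a c + s * b c - (a c + t * b c) = (s - t) * b c by ring.
  rewrite eb in xile *.
  rewrite -[pd c (sfval f)]/(sfval (spd c f)).
  set w := sfval (spd c f) (upd _ _ _).
  have wv : `|w - v| < e / (1 + `|b c|).
    apply: dP => c' c'S; apply: le_lt_trans sd'.
    rewrite updE; case: eqP => [->|_].
      by apply: le_trans xile _; rewrite normrM ler_wpM2l// le_bound ?mem_head.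
    rewrite /g; case: ifP => _; last by rewrite subrr normr0 mulr_ge0// ltW.
    rewrite (_ : _ - _ = (s - t) * b c'); last by ring.
    by rewrite normrM ler_wpM2l// le_bound// inE c'S orbT.
  have -> : w * ((s - t) * b c) - b c * v * (s - t) = (w - v) * b c * (s - t).
    by ring.
  rewrite normrM ler_wpM2r// normrM.
  apply: le_trans (_ : e / (1 + `|b c|) * `|b c| <= _).
    by rewrite ler_wpM2r// ltW.
  have bp : 0 < 1 + `|b c| by rewrite ltr_pwDl.
  by rewrite -mulrA ger_pMr// mulrC ler_pdivrMr// mul1r lerDr.
rewrite big_cons.
have -> : (fun s => sfval f (g (c :: l) s)) = (fun s => E s + sfval f (g l s)).
  by apply/funext => s; rewrite /E subrK.
by apply: is_deriveD; exact: IH.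
Qed.

End ChainRule.

Section Scaling.
Context {R : realType} {I : choiceType}.
Local Notation C := (jcoord I).
Local Notation sf := (smfun R C).
Implicit Types (f g : sf) (p q : C -> R).

Definition scale (s : R) p : C -> R := fun c =>
  match c with ct => p ct | cx => p cx | cu i => s * p (cu i) end.

Lemma is_derive_scale k f p (t : R) : jdep k f ->
  is_derive t 1 (fun s => sfval f (scale s p))
    (\sum_(i <- k) p (cu i) * sfval (spd (cu i) f) (scale t p)).
Proof.
case=> uk dk.
pose a (c : C) := if c is cu _ then 0 else p c.
pose b (c : C) := if c is cu _ then p c else 0.
have sE s : (fun c => a c + s * b c) = scale s p.
  by apply/funext => -[||i]; rewrite /a /b /= ?mulr0 ?addr0 ?add0r.
have := is_derive_line a b t (coords_uniq uk) dk.
under eq_fun do rewrite sE.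
by rewrite /coords !big_cons big_map sE /b !mul0r !add0r.
Qed.

Lemma scale_continuous f p : continuous (fun s => sfval f (scale s p)).
Proof.
move=> s; have [k dk] := jdep_ex f.
apply: differentiable_continuous; apply/derivable1_diffP.
by have [] := is_derive_scale p s dk.
Qed.

(** Compactness of the interval makes continuity at the points [scale s p]
    uniform in [s]. *)
Lemma scale_uniform S f p (e : R) : dep S f -> 0 < e ->
  exists2 d : R, 0 < d & forall q, {in S, forall c, `|q c - p c| < d} ->
    forall s, 0 <= s <= 1 -> `|sfval f (scale s q) - sfval f (scale s p)| < e.
Proof.
move=> dS e0.
pose P (d s : R) := forall q, {in S, forall c, `|q c - p c| < d} ->
  `|sfval f (scale s q) - sfval f (scale s p)| < e.
have /compact_near_coveringP/near_covering_withinP cov := @segment_compact R 0 1.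
have : \forall d \near 0^'+, `[0, 1] `<=` P d.
  apply: cov => s0 _.
  have e20 : 0 < e / 2 by rewrite divr_gt0.
  have cf : contin (sfval f) by apply: smooth_contin; exact: sfvalP.
  have [d0 d00 d0P] := contin_eps (scale s0 p) cf dS e20.
  pose B : R := 1 + \sum_(c <- S) `|p c|.
  have B0 : 0 < B by rewrite ltr_pwDl// sumr_ge0.
  have d020 : 0 < d0 / 2 by rewrite divr_gt0.
  exists ([set s | `|s - s0| < d0 / 2 / B], [set d | d < d0 / 2]) => /=.
    split; last by apply: nbhs_right_lt.
    exists (d0 / 2 / B) => /=; first by rewrite divr_gt0.
    by move=> s /=; rewrite distrC.
  move=> [s d] /= [sd dd]; rewrite in_itv /= => /andP[s_ge0 s_le1] q qd.
  have cl r : {in S, forall c, `|r c - p c| < d0 / 2} ->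
      `|sfval f (scale s r) - sfval f (scale s0 p)| < e / 2.
    move=> rd; apply: d0P => c cS; have rc := rd c cS.
    have lt2 : d0 / 2 < d0 by lra.
    case: c cS rc => [||i] cS rc /=; try exact: lt_trans lt2.
    have -> : s * r (cu i) - s0 * p (cu i) =
      s * (r (cu i) - p (cu i)) + (s - s0) * p (cu i) by ring.
    rewrite (splitr d0); apply: le_lt_trans (ler_normD _ _) _.
    rewrite !normrM (ger0_norm s_ge0) ler_ltD//.
      apply: le_trans (ltW rc); rewrite ler_piMl//.
    have pB : `|p (cu i)| <= B.
      by rewrite /B (big_rem (cu i))//= addrCA lerDl addr_ge0// sumr_ge0.
    apply: le_lt_trans (_ : `|s - s0| * B < _); first by rewrite ler_wpM2l.
    by rewrite -ltr_pdivlMr.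
  have h1 : `|sfval f (scale s q) - sfval f (scale s0 p)| < e / 2.
    by apply: cl => c /qd h; exact: lt_trans dd.
  have h2 : `|sfval f (scale s p) - sfval f (scale s0 p)| < e / 2.
    by apply: cl => c _; rewrite subrr normr0.
  rewrite (splitr e) -(subrKA (sfval f (scale s0 p))).
  by apply: le_lt_trans (ler_normD _ _) _; rewrite ltrD// distrC.
move=> nP; have [d [d0 dP]] : exists d : R, 0 < d /\ `[0, 1] `<=` P d.
  have /filter_ex [d [d0 dP]] : \forall d \near (0 : R)^'+,
      0 < d /\ `[0, 1] `<=` P d.
    by apply: filterI => //; exact: nbhs_right_gt.
  by exists d.
exists d => // q qd s s01; apply: (dP s) => //.
Qed.

Definition radial_int (m : nat) f : (C -> R) -> R := fun p =>
  int01 (fun s : R => s ^+ m * sfval f (scale s p)).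

Lemma radial_continuous (m : nat) f p : continuous (fun s : R => s ^+ m * sfval f (scale s p)).
Proof.
move=> s; apply: (@continuousM R R (fun s : R => s ^+ m) (fun s => sfval f (scale s p))).
  exact: exprn_continuous.
exact: scale_continuous.
Qed.

Lemma radial_int_dist m f p q (e : R) :
  (forall s, 0 <= s <= 1 -> `|sfval f (scale s q) - sfval f (scale s p)| <= e) ->
  `|radial_int m f q - radial_int m f p| <= e.
Proof.
move=> fe; have cm r : continuous (fun s : R => s ^+ m * sfval f (scale s r)).
  exact: radial_continuous.
have -> : radial_int m f q - radial_int m f p = int01 (fun s : R =>
    s ^+ m * sfval f (scale s q) + (-1) * (s ^+ m * sfval f (scale s p))).
  rewrite int01D ?int01Z ?mulN1r//.
  by apply: continuous_scale; exact: cm.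
apply: int01_le => [|s s01].
  by apply: continuous_add; [exact: cm|apply: continuous_scale; exact: cm].
rewrite mulN1r -mulrBr normrM; apply: le_trans (fe s s01).
case/andP: s01 => s0 s1; rewrite ler_piMl// ger0_norm ?exprn_ge0//.
by rewrite exprn_ile1.
Qed.

Lemma nbhs_box (S : seq C) p (d : R) : 0 < d ->
  \forall q \near (p : {ptws C -> R}), {in S, forall c, `|q c - p c| < d}.
Proof.
move=> d0; have FF := @nbhs_filter {ptws C -> R} p.
elim: S => [|c S IH].
  by apply: (@filterS _ _ FF setT) (@filterT _ _ FF) => q _ c.
have /cvgrPdist_lt/(_ d d0) nc := @cvg_coord R C p c.
apply: (@filterS _ _ FF _ _ _ (@filterI _ _ FF _ _ nc IH)) => q [qc qS] c'.
rewrite inE => /orP[/eqP->|cS]; last exact: qS.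
by rewrite distrC.
Qed.

Definition is_cu (c : C) : nat := if c is cu _ then 1 else 0.

Lemma is_derive_scale_upd f p c (s x : R) :
  is_derive x 1 (fun x => sfval f (scale s (upd p c x)))
    (s ^+ is_cu c * sfval (spd c f) (scale s (upd p c x))).
Proof.
have df : pderivable c (sfval f) by apply: smooth_pderivable; exact: sfvalP.
have E y : scale s (upd p c y) = upd (scale s p) c (s ^+ is_cu c * y).
  apply/funext => d; rewrite updE.
  case: c {df} => [||i]; case: d => [||j];
    rewrite /= ?updE /= ?expr0 ?mul1r ?expr1// cu_eq.
  by case: ifP.
under eq_fun do rewrite E.
rewrite E mulrC; apply: (@is_derive1_comp _ (fun y => sfval f (upd (scale s p) c y))).
  exact: is_derive_upd.
rewrite -[X in is_derive _ _ _ X]mulr1.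
exact: is_deriveZ.
Qed.

(** Differentiation under the integral sign: by the mean value theorem the
    remainder is bounded through the uniform continuity of the derivative. The
    power of [s] records that a dependent variable has been scaled. *)
Lemma is_derive_radial_int m f p c :
  is_derive (p c) 1 (fun x => radial_int m f (upd p c x))
    (radial_int (m + is_cu c) (spd c f) p).
Proof.
have [S uS dS] := dep_uniq f.
apply: is_derive_eps => e e0.
have [d d0 dP] := scale_uniform p (dep_spd c dS) e0.
exists d => // x xd; rewrite upd_id.
have cm m' g r : continuous (fun s : R => s ^+ m' * sfval g (scale s r)).
  exact: radial_continuous.
rewrite -[radial_int (m + _) _ _ * _]mulrC.
have -> : radial_int m f (upd p c x) - radial_int m f p
    - (x - p c) * radial_int (m + is_cu c) (spd c f) p =
  int01 (fun s : R => (s ^+ m * sfval f (scale s (upd p c x))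
    + (-1) * (s ^+ m * sfval f (scale s p)))
    + - (x - p c) * (s ^+ (m + is_cu c) * sfval (spd c f) (scale s p))).
  rewrite int01D ?int01D ?int01Z ?mulN1r ?mulNr//.
  - by apply: continuous_scale; exact: cm.
  - by apply: continuous_add; [exact: cm|apply: continuous_scale; exact: cm].
  - by apply: continuous_scale; exact: cm.
apply: int01_le => [|s s01].
  apply: continuous_add; last by apply: continuous_scale; exact: cm.
  by apply: continuous_add; [exact: cm|apply: continuous_scale; exact: cm].
have [xi xile e1] := MVT_everywhere (p c) x (is_derive_scale_upd f p c s).
have -> : s ^+ m * sfval f (scale s (upd p c x))
    + (-1) * (s ^+ m * sfval f (scale s p))
    + - (x - p c) * (s ^+ (m + is_cu c) * sfval (spd c f) (scale s p)) =
  s ^+ (m + is_cu c) * ((sfval (spd c f) (scale s (upd p c xi))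
    - sfval (spd c f) (scale s p)) * (x - p c)).
  rewrite exprD; transitivity (s ^+ m * (sfval f (scale s (upd p c x))
    - sfval f (scale s (upd p c (p c)))) - (x - p c) * (s ^+ m * s ^+ is_cu c
    * sfval (spd c f) (scale s p))); first by rewrite upd_id; ring.
  by rewrite e1; ring.
have [s0 s1] := andP s01.
rewrite normrM; apply: le_trans (_ : `|(sfval (spd c f) (scale s (upd p c xi))
    - sfval (spd c f) (scale s p)) * (x - p c)| <= _).
  by rewrite ler_piMl// ger0_norm ?exprn_ge0// exprn_ile1.
rewrite normrM ler_wpM2r// ltW// dP// => c' _; rewrite updE.
by case: eqP => [->|_]; [exact: le_lt_trans xd|rewrite subrr normr0].
Qed.

Lemma radial_int_smooth m f : smooth (radial_int m f).
Proof.
pose P (g : (C -> R) -> R) := exists m f, g = radial_int m f.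
suff : forall h, P h -> smooth h by apply; exists m, f.
apply: smooth_coind => _ [{}m [{}f ->]].
have [S uS dS] := dep_uniq f; split.
- exists S => p q pq; rewrite /radial_int; congr int01; apply/funext => s.
  congr (_ * _); apply: dS => -[||i] cS /=; rewrite ?pq//.
- move=> p; have FF := @nbhs_filter {ptws C -> R} p.
  suff : radial_int m f @ (p : {ptws C -> R}) --> radial_int m f p by [].
  apply/cvgrPdist_le => e e0.
  have [d d0 dP] := scale_uniform p dS e0.
  apply: (@filterS _ _ FF _ _ _ (nbhs_box S p d0)) => q qd.
  rewrite distrC; apply: radial_int_dist => s s01; exact: ltW (dP q qd s s01).
- by move=> c; apply: pderivable_ex => p; eexists; exact: is_derive_radial_int.
- move=> c; exists (m + is_cu c)%N, (spd c f).
  by apply/funext => p; apply: pd_eq; exact: is_derive_radial_int.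
Qed.

(** Powers of [s] are kept as a parameter, because differentiation with respect
    to a dependent variable raises the exponent by one. *)
Definition homotopy m f : sf := SFun (radial_int_smooth m f).

Lemma spd_homotopy m f c : spd c (homotopy m f) = homotopy (m + is_cu c) (spd c f).
Proof. by apply: smfunP => p; apply: pd_eq; exact: is_derive_radial_int. Qed.

Lemma homotopyD m f g : homotopy m (f + g) = homotopy m f + homotopy m g.
Proof.
apply: smfunP => p; rewrite sfvalD /= /radial_int -int01D;
  [|exact: radial_continuous|exact: radial_continuous].
by congr int01; apply/funext => s; rewrite mulrDr.
Qed.

Lemma sf_coordE (c : C) p : sfval (sf_coord R c) p = p c.
Proof. by []. Qed.

Lemma homotopy_u m f i :
  homotopy m (sf_coord R (cu i) * f) = sf_coord R (cu i) * homotopy m.+1 f.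
Proof.
apply: smfunP => p; rewrite sfvalM.
rewrite sf_coordE [LHS]/= [X in _ * X]/= /radial_int -int01Z; last exact: radial_continuous.
by congr int01; apply/funext => s; rewrite sfvalM sf_coordE /= exprS; ring.
Qed.

Lemma homotopy0 m : homotopy m 0 = 0.
Proof. by apply: (addrI (homotopy m 0)); rewrite -homotopyD !addr0. Qed.

Lemma homotopyN m f : homotopy m (- f) = - homotopy m f.
Proof. by apply: (addrI (homotopy m f)); rewrite -homotopyD !subrr homotopy0. Qed.

Lemma homotopy_sum m (J : Type) (s : seq J) (F : J -> sf) :
  homotopy m (\sum_(j <- s) F j) = \sum_(j <- s) homotopy m (F j).
Proof. exact: (big_morph (homotopy m) (homotopyD m) (homotopy0 m)). Qed.

Lemma homotopy_sign m n f : homotopy m ((-1) ^+ n * f) = (-1) ^+ n * homotopy m f.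
Proof.
elim: n => [|n IH]; first by rewrite expr0 !mul1r.
by rewrite exprS -!mulrA !mulN1r homotopyN IH.
Qed.

Lemma jdep_homotopy m k f : jdep k f -> jdep k (homotopy m f).
Proof.
case=> uk dk; split=> // p q pq; rewrite /= /radial_int; congr int01.
apply/funext => s; congr (_ * _); apply: dk => c ck.
by have := pq c ck; case: c ck => [||i] ck /= ->.
Qed.

(** Total derivatives are homogeneous in the dependent variables. *)
Lemma tot_homotopy b sh m f : tot b sh (homotopy m f) = homotopy m (tot b sh f).
Proof.
have [k dk] := jdep_ex f.
have e0 (n : bool) g : homotopy m (n%:R * g) = n%:R * homotopy m g.
  by case: n; rewrite ?mul1r// !mul0r homotopy0.
rewrite /tot (jvfE _ dk) (jvfE _ (jdep_homotopy m dk)) !spd_homotopy /= addn0.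
rewrite !homotopyD !e0 homotopy_sum; congr (_ + _); apply: eq_bigr => i _.
by rewrite spd_homotopy /= addn1 homotopy_u.
Qed.

(** The homotopy integrates the derivative of [s |-> s f (s u)] over [0, 1]. *)
Lemma homotopy_radial k f : jdep k f ->
  homotopy 0 (f + \sum_(i <- k) sf_coord R (cu i) * spd (cu i) f) = f.
Proof.
move=> dk; apply: smfunP => p; rewrite /= /radial_int.
pose F (s : R) := s * sfval f (scale s p).
have F10 : sfval f p = F 1 - F 0.
  rewrite /F mul0r subr0 mul1r; congr (sfval f _).
  by apply/funext => -[||i] /=; rewrite ?mul1r.
rewrite F10; apply: int01_FTC; last exact: radial_continuous.
move=> s; apply: is_derive_eq (is_deriveM (is_derive_id s 1) (is_derive_scale p s dk)) _.
rewrite /GRing.scale /= mulr1 expr0 mul1r sfvalD sfval_sum addrC; congr (_ + _).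
by rewrite mulr_sumr; apply: eq_bigr => i _; rewrite sfvalM mulrA.
Qed.

End Scaling.

(** * The inverse problem of the calculus of variations *)

Section InverseProblem.
Context {R : realType}.
Local Notation sfj := (smfun R jcoord2).
Implicit Types (D : sfj).

Lemma Pk_homotopy k m D : Pk k (homotopy m D) = homotopy m (Pk k D).
Proof.
rewrite /Pk homotopy_sign; congr (_ * _); rewrite /Dk.
have H b sh n g : iter n (tot b sh) (homotopy m g) = homotopy m (iter n (tot b sh) g).
  by elim: n => //= n ->; rewrite tot_homotopy.
by rewrite /DX /DT !H.
Qed.

Lemma Dk_u k : Dk k (u_ (0%N, 0%N)) = u_ k :> sfj.
Proof.
rewrite /Dk.
have -> : iter k.1 DT (u_ (0%N, 0%N)) = u_ (k.1, 0%N) :> sfj.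
  by elim: k.1 => //= n ->; exact: tot_u.
by rewrite iter_DX_u add0n; case: k.
Qed.

(** The Volterra-Vainberg homotopy: an expression whose linearization is
    self-adjoint on [u] itself is the Euler-Lagrange expression of
    [u \int_0^1 D(s u) ds]. *)
Lemma self_adjoint_euler D :
  evs (u_ (0%N, 0%N)) D = ev (u_ (0%N, 0%N)) D ->
  Euler (u_ (0%N, 0%N) * homotopy 0 D) = D.
Proof.
move=> sa; have [s dD] := jdep_ex D.
rewrite /Euler evsM !mul1r.
have du : jdep [:: (0%N, 0%N)] (u_ (0%N, 0%N) : sfj).
  by split=> // p q; apply; rewrite cu_coords mem_head.
rewrite (evsE (homotopy 0 D) du) big_seq1 spd_coord eqxx mulr1 /Pk expr0 mul1r.
rewrite -[Dk _ _]/(homotopy 0 D) (evsE _ (jdep_homotopy 0 dD)).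
have -> : \sum_(k <- s) Pk k (u_ (0%N, 0%N) * spd (cu k) (homotopy 0 D)) =
    homotopy 0 (evs (u_ (0%N, 0%N)) D).
  rewrite (evsE _ dD) homotopy_sum; apply: eq_bigr => k _.
  by rewrite -Pk_homotopy homotopy_u spd_homotopy.
rewrite sa (evE _ dD) addrC -homotopyD -[RHS](homotopy_radial dD).
by congr (homotopy 0 (_ + _)); apply: eq_bigr => k _; rewrite Dk_u.
Qed.

End InverseProblem.

(** * The equivalences *)

Section Sufficiency.
Context {R : realType}.
Local Notation sf := (smfun R ecoord).
Variable K : sf.
Hypothesis K3 : order_le 3 K.
Hypothesis K3_neq0 : forall p, sfval (kd K 3) p != 0.

(** A positive density of [kappa] fulfils every condition: the relation
    [r_2 = D r_3] serves both the closure of [Sigma] and the cancellation of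
    [bracket2]. *)
Lemma log_eqs_admits (r : sf) : (forall p, 0 < sfval r p) ->
  log_eqs K3_neq0 r ->
  admits_symplectic (sfval K) (first_order_op (sfval r)) /\
  admits_variational (sfval K) (first_order_op (sfval r)).
Proof.
move=> r0 r_eqs; have [r3 r2] := log_symplectic K3 r0 r_eqs.
have [a0 b0] := (log_eqsP K3_neq0 r).2 r_eqs.
split; split.
- apply: symplectic_first_order => //; exists (fun=> 0).
  by rewrite gt_eqF.
- exact/(hamiltonianE r K3).
- exact: first_order_smooth.
exists (sfval (u_ (0%N, 0%N) * homotopy 0 (Delta K r))); split; first exact: sfvalP.
rewrite apply_opE eulerE self_adjoint_euler//.
apply/eqP; rewrite -subr_eq0 self_adjoint_defect// bracket2_eq0//.
by rewrite a0 b0 !(der0 X_der) tj0; apply/eqP; ring.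
Qed.

Lemma kappa_ln_admits (r : sf) (r0 : forall p, 0 < sfval r p) :
  kappa (sfval K) = dH (sfval K) (sfval (sf_ln r0)) ->
  admits_symplectic (sfval K) (first_order_op (sfval r)) /\
  admits_variational (sfval K) (first_order_op (sfval r)).
Proof.
rewrite (kappaE K3_neq0) /dH DxE TvfE => -[/sfun_val_inj Xf /sfun_val_inj Tf].
by apply: log_eqs_admits => //; exact: (log_eqs_ln (r0 := r0)).
Qed.

Fact sf_exp_key (f : sf) : smooth (fun p => expR (sfval f p)).
Proof.
by apply: elementary_smooth; apply: elem_exp; apply: elem_smooth; exact: sfvalP.
Qed.

(** The density is the exponential of the potential. *)
Lemma trivial_claw_admits : trivial_claw (sfval K) (kappa (sfval K)) ->
  exists r : sf, [/\ exists p, sfval r p != 0,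
    admits_symplectic (sfval K) (first_order_op (sfval r)) &
    admits_variational (sfval K) (first_order_op (sfval r))].
Proof.
case=> f0 [sf0 kf]; pose r : sf := SFun (sf_exp_key (SFun sf0)).
have r0 p : 0 < sfval r p by exact: expR_gt0.
have [] := @kappa_ln_admits r r0.
  by rewrite kf; congr dH; apply/funext => p; rewrite [RHS]expRK.
by exists r; split=> //; exists (fun=> 0); rewrite gt_eqF.
Qed.

End Sufficiency.

Theorem theorem1p4 (R : realType) (K : efun R)
  (hK : smooth K)
  (hKord : depends_on
     [:: ct; cx; cu 0%N; cu 1%N; cu 2%N; cu 3%N] K)
  (hK3 : forall p : ecoord -> R, pd (cu 3%N) K p != 0) :
  [/\ ((exists r : efun R, [/\ smooth r, (exists p, r p != 0)
          & admits_symplectic K (first_order_op r)])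
       <-> trivial_claw K (kappa K)),
      ((exists r : efun R, [/\ smooth r, (exists p, r p != 0)
          & admits_variational K (first_order_op r)])
       <-> trivial_claw K (kappa K))
    & forall r : efun R, smooth r -> (forall p, 0 < r p) ->
        kappa K = dH K (fun p => ln (r p)) ->
        admits_symplectic K (first_order_op r) /\
        admits_variational K (first_order_op r)].
Proof.
pose Ks : smfun R ecoord := SFun hK.
have dK : dep [:: ct; cx; cu 0%N; cu 1%N; cu 2%N; cu 3%N] Ks := hKord.
have K3 : order_le 3 Ks.
  by move=> i i3; apply: (spd_indep dK); rewrite !inE /= !cu_eq; lia.
have K3_neq0 p : sfval (kd Ks 3) p != 0 by exact: hK3.
rewrite -[K]/(sfval Ks); split.
- split=> [[r [sr r0 [_ ham]]]|/(trivial_claw_admits K3 K3_neq0)].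
    pose rs : smfun R ecoord := SFun sr.
    apply: (log_eqs_trivial (r := rs) (K3_neq0 := K3_neq0)) => //.
    exact/log_eqsP/(hamiltonianE rs K3).
  by case=> r [r0 sym _]; exists (sfval r); split=> //; exact: sfvalP.
- split=> [[r [sr r0 var]]|/(trivial_claw_admits K3 K3_neq0)].
    pose rs : smfun R ecoord := SFun sr.
    apply: (log_eqs_trivial (r := rs) (K3_neq0 := K3_neq0)) => //.
    exact/log_eqsP/(variational_necessary K3 (r := rs)).
  by case=> r [r0 _ var]; exists (sfval r); split=> //; exact: sfvalP.
- move=> r sr r0; exact: (@kappa_ln_admits _ _ K3 K3_neq0 (SFun sr) r0).
Qed.
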